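(* Let $d\ge 3$. There exist constants $C<\infty$ and $c>0$ (depending only on $d$) such that for any $\alpha>0$, $\delta\in(0,1)$, integers $L,s\geq 1$, points $x_1,x_2\in\mathbb Z^d$ with $\|x_1-x_2\|=sL$, and any functions $f_1,f_2:\{0,1\}^{\mathbb Z^d}\to [0,1]$ such that, for $i\in\{1,2\}$, $f_i(\omega)$ only depends on the values $\omega_x$ with $\|x-x_i\|\leq L$, the following hold. 1. If $f_2$ is increasing, then $$\mathbb E^\alpha\left[f_1\,f_2\right] \leq \mathbb E^\alpha\left[f_1\right]\,\mathbb E^{\alpha+\delta}\left[f_2\right] + C\exp\left(\alpha-c\sqrt{\delta}\,s^{d-2}\right).$$ 2. If $f_2$ is decreasing, then $$\mathbb E^\alpha\left[f_1\,f_2\right] \leq \mathbb E^\alpha\left[f_1\right]\,\mathbb E^{(\alpha-\delta)_+}\left[f_2\right] + C\exp\left(\alpha-c\sqrt{\delta}\,s^{d-2}\right).$$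
   Context: $\|\cdot\|$ is the $\ell_\infty$-norm on $\mathbb Z^d$ and $t_+=\max(t,0)$. Random walk loop soup: a (non-trivial discrete) based loop is a nearest neighbor path $\dot\ell=(x_1,\dots,x_n)$ on $\mathbb Z^d$ such that $x_n$ is a neighbor of $x_1$. Two based loops of length $n$ are equivalent if they differ by a circular permutation of their vertices; equivalence classes are called loops. Let $\dot\mu(\dot\ell)=\frac1n\left(\frac1{2d}\right)^n$ for a based loop $\dot\ell=(x_1,\dots,x_n)$, and let $\mu$ be the push-forward of $\dot\mu$ to the space of loops. For $\alpha>0$, $\mathscr L^\alpha$ is the Poisson point process of loops with intensity measure $\alpha\mu$ (for $\alpha=0$ it is empty). The range $\mathcal R^\alpha$ is the set of vertices of $\mathbb Z^d$ visited by loops from $\mathscr L^\alpha$, and $\mathbb E^\alpha$ denotes expectation with respect to the distribution of $\{\mathbf 1_{x\in\mathcal R^\alpha}\}_{x\in\mathbb Z^d}$ on $\{0,1\}^{\mathbb Z^d}$. A function $f:\{0,1\}^{\mathbb Z^d}\to\mathbb R$ is increasing if $f(\omega)\le f(\omega')$ whenever $\omega_x\le\omega'_x$ for all $x$; it is decreasing if $-f$ is increasing. *)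

(* Defs.v *)
From HB Require Import structures.
From mathcomp Require Import all_boot all_order all_algebra.
From mathcomp Require Import all_classical all_reals all_analysis.
From mathcomp Require Import measurable_realfun generic_quotient.

Set Implicit Arguments.
Unset Strict Implicit.
Unset Printing Implicit Defensive.

Import Order.TTheory GRing.Theory Num.Theory.
Import numFieldNormedType.Exports.

Local Open Scope classical_set_scope.
Local Open Scope ring_scope.
Local Open Scope quotient_scope.

Definition neighbor (d : nat) : rel 'rV[int]_d :=
  fun x y => \sum_(i < d) `|x 0 i - y 0 i| == 1.

(* [cycle e [:: x_1; ...; x_n]] requires e x_1 x_2, ..., e x_(n-1) x_n and also
   e x_n x_1; it holds of the empty sequence, which is therefore excluded. *)
Definition is_based_loop (d : nat) : pred (seq 'rV[int]_d) :=
  fun s => (s != [::]) && cycle (@neighbor d) s.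

Definition based_loop (d : nat) := {s : seq 'rV[int]_d | is_based_loop s}.

Definition rot_equiv (d : nat) : rel (based_loop d) :=
  fun b b' => [exists k : 'I_(size (val b)), rot k (val b) == val b'].

Lemma rot_equivP (d : nat) (b b' : based_loop d) :
  reflect (exists k, rot k (val b) = val b') (rot_equiv b b').
Proof.
apply: (iffP existsP) => [[k /eqP <-]|[k kE]]; first by exists k.
have [kb|bk] := ltnP k (size (val b)); first by exists (Ordinal kb); apply/eqP.
have b0 : (0 < size (val b))%N.
  by case: b {kE bk} => -[|x s] /=; first by rewrite /is_based_loop.
by exists (Ordinal b0); rewrite /= rot0 -kE rot_oversize.
Qed.

Lemma rot_equiv_refl (d : nat) : reflexive (@rot_equiv d).
Proof. by move=> b; apply/rot_equivP; exists 0%N; rewrite rot0. Qed.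

Lemma rot_equiv_sym (d : nat) : symmetric (@rot_equiv d).
Proof.
suff sym b b' : @rot_equiv d b b' -> rot_equiv b' b.
  by move=> b b'; apply/idP/idP; apply: sym.
move=> /rot_equivP[k kE]; apply/rot_equivP; exists (size (val b') - k)%N.
by rewrite -kE -/(rotr k _) rotK.
Qed.

Lemma rot_equiv_trans (d : nat) : transitive (@rot_equiv d).
Proof.
move=> b2 b1 b3 /rot_equivP[k kE] /rot_equivP[m mE]; apply/rot_equivP.
by exists (rot_add (val b1) k m); rewrite -rot_rot_add kE.
Qed.

Canonical rot_equiv_rel (d : nat) := EquivRel (@rot_equiv d)
  (@rot_equiv_refl d) (@rot_equiv_sym d) (@rot_equiv_trans d).

Notation loop d := {eq_quot (@rot_equiv d)}.

Definition based_loop_weight (R : realType) (d : nat) (b : based_loop d) : R :=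
  (size (val b))%:R^-1 * ((2 * d)%:R^-1) ^+ size (val b).

Definition based_loop_measure (R : realType) (d : nat)
    (A : set (based_loop d)) : \bar R :=
  (\esum_(b in A) (based_loop_weight R b)%:E)%E.

Definition loop_measure (R : realType) (d : nat) (A : set (loop d)) : \bar R :=
  based_loop_measure R [set b : based_loop d | A (\pi_(loop d) b)].

Section poisson_point_process.
Context (R : realType) (d0 : measure_display) (Omega : measurableType d0).
Context (E : choiceType).

(* A random multiset of points of E is given by the multiplicity N w e of each
   point e; [point_count N A w] is the number of its points lying in A. *)
Definition point_count (N : Omega -> E -> nat) (A : set E) (w : Omega) : \bar R :=
  (\esum_(e in A) (N w e)%:R%:E)%E.

(* The state space E is meant to be countable, with the discrete
   sigma-algebra: all of its subsets are measurable.
   The second argument of [poisson_prob] is a dummy. *)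
Record poisson_point_process (P : probability Omega R) (nu : set E -> \bar R)
    (N : Omega -> E -> nat) : Prop := PoissonPointProcess {
  ppp_measurable : forall A : set E,
    measurable_fun [set: Omega] (point_count N A : Omega -> \bar R) ;
  ppp_poisson : forall A : set E, nu A \is a fin_num -> forall k : nat,
    P [set w | point_count N A w = k%:R%:E]
      = poisson_prob (fine (nu A)) k [set k] ;
  ppp_infinite : forall A : set E, nu A = +oo%E ->
    {ae P, forall w, point_count N A w = +oo%E} ;
  ppp_independent : forall (n : nat) (A : 'I_n -> set E),
    trivIset [set: 'I_n] A ->
    forall B : 'I_n -> set (\bar R), (forall i, measurable (B i)) ->
    P [set w | forall i, B i (point_count N (A i) w)]
      = (\prod_(i < n) P [set w | B i (point_count N (A i) w)])%E }.

End poisson_point_process.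

Definition loop_soup (R : realType) (d : nat) (d0 : measure_display)
    (Omega : measurableType d0) (P : probability Omega R) (alpha : R)
    (N : Omega -> loop d -> nat) : Prop :=
  poisson_point_process P (fun A => alpha%:E * loop_measure R A)%E N.

Definition cylinders (d : nat) : set (set ('rV[int]_d -> bool)) :=
  [set A | exists x, A = [set omega : 'rV[int]_d -> bool | omega x]].
Arguments cylinders : clear implicits.

Notation config d := (g_sigma_algebraType (cylinders d)).

Definition soup_range (d : nat) (n : loop d -> nat) : set 'rV[int]_d :=
  [set x | exists2 b : based_loop d,
             (0 < n (\pi_(loop d) b))%N & x \in val b].

Definition range_indicator (d : nat) (n : loop d -> nat) : config d :=
  fun x => x \in soup_range n.

Definition range_law (R : realType) (d : nat) (alpha : R)
    (Q : probability (config d) R) : Prop :=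
  exists (d0 : measure_display) (Omega : measurableType d0)
         (P : probability Omega R) (N : Omega -> loop d -> nat),
    loop_soup P alpha N /\
    forall A : set (config d), measurable A ->
      Q A = P [set w | A (range_indicator (N w))].

Definition increasing (R : realType) (d : nat) (f : config d -> R) : Prop :=
  forall omega omega' : config d,
    (forall x, (omega x <= omega' x)%N) -> f omega <= f omega'.

Definition decreasing (R : realType) (d : nat) (f : config d -> R) : Prop :=
  increasing (fun omega => - f omega).

Definition depends_on (R : realType) (d : nat) (f : config d -> R)
    (S : set 'rV[int]_d) : Prop :=
  forall omega omega' : config d,
    (forall x, S x -> omega x = omega' x) -> f omega = f omega'.

(* Main.v *)
Require Import Defs.
From HB Require Import structures.
From mathcomp Require Import all_boot all_order all_algebra.
From mathcomp Require Import all_classical all_reals all_analysis.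
From mathcomp Require Import measurable_realfun generic_quotient.
From mathcomp Require Import ring lra zify.

Set Implicit Arguments.
Unset Strict Implicit.
Unset Printing Implicit Defensive.

Import Order.TTheory GRing.Theory Num.Theory.
Import numFieldNormedType.Exports.

Local Open Scope classical_set_scope.
Local Open Scope ring_scope.

(**
  Let B1, B2 be the two boxes. Loops that hit B1 are sorted by their number n of
  excursions from B1 to the complement of a much larger concentric box. Bounds on
  the Green function, obtained from the explicit potential (|x|^2 + A)^(-(d-2)/2),
  show that the loops with n excursions have mass at most 4^-n, and that an
  excursion which meets B2 can be replaced by one which avoids B2 together with an
  additional loop avoiding B1, at the cost of a factor of order s^(-2(d-2)). Hence
  the trace of a loop with n excursions is dominated by that of a loop avoiding B2
  to which at most n traces of loops avoiding B1 are grafted, each with intensity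
  of order s^(-2(d-2)). Up to a total of m graftings their effect on f2 is bounded
  by that of a sprinkling of loops of intensity m^2 s^(-2(d-2)), which is below
  delta when m is of order sqrt delta s^(d-2); needing more than m graftings costs
  exp alpha (2/3)^m. The loops that hit only B1 or only B2 are independent.
  For decreasing f2 one first discards the loops hitting B1 and then compares the
  intensities alpha and alpha - delta by the increasing case.
*)

(** * Sums over countable sets *)

(** The comparison of excursions has to hold for each pair of endpoints in the first ball, not only
    on average. Reversing paths factorises the probability to hit a ball at a point x into the
    escape probability from x and a power of the distance, with the same escape factor in the upper
    and in the lower bound. This factor cancels when an excursion through the second ball is
    compared with a direct one, and the scale L drops out. A detour through the second ball is an
    arc, not a loop; closing it by an outer excursion adds no new vertex of either ball. A loop
    arises in this way once for each of its excursions from the second ball, so grafted loops carry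
    that number as a weight. Cutting it at m gives one factor m of m^2 s^(-2(d-2)); the number of
    graftings gives the other. As f1 and f2 see finitely many sites, a loop matters only through its
    trace, and Poisson expectations become exponentials of a union convolution on functions of
    finite sets. The law of the soup enters through void probabilities alone. Stopping times are
    prefix-free sets of finite paths, so that no measure on infinite paths is needed. *)

Section esum_extra.
Context {R : realType}.
Local Open Scope ereal_scope.

Lemma esum_subset (T : choiceType) (A B : set T) (f : T -> \bar R) :
  A `<=` B -> (forall t, 0 <= f t) ->
  \esum_(t in A) f t <= \esum_(t in B) f t.
Proof.
move=> AB f0; rewrite esum_mkcond [leRHS]esum_mkcond; apply: le_esum => t _.
case: ifPn => [/set_mem/AB/mem_set -> //|_].
by case: ifPn.
Qed.

Lemma esum_inj_le (T U : choiceType) (A : set T) (B : set U) (i : T -> U)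
    (f : T -> \bar R) (g : U -> \bar R) :
  (forall t, A t -> B (i t)) -> (forall t t', A t -> A t' -> i t = i t' -> t = t') ->
  (forall t, A t -> f t <= g (i t)) -> (forall u, 0 <= g u) ->
  \esum_(t in A) f t <= \esum_(u in B) g u.
Proof.
move=> AB iI fg g0; apply: (le_trans (le_esum fg)).
rewrite -(esum_image A i g); last first.
  by move=> x y /set_mem xA /set_mem yA; exact: iI.
by apply: esum_subset => // _ [t At <-]; exact: AB.
Qed.

Lemma esumZl (T : choiceType) (A : set T) (c : \bar R) (f : T -> \bar R) :
  0 <= c -> (forall t, 0 <= f t) ->
  \esum_(t in A) (c * f t) = c * \esum_(t in A) f t.
Proof.
have le_scale (r : R) (h : T -> \bar R) : (0 <= r)%R ->
    (forall t, 0 <= h t) ->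
    \esum_(t in A) (r%:E * h t) <= r%:E * \esum_(t in A) h t.
  move=> r0 h0; apply: ge_ereal_sup => _ [X [finX XA] <-].
  rewrite -ge0_mule_fsumr //.
  apply: lee_wpmul2l; first by rewrite lee_fin.
  by apply: ereal_sup_ubound; exists X.
move=> c0 f0; case: c c0 => // [r|_].
  rewrite lee_fin le_eqVlt => /orP[/eqP <-|r0].
    by rewrite mul0e esum1 // => t _; rewrite mul0e.
  apply/eqP; rewrite eq_le le_scale //=; last exact: ltW.
  rewrite -lee_pdivlMl //.
  have -> : \esum_(t in A) f t = \esum_(t in A) (r^-1%:E * (r%:E * f t)).
    apply: eq_esum => t _.
    by rewrite muleA -EFinM mulVf ?mul1e // gt_eqF.
  by rewrite le_scale ?invr_ge0 ?(ltW r0) // => t; rewrite mule_ge0 // lee_fin ltW.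
have [[t [At ft]]|nex] := pselect (exists t, A t /\ 0 < f t).
  transitivity (+oo : \bar R).
    apply/eqP; rewrite -leye_eq.
    apply: (@le_trans _ _ (+oo * f t)); first by rewrite gt0_mulye.
    rewrite -(@esum_set1 _ _ t (fun t => +oo * f t)) ?mule_ge0 //.
    by apply: esum_subset => [_ ->//|t']; rewrite mule_ge0.
  rewrite gt0_mulye //; apply: (lt_le_trans ft).
  by rewrite -(@esum_set1 _ _ t f) //; apply: esum_subset => // _ ->.
have f_eq0 t : A t -> f t = 0.
  move=> At; apply/eqP; rewrite eq_le f0 andbT leNgt.
  by apply/negP => ft; apply: nex; exists t.
rewrite !esum1 ?mule0 // => t At; rewrite f_eq0 ?mule0 //.
Qed.

Lemma esumZr (T : choiceType) (A : set T) (c : \bar R) (f : T -> \bar R) :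
  0 <= c -> (forall t, 0 <= f t) ->
  \esum_(t in A) (f t * c) = (\esum_(t in A) f t) * c.
Proof.
by move=> c0 f0; rewrite muleC -esumZl //; apply: eq_esum => t _; rewrite muleC.
Qed.

Lemma esum_exchange (T U : choiceType) (A : set T) (B : set U)
    (f : T -> U -> \bar R) : (forall t u, 0 <= f t u) ->
  \esum_(t in A) \esum_(u in B) f t u = \esum_(u in B) \esum_(t in A) f t u.
Proof.
move=> f0; rewrite (@esum_esum _ _ _ A (fun=> B)) // (@esum_esum _ _ _ B (fun=> A)) //.
apply: (@reindex_esum _ _ _ _ _ (fun k => (k.2, k.1))); split.
- by move=> [t u] /= [].
- by move=> [t u] [t' u'] /= _ _ [-> ->].
- by move=> [t u] /= [At Bu]; exists (u, t).
Qed.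

Lemma esum_le_fin (T : choiceType) (A : set T) (f : T -> \bar R) (M : \bar R) :
  (forall X, finite_set X -> X `<=` A -> \esum_(t in X) f t <= M) ->
  (forall t, 0 <= f t) -> \esum_(t in A) f t <= M.
Proof.
move=> h f0; apply: ge_ereal_sup => _ [X [finX XA] <-].
by rewrite -esum_fset //; exact: h.
Qed.

(** Every finite set of sequences has bounded length, so a bound on the truncated sums, usually
    obtained by induction on the length, is enough. *)
Lemma esum_le_size (T : choiceType) (A : set (seq T)) (f : seq T -> \bar R)
    (M : \bar R) :
  (forall n, \esum_(p in [set p | A p /\ (size p <= n)%N]) f p <= M) ->
  (forall p, 0 <= f p) -> \esum_(p in A) f p <= M.
Proof.
move=> h f0; apply: esum_le_fin => // X finX XA.
pose n := (\max_(p <- finmap.enum_fset (fset_set X)) size p)%N.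
apply: le_trans (h n); apply: esum_subset => // p Xp; split; first exact: XA.
have pX : p \in finmap.enum_fset (fset_set X) by rewrite in_fset_set // mem_set.
exact: leq_bigmax_seq.
Qed.

Lemma esum_seq (T : choiceType) (r : seq T) (f : T -> \bar R) :
  uniq r -> (forall t, 0 <= f t) ->
  \esum_(t in [set` r]) f t = \sum_(t <- r) f t.
Proof. by move=> ur f0; rewrite fsbig_seq // esum_fset. Qed.

Lemma esum_fintype (T : finType) (f : T -> \bar R) : (forall t, 0 <= f t) ->
  \esum_(t in [set: T]) f t = \sum_t f t.
Proof.
move=> f0; rewrite -big_enum -esum_seq ?enum_uniq //; congr (esum _ _).
by apply/seteqP; split => t //= _; rewrite mem_enum.
Qed.

Lemma esum_fiber (T U : choiceType) (A : set T) (h : T -> U)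
    (f : T -> \bar R) : (forall t, 0 <= f t) ->
  \esum_(t in A) f t = \esum_(u in [set: U]) \esum_(t in [set t | A t /\ h t = u]) f t.
Proof.
move=> f0; rewrite (@esum_esum _ _ _ setT (fun u => [set t | A t /\ h t = u])
   (fun u t => f t)) //.
apply: (@reindex_esum _ _ _ _ _ (fun k => k.2)); split.
- by move=> [u t] /= [_ []].
- move=> [u t] [u' t'] /set_mem /= [_ [_ <-]] /set_mem /= [_ [_ <-]] /=.
  by move=> ->.
- by move=> t At; exists (h t, t).
Qed.

End esum_extra.

(** * Weights of nearest neighbour paths *)

Section neighbors.
Variable d : nat.
Notation V := 'rV[int]_d.
Notation e_ i := (delta_mx 0 i : V).

Lemma neighborC : symmetric (@neighbor d).
Proof.
by move=> x y; rewrite /neighbor; under eq_bigr do rewrite distrC.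
Qed.

Definition nbrs (x : V) : seq V :=
  [seq x + e_ i | i <- enum 'I_d] ++ [seq x - e_ i | i <- enum 'I_d].

Lemma delta_inj (i j : 'I_d) : e_ i = e_ j -> i = j.
Proof.
move=> /matrixP /(_ 0 i); rewrite !mxE !eqxx /=.
by case: eqP => //.
Qed.

Lemma delta_neq (i j : 'I_d) : e_ i <> - e_ j.
Proof.
move=> /matrixP /(_ 0 i); rewrite !mxE !eqxx /=.
by case: eqP.
Qed.

Lemma uniq_nbrs x : uniq (nbrs x).
Proof.
have inj1 : injective (fun i => x + e_ i) by move=> i j /addrI /delta_inj.
have inj2 : injective (fun i => x - e_ i) by move=> i j /addrI /oppr_inj /delta_inj.
rewrite cat_uniq !(map_inj_uniq inj1, map_inj_uniq inj2) !enum_uniq andbT /=.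
apply/hasPn => _ /mapP[i _ ->]; apply/mapP => -[j _].
by move=> /addrI /esym /delta_neq.
Qed.

Lemma sum_delta (i : 'I_d) : \sum_(j < d) `|(e_ i) 0 j| = 1.
Proof.
rewrite (bigD1 i) //= !mxE !eqxx normr1 big1 ?addr0 // => j /negbTE ji.
by rewrite !mxE ji andbF normr0.
Qed.

Lemma mem_nbrs x y : (y \in nbrs x) = neighbor x y.
Proof.
rewrite mem_cat /neighbor; apply/idP/idP => [/orP[] /mapP[i _ ->]|].
- rewrite (eq_bigr (fun j => `|(e_ i) 0 j|)) ?sum_delta // => j _.
  by rewrite !mxE opprD addNKr normrN.
- rewrite (eq_bigr (fun j => `|(e_ i) 0 j|)) ?sum_delta // => j _.
  by rewrite !mxE opprD addNKr opprK.
move=> /eqP sum1.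
have [/existsP[i xyi]|] := boolP [exists i : 'I_d, x 0 i != y 0 i]; last first.
  rewrite negb_exists => /forallP h; move: sum1; rewrite big1 // => i _.
  by have := h i; rewrite negbK => /eqP ->; rewrite subrr normr0.
move: sum1; rewrite (bigD1 i) //=.
set r := (X in _ + X) => sum1.
have r0 : 0 <= r by apply: sumr_ge0.
have xi : 1 <= `|x 0 i - y 0 i| by rewrite -gtz0_ge1 normr_gt0 subr_eq0.
have r00 : r = 0 by apply/eqP; rewrite eq_le r0 andbT -(lerD2l 1) addr0 -[leRHS]sum1 lerD2r.
have xi1 : `|x 0 i - y 0 i| = 1 by rewrite r00 addr0 in sum1.
have xj j : j != i -> x 0 j = y 0 j.
  move=> ji; apply/eqP; rewrite -subr_eq0 -normr_eq0; apply/eqP.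
  exact: (psumr_eq0P _ r00).
have yE (c : int) : y 0 i - x 0 i = c -> y = x + c *: e_ i.
  move=> h; apply/matrixP => k j; rewrite ord1 !mxE eqxx /=.
  have [->|/xj ->] := eqVneq j i; last by rewrite mulr0 addr0.
  by rewrite mulr1 -h addrC subrK.
apply/orP; have /orP[/eqP h|/eqP h] : (y 0 i - x 0 i == 1) || (y 0 i - x 0 i == -1).
    by rewrite -(andbT (_ || _)) -[X in _ && X](@ler01 int) -eqr_norml distrC xi1.
  by left; apply/mapP; exists i; rewrite ?mem_enum // (yE _ h) scale1r.
by right; apply/mapP; exists i; rewrite ?mem_enum // (yE _ h) scaleN1r.
Qed.

End neighbors.

Section walks.
Context (R : realType) (d : nat).
Notation V := 'rV[int]_d.
Notation e_ i := (delta_mx 0 i : V).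
Local Open Scope ereal_scope.

(** The starting vertex [x] is not listed in [p], so that paths compose by plain concatenation.
    Sequences that are not paths get weight 0, and sums may range over all sequences. *)
Definition pweight (x : V) (p : seq V) : R :=
  if path (@neighbor d) x p then ((2 * d)%:R^-1 ^+ size p)%R else 0%R.

Definition weight (x : V) (p : seq V) : \bar R := (pweight x p)%:E.

Lemma weight_ge0 x p : 0 <= weight x p.
Proof.
by rewrite lee_fin /pweight; case: ifP => // _; rewrite exprn_ge0 // invr_ge0.
Qed.
Hint Resolve weight_ge0 : core.

Lemma weight_nil x : weight x [::] = 1. Proof. by rewrite /weight /pweight /= expr0. Qed.

Lemma weight_cat x p q : weight x (p ++ q) = weight x p * weight (last x p) q.
Proof.
rewrite /weight /pweight -EFinM cat_path size_cat exprD.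
by case: (path _ x p) => /=; case: (path _ _ q); rewrite ?mulr0 ?mul0r.
Qed.

Lemma weight_rev x p : weight (last x p) (rev (belast x p)) = weight x p.
Proof.
rewrite /weight /pweight rev_path size_rev size_belast.
by rewrite (@eq_path _ _ (@neighbor d)) // => a b; rewrite neighborC.
Qed.

Lemma weight_path x p : ~~ path (@neighbor d) x p -> weight x p = 0.
Proof. by rewrite /weight /pweight => /negbTE ->. Qed.

(* Only genuine nearest neighbour paths have to be split. *)
Lemma split_le x (A B : set (seq V)) (C : seq V -> set (seq V))
    (phi : seq V -> \bar R) : (forall p, 0 <= phi p) ->
  (forall p, path (@neighbor d) x p -> A p ->
     exists q r, [/\ p = q ++ r, B q & C q r]) ->
  \esum_(p in A) (weight x p * phi p) <=
  \esum_(q in B) (weight x q * \esum_(r in C q) (weight (last x q) r * phi (q ++ r))).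
Proof.
move=> phi0 split.
under [leRHS]eq_esum do (rewrite -esumZl //; last by move=> ?; rewrite mule_ge0).
rewrite esum_esum; last by move=> *; rewrite !mule_ge0.
have /choice[i iP] : forall p, exists qr : seq V * seq V,
    path (@neighbor d) x p -> A p -> [/\ p = qr.1 ++ qr.2, B qr.1 & C qr.1 qr.2].
  move=> p; have [pp|] := pselect (path (@neighbor d) x p); last by exists ([::], [::]).
  have [Ap|] := pselect (A p); last by exists ([::], [::]).
  by have [q [r h]] := split p pp Ap; exists (q, r).
rewrite (_ : esum A _ = \esum_(p in A `&` [set p | path (@neighbor d) x p]) (weight x p * phi p)).
  apply: (esum_inj_le (i := i)).
  - by move=> p [Ap pp]; have [] := iP p pp Ap.
  - move=> p q [Ap pp] [Aq pq] ipq; have [-> _ _] := iP p pp Ap.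
    by have [-> _ _] := iP q pq Aq; rewrite ipq.
  - by move=> p [Ap pp]; have [pE _ _] := iP p pp Ap; rewrite muleA -weight_cat -pE.
  - by move=> k; rewrite !mule_ge0.
rewrite [RHS]esum_mkcondr; apply: eq_esum => p Ap.
by case: ifPn => //; rewrite notin_setE /= => /negP /weight_path ->; rewrite mul0e.
Qed.

(** For this direction the cutting point [q] must be recoverable from [q ++ r]; otherwise the left
    side would count the same path several times. *)
Lemma split_ge x (A B : set (seq V)) (C : seq V -> set (seq V))
    (phi : seq V -> \bar R) : (forall p, 0 <= phi p) ->
  (forall q r, B q -> C q r -> path (@neighbor d) x (q ++ r) -> A (q ++ r)) ->
  (forall q r q' r', B q -> C q r -> B q' -> C q' r' -> q ++ r = q' ++ r' -> q = q') ->
  \esum_(q in B) (weight x q * \esum_(r in C q) (weight (last x q) r * phi (q ++ r))) <=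
  \esum_(p in A) (weight x p * phi p).
Proof.
move=> phi0 join uniq.
under eq_esum do (rewrite -esumZl //; last by move=> ?; rewrite mule_ge0).
rewrite esum_esum; last by move=> *; rewrite !mule_ge0.
rewrite (_ : esum _ _ = \esum_(k in (B `*`` C) `&` [set k | path (@neighbor d) x (k.1 ++ k.2)])
   (weight x k.1 * (weight (last x k.1) k.2 * phi (k.1 ++ k.2)))).
  apply: (esum_inj_le (i := fun k => k.1 ++ k.2)).
  - by move=> [q r] /= [[Bq Cr] pp]; exact: join.
  - move=> [q r] [q' r'] /= [[Bq Cr] _] [[Bq' Cr'] _] e.
    have qq := uniq _ _ _ _ Bq Cr Bq' Cr' e; move: e; rewrite qq => /eqP.
    by rewrite eqseq_cat // eqxx => /eqP ->.
  - by move=> [q r] _; rewrite weight_cat muleA.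
  - by move=> k; rewrite !mule_ge0.
rewrite [RHS]esum_mkcondr; apply: eq_esum => -[q r] /= _.
case: ifPn => //; rewrite notin_setE /= => /negP /weight_path.
by rewrite weight_cat muleA => ->; rewrite mul0e.
Qed.

(** A stopping time, encoded by the set of paths at which it stops: no stopped path properly extends
    another one. *)
Definition prefix_free (F : set (seq V)) := forall p q, F p -> F (p ++ q) -> q = [::].

Lemma prefix_free_uniq F q r q' r' : prefix_free F -> F q -> F q' ->
  q ++ r = q' ++ r' -> q = q'.
Proof.
move=> pf.
wlog qq' : q r q' r' / (size q <= size q')%N.
  move=> h Fq Fq' e; have [qq'|/ltnW qq'] := leqP (size q) (size q').
    exact: (h q r q' r').
  by apply/esym; apply: (h q' r' q r).
move=> Fq Fq' e; have q'E : q' = q ++ drop (size q) q'.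
  rewrite -{1}[q'](cat_take_drop (size q)); congr (_ ++ _).
  have := congr1 (take (size q)) e; rewrite take_size_cat // takel_cat //.
by have := pf q (drop (size q) q') Fq; rewrite -q'E => /(_ Fq') h; rewrite q'E h cats0.
Qed.

Definition step1 : set (seq V) := [set p | size p = 1%N].

Definition superharmonic (psi : V -> \bar R) :=
  forall x, \esum_(q in step1) (weight x q * psi (last x q)) <= psi x.

(** Optional stopping for nonnegative superharmonic functions. The induction runs on the length
    bound: after a first step [q] the continuations [[set r | F (q ++ r)]] are again prefix free,
    and the step itself is paid for by superharmonicity. *)
Lemma stop_le F psi x : prefix_free F -> (forall x, 0 <= psi x) -> superharmonic psi ->
  \esum_(p in F) (weight x p * psi (last x p)) <= psi x.
Proof.
move=> pf psi0 sh; apply: esum_le_size; last by move=> p; rewrite mule_ge0.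
move=> n; elim: n => [|n IH] in F pf x *.
  rewrite (le_trans (esum_subset (B := [set [::]]) _ _)) //.
  - by move=> p [_]; rewrite leqn0 => /nilP.
  - by move=> p; rewrite mule_ge0.
  - by rewrite esum_set1 ?mule_ge0 // weight_nil mul1e.
have [F0|nF0] := pselect (F [::]).
  rewrite (le_trans (esum_subset (B := [set [::]]) _ _)) //.
  - by move=> p [Fp _]; exact: (pf _ _ F0).
  - by move=> p; rewrite mule_ge0.
  - by rewrite esum_set1 ?mule_ge0 // weight_nil mul1e.
apply: le_trans (sh x).
apply: (le_trans (split_le (B := step1)
  (C := fun q => [set r | F (q ++ r) /\ (size r <= n)%N])
  (phi := fun p => psi (last x p)) _ _)) => //.
  move=> [|y p] _ [Fp sp] //; exists [:: y], p; split => //.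
apply: le_esum => q q1; apply: lee_wpmul2l => //.
under eq_esum do rewrite last_cat.
apply: (IH [set r | F (q ++ r)]).
by move=> a b /= Fa Fab; apply: (pf (q ++ a)); rewrite -?catA.
Qed.

Lemma step1E (phi : V -> \bar R) x : (forall y, 0 <= phi y) ->
  \esum_(q in step1) (weight x q * phi (last x q)) =
  ((2 * d)%:R^-1)%:E * \sum_(y <- nbrs x) phi y.
Proof.
move=> phi0.
have -> : \esum_(q in step1) (weight x q * phi (last x q)) =
    \esum_(y in [set: V]) (weight x [:: y] * phi y).
  rewrite (reindex_esum [set: V] step1 (fun y => [:: y])) //; split => //.
  - by move=> y y' _ _ [].
  - by move=> [|y [|//]] //= _; exists y.
rewrite -esum_seq ?uniq_nbrs // -esumZl // [RHS]esum_mkcond.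
apply: eq_esum => y _; rewrite /weight /pweight /= andbT -mem_nbrs.
by rewrite mem_setE; case: (y \in _); rewrite ?expr1 ?mul0e.
Qed.

Lemma sum_nbrs (T : nmodType) (phi : V -> T) x :
  (\sum_(y <- nbrs x) phi y = \sum_(i < d) (phi (x + e_ i) + phi (x - e_ i)))%R.
Proof. by rewrite /nbrs big_cat /= !big_map big_split; congr (_ + _)%R; rewrite big_enum. Qed.

Lemma superharmonic1 : superharmonic (fun=> 1).
Proof.
move=> x; rewrite (step1E (phi := fun=> 1)) // sumEFin -EFinM sum_nbrs sumr_const.
rewrite card_ord lee_fin (_ : (1 + 1) *+ d = (2 * d)%:R)%R; last by rewrite mulrnA.
have [->|d0] := posnP d; first by rewrite muln0 mulr0.
by rewrite mulVf // pnatr_eq0 muln_eq0 /= -lt0n.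
Qed.

End walks.
#[global] Hint Extern 0 (is_true (@Order.le _ _ _ (@weight _ _ _ _))) => solve [exact: weight_ge0] : core.

(** * A superharmonic potential *)

Section taylor.
Context {R : realType}.
Implicit Types (u t h : R) (k : nat).

Definition isqrt t : R := (Num.sqrt t)^-1.

(** No derivative is used. For the Taylor polynomial [p] one has [p ^+ 2 * (1 + u) = 1 + u ^+ 4 * q]
    with [q] bounded by 1, while [w ^+ 2 * (1 + u) = 1]. Subtracting gives [w - p] as [- u ^+ 4 * q]
    divided by [(w + p) * (1 + u)], which is at least 1/4. *)
Lemma isqrt_taylor1 u : `|u| <= 2^-1 ->
  `|isqrt (1 + u) - (1 - u / 2 + 3 / 8 * u ^+ 2 - 5 / 16 * u ^+ 3)| <= 4 * u ^+ 4.
Proof.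
move=> hu; have /andP[u1 u2] : - 2^-1 <= u <= 2^-1 by rewrite -ler_norml.
set p := 1 - _ + _ - _; set w := isqrt _.
have w0 : 0 < w by rewrite invr_gt0 sqrtr_gt0; lra.
have ww : w ^+ 2 * (1 + u) = 1.
  by rewrite exprVn sqr_sqrtr ?mulVf //; [rewrite gt_eqF //; lra|lra].
have u2b : u ^+ 2 <= 4^-1 by nra.
have p0 : 2^-1 <= p by rewrite /p; nra.
pose q : R := - 35 / 64 + 14 / 64 * u - 35 / 256 * u ^+ 2 + 25 / 256 * u ^+ 3.
have pE : p ^+ 2 * (1 + u) = 1 + u ^+ 4 * q by rewrite /p /q; field.
have u3 : u ^+ 3 = u * u ^+ 2 by rewrite exprS.
have uu : 0 <= u ^+ 2 by exact: sqr_ge0.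
have q1 : `|q| <= 1 by rewrite ler_norml /q u3; apply/andP; split; nra.
have key : (w - p) * ((w + p) * (1 + u)) = - (u ^+ 4 * q).
  have -> : (w - p) * ((w + p) * (1 + u)) = w ^+ 2 * (1 + u) - p ^+ 2 * (1 + u) by ring.
  by rewrite ww pE; ring.
have wp : 4^-1 <= (w + p) * (1 + u) by nra.
have u4 : 0 <= u ^+ 4 by rewrite exprn_even_ge0.
have : `|w - p| * ((w + p) * (1 + u)) <= u ^+ 4.
  rewrite -[X in _ * X]ger0_norm; last by lra.
  rewrite -normrM key normrN normrM (ger0_norm u4).
  by rewrite ler_piMr.
have := normr_ge0 (w - p); nra.
Qed.

(** Cubic Taylor polynomial of (1 + u)^(-k/2). *)
Definition taylor3 k u : R := 1 - k%:R / 2 * u + k%:R * (k%:R + 2) / 8 * u ^+ 2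
   - k%:R * (k%:R + 2) * (k%:R + 4) / 48 * u ^+ 3.

Lemma isqrt_taylor k : exists2 C : R, 0 <= C & forall u, `|u| <= 2^-1 ->
  `|isqrt (1 + u) ^+ k - taylor3 k u| <= C * u ^+ 4.
Proof.
elim: k => [|k [C C0 IH]].
  exists 0 => // u _; rewrite expr0 /taylor3 (_ : 1 - _ = 0) ?normr0 ?mul0r //.
  by field.
pose K : R := k%:R.
pose c2 : R := K * (K + 2) / 8; pose c3 : R := K * (K + 2) * (K + 4) / 48.
(* [a], [b] and [c] are the coefficients of degree 4, 5 and 6 of the product of [p] and [taylor3 k];
   its terms of lower degree are exactly [taylor3 k.+1]. *)
pose a : R := c3 / 2 + 3 / 8 * c2 + 5 / 32 * K.
pose b : R := - (3 / 8 * c3 + 5 / 16 * c2).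
pose c : R := 5 / 16 * c3.
exists (2 ^+ k * 4 + 2 * C + (`|a| + `|b| + `|c|)).
  by rewrite !addr_ge0 // ?mulr_ge0 // exprn_ge0.
move=> u hu; have /andP[u1 u2] : - 2^-1 <= u <= 2^-1 by rewrite -ler_norml.
have u4 : 0 <= u ^+ 4 by rewrite exprn_even_ge0.
set w := isqrt (1 + u).
pose p := 1 - u / 2 + 3 / 8 * u ^+ 2 - 5 / 16 * u ^+ 3.
have -> : w ^+ k.+1 - taylor3 k.+1 u =
   w ^+ k * (w - p) + p * (w ^+ k - taylor3 k u) + u ^+ 4 * (a + b * u + c * u ^+ 2).
  by rewrite exprS /taylor3 /p /a /b /c /c2 /c3 /K -natr1; field.
have w0 : 0 < w by rewrite invr_gt0 sqrtr_gt0; lra.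
have w2 : w <= 2.
  have ww : w ^+ 2 * (1 + u) = 1.
    by rewrite exprVn sqr_sqrtr ?mulVf //; [rewrite gt_eqF //; lra|lra].
  rewrite leNgt; apply/negP => ?; nra.
have u3 : u ^+ 3 = u * u ^+ 2 by rewrite exprS.
have uu : 0 <= u ^+ 2 by exact: sqr_ge0.
have u2b : u ^+ 2 <= 4^-1 by nra.
have p2 : `|p| <= 2 by rewrite ler_norml /p u3; apply/andP; split; nra.
rewrite [leRHS]mulrDl [X in _ <= X + _]mulrDl; apply: (le_trans (ler_normD _ _)); apply: lerD.
  apply: (le_trans (ler_normD _ _)); apply: lerD.
    rewrite normrM -mulrA ler_pM // ?normr_ge0 ?isqrt_taylor1 //.
    rewrite ger0_norm ?exprn_ge0 ?(ltW w0) //.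
    by apply: lerXn2r; rewrite ?nnegrE ?(ltW w0).
  by rewrite normrM -mulrA ler_pM // IH.
rewrite normrM (ger0_norm u4) mulrC ler_wpM2r //.
apply: (le_trans (ler_normD _ _)); apply: lerD.
  apply: (le_trans (ler_normD _ _)); apply: lerD => //.
  by rewrite normrM ler_piMr //; lra.
by rewrite normrM ler_piMr // ger0_norm //; lra.
Qed.

Lemma isqrtM t u : 0 <= t -> isqrt (t * u) = isqrt t * isqrt u.
Proof. by move=> t0; rewrite /isqrt sqrtrM // invfM. Qed.

Lemma isqrt_gt0 t : 0 < t -> 0 < isqrt t.
Proof. by move=> t0; rewrite invr_gt0 sqrtr_gt0. Qed.

Lemma le_isqrt t u : 0 < t -> t <= u -> isqrt u <= isqrt t.
Proof.
move=> t0 tu; rewrite lef_pV2 ?posrE ?sqrtr_gt0 //; last exact: lt_le_trans tu.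
exact: ler_wsqrtr.
Qed.

Lemma isqrt_sqr t : 0 <= t -> isqrt (t ^+ 2) = t^-1.
Proof. by move=> t0; rewrite /isqrt sqrtr_sqr ger0_norm. Qed.

End taylor.

(** * The discrete Laplacian of the smoothed potential *)

Section potential.
Context {R : realType} (d : nat).
Notation V := 'rV[int]_d.
Notation e_ i := (delta_mx 0 i : V).
Notation k := (d - 2)%N.
Hypothesis hd : (3 <= d)%N.

Definition sqnorm (x : V) : R := \sum_(i < d) ((x 0 i)%:~R) ^+ 2.

Lemma sqnorm_ge0 x : 0 <= sqnorm x.
Proof. by apply: sumr_ge0 => i _; exact: sqr_ge0. Qed.

Lemma sqnormD x i : sqnorm (x + e_ i) = sqnorm x + 1 + 2 * (x 0 i)%:~R.
Proof.
rewrite /sqnorm (bigD1 i) //= [in RHS](bigD1 i) //= !mxE !eqxx /=.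
rewrite (eq_bigr (fun j => (x 0 j)%:~R ^+ 2 : R)); last first.
  by move=> j /negbTE ji; rewrite !mxE ji andbF addr0.
by rewrite intrD; ring.
Qed.

Lemma sqnormB x i : sqnorm (x - e_ i) = sqnorm x + 1 - 2 * (x 0 i)%:~R.
Proof.
rewrite /sqnorm (bigD1 i) //= [in RHS](bigD1 i) //= !mxE !eqxx /=.
rewrite (eq_bigr (fun j => (x 0 j)%:~R ^+ 2 : R)); last first.
  by move=> j /negbTE ji; rewrite !mxE ji andbF subr0.
by rewrite intrB; ring.
Qed.

Lemma sqnorm_coord (x : V) i : ((x 0 i)%:~R : R) ^+ 2 <= sqnorm x.
Proof.
rewrite /sqnorm (bigD1 i) //= lerDl sumr_ge0 // => j _; exact: sqr_ge0.
Qed.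

(* A smoothed version of |x|^(2-d), the decay of the Green function. *)
Definition potential (A : R) (x : V) : R := isqrt (sqnorm x + A) ^+ k.

(** The charge (1 - P) [potential], with P the transition operator of simple random walk. *)
Definition source (A : R) (x : V) : R :=
  potential A x - (2 * d)%:R^-1 * \sum_(y <- nbrs x) potential A y.

(** In the continuum, (|x|^2 + A)^(-k/2) with k = d - 2 has Laplacian exactly - k d A (|x|^2 +
    A)^(-k/2 - 2). Dividing by 2 d gives the main term with factor k A / 2. The lattice error has
    the same decay but a constant free of A, so it is at most half of the main term once A is
    large. *)
Lemma source_bounds : exists2 A0 : R, 6 <= A0 & forall A, A0 <= A -> forall x,
  k%:R * A / 4 * (potential A x / (sqnorm x + A) ^+ 2) <= source A x
   <= k%:R * A * (potential A x / (sqnorm x + A) ^+ 2).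
Proof.
have [C C0 tay] := isqrt_taylor (R := R) k.
pose K : R := k%:R; pose D : R := d%:R.
have DK : D = K + 2 by rewrite /D /K -natrD subnK //; exact: ltnW.
have K1 : 1 <= K by rewrite ler1n; lia.
pose c2 : R := K * (K + 2) / 8; pose c3 : R := K * (K + 2) * (K + 4) / 48.
have c20 : 0 <= c2 by rewrite /c2; nra.
have c30 : 0 <= c3 by rewrite /c3; nra.
(* [B / (2 * D)] bounds the lattice error in units of [t ^- 2]. It does not involve [A], and
   [A >= 2 * B] makes the error at most [K * A / 4] in the same units. *)
pose B := 2 * D * c2 + c3 * (2 * D + 24) + 200 * D * C.
have Dge0 : 0 <= D by rewrite ler0n.
have B0 : 0 <= B by rewrite /B !(addr_ge0, mulr_ge0) // ltW.
exists (6 + 2 * B); first by lra.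
move=> A hA x; set q := sqnorm x; set t := q + A.
have q0 : 0 <= q := sqnorm_ge0 x.
have A6 : 6 <= A by lra.
have t0 : 6 <= t by rewrite /t; lra.
have t1 : 0 < t by apply: lt_le_trans t0.
have tge0 := ltW t1; have tn : t != 0 by rewrite gt_eqF.
pose X i : R := (x 0 i)%:~R.
have Xq i : X i ^+ 2 <= q by exact: sqnorm_coord.
(* The sign [s] is 1 or -1 and selects the neighbour. With z = s X_i, the condition [6 <= A] gives
   2|z| + 1 <= (z^2 + 6) / 2, hence |u| <= 1/2; the factor 100 comes from (1 + 2z)^2 <= 10 t. *)
have pE i (s : R) : s ^+ 2 = 1 ->
    exists2 E, `|E| <= C * 100 / t ^+ 2 &
    isqrt (t + 1 + 2 * s * X i) ^+ k = isqrt t ^+ k * (taylor3 k ((1 + 2 * s * X i) / t) + E).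
  move=> s2; pose u := (1 + 2 * s * X i) / t.
  have sx : (s * X i) ^+ 2 <= q by rewrite exprMn s2 mul1r.
  have hu : `|u| <= 2^-1.
    rewrite normrM (@ger0_norm _ t^-1) ?invr_ge0; last by lra.
    rewrite ler_pdivrMr; last by lra.
    have := sqr_ge0 (s * X i - 2); have := sqr_ge0 (s * X i + 2).
    rewrite -(mulrA 2); move: (s * X i) sx => z sx h1 h2.
    by rewrite ler_norml /t; apply/andP; split; nra.
  exists (isqrt (1 + u) ^+ k - taylor3 k u).
    apply: (le_trans (tay _ hu)); rewrite -mulrA ler_wpM2l //.
    rewrite exprMn exprVn ler_pdivlMr ?exprn_gt0 //.
    have -> : (1 + 2 * s * X i) ^+ 4 / t ^+ 4 * t ^+ 2 =
       ((1 + 2 * s * X i) ^+ 2 / t) ^+ 2 by field.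
    rewrite (_ : 100 = 10 ^+ 2); last by ring.
    rewrite ler_sqr ?nnegrE; [|rewrite divr_ge0 ?sqr_ge0 //; lra|lra].
    rewrite ler_pdivrMr; last by lra.
    have := sqr_ge0 (s * X i - 2).
    rewrite -(mulrA 2); move: (s * X i) sx => z sx h1.
    by rewrite /t; nra.
  have -> : t + 1 + 2 * s * X i = t * (1 + u) by rewrite /u; field.
  by rewrite isqrtM ?exprMn; [congr (_ * _); ring|lra].
have /choice[Ep EpP] : forall i, exists E, `|E| <= C * 100 / t ^+ 2 /\
    isqrt (t + 1 + 2 * X i) ^+ k = isqrt t ^+ k * (taylor3 k ((1 + 2 * X i) / t) + E).
  move=> i; have [E h1 h2] := pE i 1 (expr1n _ _).
  by exists E; split => //; move: h2; rewrite mulr1.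
have /choice[Em EmP] : forall i, exists E, `|E| <= C * 100 / t ^+ 2 /\
    isqrt (t + 1 - 2 * X i) ^+ k = isqrt t ^+ k * (taylor3 k ((1 - 2 * X i) / t) + E).
  move=> i; have [|E h1 h2] := pE i (-1); first by rewrite sqrrN expr1n.
  by exists E; split => //; move: h2; rewrite mulrN1 mulNr.
pose S : R := \sum_(i < d) (Ep i + Em i).
have SE : `|S| <= 200 * D * C / t ^+ 2.
  rewrite /S; apply: (le_trans (ler_norm_sum _ _ _)).
  have -> : 200 * D * C / t ^+ 2 = \sum_(i < d) (200 * C / t ^+ 2).
    by rewrite sumr_const card_ord -[RHS]mulr_natl -/D; ring.
  apply: ler_sum => i _; have [h1 _] := EpP i; have [h2 _] := EmP i.
  by apply: (le_trans (ler_normD _ _)); lra.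
(* Adding opposite neighbours cancels the odd powers of the coordinates. By [D = K + 2] the terms of
   order 1/t and q/t^2 combine to - K D A / t^2, the only main term left. *)
have sumE : \sum_(y <- nbrs x) potential A y = isqrt t ^+ k *
   (2 * D - K * D * A / t ^+ 2 + 2 * D * c2 / t ^+ 2 - c3 * (2 * D + 24 * q) / t ^+ 3 + S).
  rewrite sum_nbrs; under eq_bigr => i _.
    rewrite /potential sqnormD sqnormB -/q.
    rewrite (_ : q + 1 + 2 * (x 0 i)%:~R + A = t + 1 + 2 * X i); last by rewrite /t /X; ring.
    rewrite (_ : q + 1 - 2 * (x 0 i)%:~R + A = t + 1 - 2 * X i); last by rewrite /t /X; ring.
    have [_ ->] := EpP i; have [_ ->] := EmP i.
    rewrite -mulrDr.
    rewrite (_ : _ + _ = (2 - K / t + 2 * c2 / t ^+ 2 - 2 * c3 / t ^+ 3) +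
       (8 * c2 / t ^+ 2 - 24 * c3 / t ^+ 3) * (X i ^+ 2) + (Ep i + Em i)); last first.
      by rewrite /taylor3 -/K /c2 /c3; field.
    over.
  rewrite -mulr_sumr big_split /= -/S big_split /= -mulr_sumr -/(sqnorm x) -/q.
  rewrite sumr_const card_ord -[X in X + _ + S]mulr_natl -/D; congr (_ * (_ + _)).
  have -> : A = t - q by rewrite /t; ring.
  by rewrite /c2 /c3 DK; field.
have D0 : 0 < D by lra.
have Dn : D != 0 by rewrite gt_eqF.
have D2 : 0 < 2 * D by rewrite mulr_gt0.
pose E := (2 * D * c2 / t ^+ 2 - c3 * (2 * D + 24 * q) / t ^+ 3 + S) / (2 * D).
have sE : source A x = isqrt t ^+ k * (K * A / (2 * t ^+ 2) - E).
  rewrite /E /source sumE natrM -/D /potential -/q -/t; field.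
  by rewrite tn Dn.
have p0 : 0 <= isqrt t ^+ k by rewrite exprn_ge0 // ltW // isqrt_gt0 //; lra.
have Ebound : `|E| <= B / (2 * D) / t ^+ 2.
  rewrite normrM (@ger0_norm _ (2 * D)^-1); last by rewrite invr_ge0 ltW.
  rewrite [leRHS]mulrAC ler_wpM2r ?invr_ge0 ?(ltW D2) //.
  rewrite /B [leRHS]mulrDl [X in _ <= X + _]mulrDl.
  apply: (le_trans (ler_normD _ _)); apply: lerD => //.
  apply: (le_trans (ler_normB _ _)); apply: lerD.
    by rewrite ger0_norm // divr_ge0 ?exprn_ge0 ?(mulr_ge0 (ltW D2)).
  rewrite ger0_norm; last by rewrite divr_ge0 ?exprn_ge0 // !(mulr_ge0, addr_ge0).
  rewrite -[leLHS]mulrA -[leRHS]mulrA ler_wpM2l // ler_pdivrMr; last by rewrite exprn_gt0.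
  have -> : (2 * D + 24) / t ^+ 2 * t ^+ 3 = (2 * D + 24) * t.
    by field.
  by rewrite /t; nra.
have BA : B / (2 * D) / t ^+ 2 <= K * A / 4 / t ^+ 2.
  rewrite ler_wpM2r ?invr_ge0 ?exprn_ge0 //.
  rewrite ler_pdivrMr //.
  have -> : K * A / 4 * (2 * D) = A / 2 * (K * D) by field.
  apply: (@le_trans _ _ (A / 2)); first by lra.
  have A0 : 0 <= A by apply: le_trans A6.
  rewrite ler_peMr ?divr_ge0 // -[leLHS]mulr1 ler_pM // DK.
  by rewrite (le_trans K1) // lerDl.
rewrite /potential -/q -/t sE.
clearbody E.
have /andP[E1 E2] : - (K * A / 4 / t ^+ 2) <= E <= K * A / 4 / t ^+ 2.
  by rewrite -ler_norml; exact: le_trans Ebound BA.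
have h : K * A / (2 * t ^+ 2) = 2 * (K * A / 4 / t ^+ 2).
  by field.
have KA : 0 <= K * A / 4 / t ^+ 2.
  by rewrite !divr_ge0 ?exprn_ge0 ?mulr_ge0 ?ler0n //; apply: le_trans A6.
apply/andP; split.
  by rewrite [leLHS]mulrCA ler_wpM2l //; lra.
rewrite [leRHS]mulrCA ler_wpM2l //.
have -> : K * A / t ^+ 2 = 4 * (K * A / 4 / t ^+ 2) by field.
lra.
Qed.

End potential.

(** * Green function bounds *)

Section green.
Context {R : realType} (d : nat).
Notation V := 'rV[int]_d.
Notation e_ i := (delta_mx 0 i : V).
Notation k := (d - 2)%N.
Notation weight := (@weight R d).
Local Open Scope ereal_scope.

(** For [F = steps n] this is the n-th power of the transition operator, for [F = setT] the Green
    operator. *)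
Definition walk_sum (F : set (seq V)) (phi : V -> \bar R) (x : V) : \bar R :=
  \esum_(p in F) (weight x p * phi (last x p)).

Definition steps n : set (seq V) := [set p | size p = n].

Lemma walk_sum_ge0 F phi x : (forall y, 0 <= phi y) -> 0 <= walk_sum F phi x.
Proof. by move=> phi0; apply: esum_ge0 => p _; rewrite mule_ge0. Qed.

Lemma le_walk_sum F phi psi x : (forall y, phi y <= psi y) ->
  walk_sum F phi x <= walk_sum F psi x.
Proof. by move=> h; apply: le_esum => p _; rewrite lee_wpmul2l ?h ?weight_ge0. Qed.

Lemma walk_sumD F phi psi x : (forall y, 0 <= phi y) -> (forall y, 0 <= psi y) ->
  walk_sum F (fun y => phi y + psi y) x = walk_sum F phi x + walk_sum F psi x.
Proof.
move=> h1 h2; rewrite /walk_sum -esumD; [|by move=> p _; rewrite mule_ge0..].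
by apply: eq_esum => p _; rewrite ge0_muleDr.
Qed.

Lemma walk_sumZ F c phi x : (forall y, 0 <= phi y) -> 0 <= c ->
  walk_sum F (fun y => c * phi y) x = c * walk_sum F phi x.
Proof.
move=> h c0; rewrite /walk_sum -esumZl //; last by move=> p; rewrite mule_ge0.
by apply: eq_esum => p _; rewrite muleCA.
Qed.

Lemma stepsD m n phi x : (forall y, 0 <= phi y) ->
  walk_sum (steps (m + n)) phi x = walk_sum (steps m) (walk_sum (steps n) phi) x.
Proof.
move=> phi0; pose Phi p := phi (last x p).
have E : walk_sum (steps m) (walk_sum (steps n) phi) x =
    \esum_(q in steps m) (weight x q *
      \esum_(r in steps n) (weight (last x q) r * Phi (q ++ r))).
  apply: eq_esum => q _; congr (_ * _); apply: eq_esum => r _.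
  by rewrite /Phi last_cat.
rewrite E; apply/eqP; rewrite eq_le; apply/andP; split.
  apply: split_le => [p|p _ /= sp]; first exact: phi0.
  exists (take m p), (drop m p); rewrite cat_take_drop; split => //=.
    by rewrite /steps /= size_takel // sp leq_addr.
  by rewrite /steps /= size_drop sp addKn.
apply: (@split_ge R d x (steps (m + n)) (steps m) (fun=> steps n) Phi).
- by move=> p; exact: phi0.
- by move=> q r /= qm rn _; rewrite /steps /= size_cat qm rn.
- move=> q r q' r' /= qm _ q'm _ e.
  by have := congr1 (take m) e; rewrite !take_size_cat.
Qed.

Lemma steps0 phi x : (forall y, 0 <= phi y) -> walk_sum (steps 0) phi x = phi x.
Proof.
move=> phi0; rewrite /walk_sum (_ : steps 0 = [set [::]]).
  by rewrite esum_set1 ?mule_ge0 // weight_nil mul1e.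
by apply/seteqP; split => p /=; [move=> /size0nil|move=> ->].
Qed.

Lemma walk_sumT phi x : (forall y, 0 <= phi y) ->
  walk_sum setT phi x = \sum_(n <oo) walk_sum (steps n) phi x.
Proof.
move=> phi0; rewrite nneseries_esumT; last by move=> n; exact: walk_sum_ge0.
rewrite /walk_sum (esum_fiber _ size); last by move=> p; rewrite mule_ge0.
apply: eq_esum => n _; congr (esum _ _).
by apply/seteqP; split => p /=; [move=> []|move=> ->].
Qed.

Lemma walk_sum_part_le f psi : (forall x, 0 <= f x) -> (forall x, 0 <= psi x) ->
  (forall x, f x + walk_sum (steps 1) psi x <= psi x) ->
  forall n x, \sum_(0 <= j < n) walk_sum (steps j) f x + walk_sum (steps n) psi x <= psi x.
Proof.
move=> f0 psi0 h; elim=> [|n IH] x; first by rewrite big_nil add0e steps0.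
apply: le_trans (IH x); rewrite big_nat_recr //= -addeA leeD2l //.
rewrite -addn1 stepsD // -walk_sumD //; last by move=> y; exact: walk_sum_ge0.
exact: le_walk_sum.
Qed.

Lemma walk_sum_le f psi : (forall x, 0 <= f x) -> (forall x, 0 <= psi x) ->
  (forall x, f x + walk_sum (steps 1) psi x <= psi x) ->
  forall x, walk_sum setT f x <= psi x.
Proof.
move=> f0 psi0 h x; rewrite walk_sumT //; apply: lime_le.
  by apply: is_cvg_nneseries => n _ _; exact: walk_sum_ge0.
apply: nearW => n; apply: le_trans (walk_sum_part_le f0 psi0 h n x).
by rewrite leeDl // walk_sum_ge0.
Qed.

(** Unlike in the upper bound, the remainder after n steps cannot be dropped; for the potential it
    is shown to become small in [pot_vanish]. *)
Lemma walk_sum_ge f psi : (forall x, 0 <= f x) -> (forall x, 0 <= psi x) ->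
  (forall x, psi x <= f x + walk_sum (steps 1) psi x) ->
  forall n x, psi x <= walk_sum setT f x + walk_sum (steps n) psi x.
Proof.
move=> f0 psi0 h n x.
suff : psi x <= \sum_(0 <= j < n) walk_sum (steps j) f x + walk_sum (steps n) psi x.
  move=> /le_trans; apply; rewrite leeD2r // walk_sumT //.
  by apply: nneseries_lim_ge => j _ _; exact: walk_sum_ge0.
elim: n => [|n IH] in x *; first by rewrite big_nil add0e steps0.
apply: (le_trans (IH x)); rewrite big_nat_recr //= -addeA leeD2l //.
rewrite -addn1 stepsD // -walk_sumD //; last by move=> y; exact: walk_sum_ge0.
exact: le_walk_sum.
Qed.

Lemma steps_mass n x : walk_sum (steps n) (fun=> 1) x <= 1.
Proof.
apply: (@stop_le _ _ (steps n) (fun=> 1) x) => //; last exact: superharmonic1.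
by move=> p q /= pn; rewrite /steps /= size_cat pn => /eqP; rewrite -{2}[n]addn0 eqn_add2l => /nilP.
Qed.

Definition green (x y : V) : \bar R := \esum_(p in [set p | last x p = y]) weight x p.

Lemma green_ge0 x y : 0 <= green x y. Proof. exact: esum_ge0. Qed.

Lemma green_neighbor x y y' : neighbor y' y -> green x y' <= (2 * d)%:R%:E * green x y.
Proof.
move=> yy'; rewrite /green -esumZl; [|by rewrite ?lee_fin ?ler0n|by []].
apply: (esum_inj_le (i := fun p => rcons p y)).
- by move=> p _; rewrite /= last_rcons.
- by move=> p p' _ _ /rcons_inj[].
- move=> p /= py'; rewrite -cats1 weight_cat py' muleCA -[leLHS]mule1.
  apply: lee_wpmul2l => //; rewrite /weight /pweight /= yy' andbT expr1 -EFinM lee_fin.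
  have [d0|d0] := posnP d; last by rewrite divff // pnatr_eq0 muln_eq0 /= -lt0n.
  exfalso; move: yy'; rewrite /neighbor big1; first by [].
  by move=> [i id] _; exfalso; move: id; rewrite d0.
- by move=> p; rewrite mule_ge0.
Qed.

Definition translate_growth (v : V) :=
  exists2 K : R, (0 <= K)%R & forall x y, green x (y + v)%R <= K%:E * green x y.

(** A Harnack comparison, uniform in both arguments. Appending one step to a path costs a factor 2
    d, and any translation is a finite sum of unit steps. *)
Lemma translate_growthP v : translate_growth v.
Proof.
have t0 : translate_growth 0.
  by exists 1%R => // x y; rewrite addr0 mul1e.
have tD v1 v2 : translate_growth v1 -> translate_growth v2 -> translate_growth (v1 + v2)%R.
  move=> [K1 K10 h1] [K2 K20 h2]; exists (K2 * K1)%R; first exact: mulr_ge0.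
  move=> x y; rewrite addrA; apply: (le_trans (h2 _ _)).
  by rewrite EFinM -muleA lee_wpmul2l ?lee_fin.
have te (s : bool) (i : 'I_d) : translate_growth (if s then e_ i else (- e_ i)%R).
  exists (2 * d)%:R%R => // x y; apply: green_neighbor; rewrite neighborC -mem_nbrs mem_cat.
  by apply/orP; case: s; [left|right]; apply/mapP; exists i; rewrite ?mem_enum.
have tn (s : bool) (i : 'I_d) n : translate_growth ((if s then e_ i else - e_ i) *+ n)%R.
  by elim: n => [|n IH]; rewrite ?mulr0n // mulrS; exact: tD.
rewrite [v]row_sum_delta; elim/big_ind : _ => // i _.
case: (v 0%R i) => n.
  have := tn true i n; rewrite (_ : e_ i *+ n = n%:Z *: e_ i)%R //.
  by rewrite -scaler_nat natz.
have := tn false i n.+1; rewrite (_ : - e_ i *+ n.+1 = Negz n *: e_ i)%R //.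
by rewrite NegzE scaleNr mulNrn -scaler_nat natz.
Qed.

Lemma bounded_seq (n : nat) : exists s : seq V,
  forall v : V, (forall i, `|v 0 i| <= n%:Z)%R -> v \in s.
Proof.
exists [seq (\row_i ((f i : nat)%:Z - n%:Z))%R | f : {ffun 'I_d -> 'I_(2 * n).+1} <- enum {ffun 'I_d -> 'I_(2 * n).+1}].
move=> v hv; apply/mapP; exists [ffun i => inord `|(v 0%R i + n%:Z)%R|%N]; first by rewrite mem_enum.
apply/rowP => i; rewrite mxE ffunE.
have := hv i; move: (v _ i) => z; rewrite ler_norml => /andP[h1 h2].
by rewrite inordK; lia.
Qed.

End green.

Section green_bounds.
Context {R : realType} (d : nat).
Notation V := 'rV[int]_d.
Notation e_ i := (delta_mx 0 i : V).
Notation k := (d - 2)%N.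
Notation weight := (@weight R d).
Hypothesis hd : (3 <= d)%N.

Let pot (A : R) (y x : V) : \bar R := (potential A (x - y))%:E.
Let src (A : R) (y x : V) : \bar R := (source A (x - y))%:E.

Variable A0 : R.
Hypothesis A06 : 6 <= A0.
Hypothesis sb : forall A, A0 <= A -> forall x : V,
  k%:R * A / 4 * (potential A x / (sqnorm x + A) ^+ 2) <= source A x
   <= k%:R * A * (potential A x / (sqnorm x + A) ^+ 2).

Lemma scale_gt0 (A : R) : A0 <= A -> 0 < A.
Proof. by apply: lt_le_trans; apply: lt_le_trans A06. Qed.

Lemma k_ge1 : 1 <= k%:R :> R. Proof. by rewrite ler1n; lia. Qed.

Lemma potential_gt0 (A : R) (x : V) : 0 < A -> 0 < potential A x.
Proof. by move=> A0'; rewrite exprn_gt0 // isqrt_gt0 // ltr_wpDl // sqnorm_ge0. Qed.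

Lemma potential_le1 (A : R) (x : V) : 1 <= A -> potential A x <= 1.
Proof.
move=> A1; rewrite /potential exprn_ile1 //.
  by rewrite ltW // isqrt_gt0 // ltr_wpDl ?sqnorm_ge0 //; lra.
rewrite -invr1 lef_pV2 ?posrE // ?sqrtr_gt0; last first.
  by rewrite ltr_wpDl ?sqnorm_ge0 //; lra.
by rewrite -sqrtr1 ler_wsqrtr // ler_wpDl ?sqnorm_ge0.
Qed.

Lemma source_gt0 (A : R) (x : V) : A0 <= A -> 0 < source A x.
Proof.
move=> hA; have /andP[h _] := sb hA x; apply: lt_le_trans h.
have A1 := scale_gt0 hA; have A6 := A06.
have q := sqnorm_ge0 (R := R) x; have k1 := k_ge1.
rewrite mulr_gt0 ?divr_gt0 ?mulr_gt0 ?potential_gt0 ?exprn_gt0 //; lra.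
Qed.

Lemma pot_ge0 A y x : 0 < A -> (0 <= pot A y x)%E.
Proof. by move=> h; rewrite lee_fin ltW // potential_gt0. Qed.

Lemma src_ge0 A y x : A0 <= A -> (0 <= src A y x)%E.
Proof. by move=> h; rewrite lee_fin ltW // source_gt0. Qed.

Lemma pot_step A y x : 0 < A ->
  (src A y x + walk_sum (steps 1) (pot A y) x)%E = pot A y x.
Proof.
move=> hA; rewrite /walk_sum (step1E (phi := pot A y)); last by move=> z; exact: pot_ge0.
rewrite /pot sumEFin sum_nbrs /src -EFinM -EFinD /source sum_nbrs; congr (_%:E).
rewrite [X in _ + _ * X](eq_bigr (fun i => potential A (x - y + e_ i) + potential A (x - y - e_ i))).
  by rewrite subrK.
by move=> i _; rewrite addrAC (addrAC x (- e_ i)).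
Qed.

Lemma walk_source_le A y x : A0 <= A -> (walk_sum setT (src A y) x <= pot A y x)%E.
Proof.
move=> hA; have A1 := scale_gt0 hA.
apply: walk_sum_le => z; [exact: src_ge0|exact: pot_ge0|by rewrite pot_step].
Qed.

(** The potential exceeds [eps] only in a bounded region, where the source is bounded below by a
    positive constant. *)
Lemma potential_le_source (eps : R) : 0 < eps ->
  exists2 c : R, 0 <= c & forall z : V, potential A0 z <= eps + c * source A0 z.
Proof.
move=> e0; have A1 := scale_gt0 (lexx A0); have A6 := A06.
(* The region is |z|^2 + A0 <= eps^(-2): there [potential A0 z] is at most the inverse square root
   of |z|^2 + A0, because d - 2 >= 1. *)
pose T : R := (eps^-1) ^+ 2; have T0 : 0 <= T := sqr_ge0 _.
exists (4 * T ^+ 2) => [|z]; first by rewrite mulr_ge0 // sqr_ge0.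
have sz := source_gt0 z (lexx A0).
have [h|h] := leP (potential A0 z) eps.
  by apply: (le_trans h); rewrite lerDl mulr_ge0 ?(ltW sz) // mulr_ge0 // sqr_ge0.
apply: (@le_trans _ _ (4 * T ^+ 2 * source A0 z)); last by rewrite lerDr ltW.
have /andP[s1 _] := sb (lexx _) z; set t := sqnorm z + A0 in s1.
have q0 : 0 <= sqnorm z := sqnorm_ge0 (R := R) z.
have t6 : 6 <= t by rewrite /t; lra.
have tT : t <= T.
  have it0 : 0 < isqrt t by rewrite isqrt_gt0; lra.
  have it1 : isqrt t <= 1.
    rewrite -invr1 lef_pV2 ?posrE // ?sqrtr_gt0; last by lra.
    by rewrite -sqrtr1 ler_wsqrtr //; lra.
  have : eps < isqrt t.
    apply: (lt_le_trans h); rewrite /potential -/t -{2}[isqrt t]expr1.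
    by apply: ler_wiXn2l; rewrite ?subn_gt0 // ltW.
  have st : 0 < Num.sqrt t by rewrite sqrtr_gt0; lra.
  rewrite /isqrt -{1}[eps]invrK ltf_pV2 ?posrE ?invr_gt0 // => /ltW h'; rewrite /T -[t]sqr_sqrtr; last by lra.
  by rewrite ler_sqr ?nnegrE ?sqrtr_ge0 ?invr_ge0 ?(ltW e0).
have p0 := ltW (potential_gt0 z A1); have k1 := k_ge1.
have : potential A0 z / 4 <= t ^+ 2 * source A0 z.
  rewrite -ler_pdivrMl ?exprn_gt0 //; last by lra.
  apply: le_trans s1.
  have -> : (t ^+ 2)^-1 * (potential A0 z / 4) = 4^-1 * (potential A0 z / t ^+ 2) by ring.
  rewrite ler_wpM2r //; first by rewrite divr_ge0 // sqr_ge0.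
  nra.
have : t ^+ 2 * source A0 z <= T ^+ 2 * source A0 z.
  by rewrite ler_wpM2r ?(ltW sz) // ler_sqr ?nnegrE //; lra.
lra.
Qed.

(** Transience. The n-step averages of the source have a sum bounded by the potential, so they
    cannot all stay above a positive constant; [potential_le_source] transfers smallness to the
    potential, the n-step mass being at most 1. *)
Lemma pot_vanish y x (eps : R) : 0 < eps ->
  exists n, (walk_sum (steps n) (pot A0 y) x <= eps%:E)%E.
Proof.
move=> e0; have A1 := scale_gt0 (lexx A0); have A6 := A06.
have [c c0 hc] := potential_le_source (divr_gt0 e0 (ltr0n _ 2)).
have src0 z := src_ge0 y z (lexx A0).
have [n hn] : exists n, (c%:E * walk_sum (steps n) (src A0 y) x <= (eps / 2)%:E)%E.
  apply: contrapT => /forallNP h.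
  have c1 : 0 < c.
    rewrite lt_neqAle c0 andbT; apply/eqP => c00; apply: (h 0%N).
    by rewrite -c00 mul0e lee_fin; lra.
  have hs n : (((eps / 2) / c)%:E <= walk_sum (steps n) (src A0 y) x)%E.
    have /negP := h n; rewrite -ltNge => /ltW.
    by rewrite -lee_pdivrMl // -EFinM mulrC.
  pose a := eps / 2 / c; have a0 : 0 < a by rewrite !divr_gt0.
  have hN N : N%:R * a <= potential A0 (x - y).
    rewrite -lee_fin -[leRHS]/(pot A0 y x).
    apply: le_trans (walk_source_le y x (lexx _)).
    rewrite walk_sumT //; apply: le_trans (nneseries_lim_ge N _); last first.
      by move=> j _ _; exact: walk_sum_ge0.
    apply: (@le_trans _ _ (\sum_(0 <= j < N) a%:E)%E).
      by rewrite sumEFin sumr_const_nat subn0 mulr_natl.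
    by apply: lee_sum => j _; exact: hs.
  have := hN (Num.truncn (potential A0 (x - y) / a)).+1.
  apply/negP; rewrite -ltNge -ltr_pdivrMr //.
  exact: truncnS_gt.
exists n; apply: (@le_trans _ _ (walk_sum (steps n) (fun z => (eps / 2)%:E * 1 + c%:E * src A0 y z)%E x)).
  apply: le_walk_sum => z; rewrite mule1 -EFinM -EFinD lee_fin; exact: hc.
rewrite walk_sumD; last 2 first.
- by move=> z; rewrite mule1 lee_fin; lra.
- by move=> z; rewrite mule_ge0.
rewrite walk_sumZ ?walk_sumZ //; last by rewrite lee_fin; lra.
have -> : eps%:E = ((eps / 2)%:E + (eps / 2)%:E)%E by rewrite -EFinD -splitr.
rewrite leeD //.
rewrite -[leRHS]mule1 lee_wpmul2l ?lee_fin ?steps_mass //; lra.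
Qed.

Lemma pot_le_walk_source y x : (pot A0 y x <= walk_sum setT (src A0 y) x)%E.
Proof.
have A1 := scale_gt0 (lexx A0); have A6 := A06.
apply/lee_addgt0Pr => eps e0; have [n hn] := pot_vanish y x e0.
apply: (@le_trans _ _ (walk_sum setT (src A0 y) x + walk_sum (steps n) (pot A0 y) x)%E).
  apply: walk_sum_ge => z; [exact: src_ge0|exact: pot_ge0|by rewrite pot_step].
by rewrite leeD2l.
Qed.

(** The Green potential of the source is at most the potential, and the visits to [y] alone
    contribute [f0] times the Green function. *)
Lemma green_upper : exists2 C : R, 0 < C &
  forall x y : V, (green x y <= (C * potential A0 (x - y))%:E)%E.
Proof.
pose f0 := source A0 (0 : V); have f00 : 0 < f0 := source_gt0 0 (lexx _).
exists f0^-1 => [|x y]; first by rewrite invr_gt0.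
rewrite EFinM lee_pdivlMl //.
apply: le_trans (walk_source_le y x (lexx _)).
rewrite /green -esumZl //; last by rewrite lee_fin ltW.
rewrite (eq_esum (b := fun p => weight x p * src A0 y (last x p))%E); last first.
  by move=> p /= ->; rewrite /src subrr muleC.
by apply: esum_subset => // p; rewrite mule_ge0 // src_ge0.
Qed.

(** A wider smoothing has a source with the same decay at infinity but a larger constant. This lets
    the tail of the source of [A0] be absorbed in [green_lower]. *)
Lemma source_dominated : exists2 R2 : R, A0 <= R2 & forall z : V, R2 <= sqnorm z ->
  source A0 z <= 2^-1 * source R2 z.
Proof.
pose i2 : R := isqrt 2 ^+ k; have i20 : 0 < i2 by rewrite exprn_gt0 // isqrt_gt0.
(* The factor 32 is 4 (lower constant of the source) times 4 (from [u <= 2 * t], squared) times 2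
   (the half to be gained); [i2] is lost when the potentials are compared. *)
pose R2 := A0 + 32 * A0 / i2.
have A1 := scale_gt0 (lexx A0); have A6 := A06.
have hR2 : 32 * A0 / i2 <= R2 by rewrite /R2; lra.
have AR2 : A0 <= R2 by rewrite /R2 lerDl divr_ge0 //; [lra|exact: ltW].
exists R2 => // z hz.
have /andP[_ s1] := sb (lexx _) z; have /andP[s2 _] := sb AR2 z.
apply: (le_trans s1); rewrite [leRHS]mulrC ler_pdivlMr //; apply: le_trans s2.
have k1 := k_ge1; set t := sqnorm z + A0; set u := sqnorm z + R2.
have t0 : 0 < t by rewrite /t; lra.
have u0 : 0 < u by rewrite /u; lra.
have ut : u <= 2 * t by rewrite /u /t; lra.
have pu : i2 * potential A0 z <= potential R2 z.
  rewrite /potential -/t -/u /i2 -exprMn -isqrtM //.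
  by apply: lerXn2r; rewrite ?nnegrE ?(ltW (isqrt_gt0 _)) ?mulr_gt0 // le_isqrt.
have p0 := potential_gt0 z A1.
have uu : u ^+ 2 <= 4 * t ^+ 2.
  have -> : 4 * t ^+ 2 = (2 * t) ^+ 2 by ring.
  by rewrite ler_sqr ?nnegrE //; lra.
have pq : i2 / 4 * (potential A0 z / t ^+ 2) <= potential R2 z / u ^+ 2.
  rewrite ler_pdivlMr ?exprn_gt0 //; apply: le_trans pu.
  rewrite -mulrA (mulrC (4^-1)) -!mulrA ler_wpM2l ?(ltW i20) // ler_piMr ?(ltW p0) //.
  rewrite ler_pdivrMl ?exprn_gt0 // mulr1 ler_pdivrMl //.
apply: (@le_trans _ _ (k%:R * R2 / 4 * (i2 / 4 * (potential A0 z / t ^+ 2)))); last first.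
  by rewrite ler_wpM2l // divr_ge0 // mulr_ge0 //; lra.
have -> : k%:R * R2 / 4 * (i2 / 4 * (potential A0 z / t ^+ 2)) =
  k%:R * (R2 * i2 / 16) * (potential A0 z / t ^+ 2) by field; rewrite gt_eqF.
rewrite mulrAC ler_wpM2r //; first by rewrite divr_ge0 ?(ltW p0) ?sqr_ge0.
rewrite -[leLHS]mulrA ler_wpM2l //; move: hR2; rewrite ler_pdivrMr //; lra.
Qed.

(** The source is not supported at one point. Near [y] it is bounded and the Green function is
    comparable to its value at [y] by [translate_growthP]; far away it is at most half the source of
    scale [R2], whose Green potential is at most [pot R2 y], hence at most [pot A0 y]. Thus the
    potential is at most a multiple of the Green function plus half of itself. *)
Lemma green_lower : exists2 c : R, 0 < c &
  forall x y : V, ((c * potential A0 (x - y))%:E <= green x y)%E.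
Proof.
have [R2 AR2 dom] := source_dominated.
have A1 := scale_gt0 (lexx A0); have A6 := A06.
have R20 : 0 < R2 by lra.
have k1 := k_ge1.
pose M0 : R := k%:R * A0; have M00 : 0 < M0 by rewrite mulr_gt0 //; lra.
have src_le (z : V) : source A0 z <= M0.
  have /andP[_] := sb (lexx _) z; move=> /le_trans; apply.
  rewrite -/M0 ler_piMr ?(ltW M00) //.
  have q0 : 0 <= sqnorm z := sqnorm_ge0 (R := R) z.
  rewrite ler_pdivrMr ?exprn_gt0 //; last by lra.
  apply: (le_trans (potential_le1 _ _)); first by lra.
  by rewrite mul1r -[leLHS](expr1n _ 2) ler_sqr ?nnegrE //; lra.
clearbody M0.
have [s0 hs0] := bounded_seq d (Num.truncn R2).+1.
pose s := undup s0.
have hs (v : V) : sqnorm v < R2 -> v \in s.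
  move=> hv; rewrite mem_undup; apply: hs0 => i.
  have := sqnorm_coord (R := R) v i; move: (v 0 i) => z hz.
  rewrite -(ler_int R); apply: ltW.
  apply: (@le_lt_trans _ _ (sqnorm v)); last first.
    by apply: (lt_trans hv); rewrite -pmulrn; exact: truncnS_gt.
  apply: le_trans hz; rewrite -rmorphXn ler_int /=.
  by case: z => [[|n]|n]; nia.
have growth (v : V) := translate_growthP (R := R) v.
have [K K0 hK] : exists2 K : R, 0 < K & forall x y,
   (\sum_(v <- s) green x (y + v) <= K%:E * green x y)%E.
  elim: s {hs} => [|v s' [K K0 hK]].
    by exists 1 => // x y; rewrite big_nil mul1e green_ge0.
  have [K' K'0 hK'] := growth v; exists (K' + K); first by rewrite ltr_wpDl.
  move=> x y; rewrite big_cons EFinD ge0_muleDl ?lee_fin ?(ltW K0) //.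
  by apply: leeD; [exact: hK'|exact: hK].
exists ((2 * M0 * K)^-1); first by rewrite invr_gt0 !mulr_gt0.
move=> x y; rewrite EFinM lee_pdivrMl ?mulr_gt0 //.
pose ind (z : V) : R := (sqnorm (z - y) < R2)%R%:R.
have ind0 z : (0 <= (ind z)%:E)%E by rewrite lee_fin.
have U : (walk_sum setT (src A0 y) x <=
   M0%:E * walk_sum setT (fun z => (ind z)%:E) x + (2^-1)%:E * pot R2 y x)%E.
  apply: (@le_trans _ _ (walk_sum setT (fun z => M0%:E * (ind z)%:E + (2^-1)%:E * src R2 y z)%E x)).
    apply: le_walk_sum => z; rewrite -!EFinM -EFinD lee_fin /ind.
    have sz : 0 < source R2 (z - y) by exact: source_gt0.
    case: ltP => h; first by rewrite mulr1 ler_wpDr //; rewrite mulr_ge0 ?(ltW sz).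
    by rewrite mulr0 add0r dom.
  rewrite walk_sumD; last 2 first.
  - by move=> z; rewrite -EFinM lee_fin mulr_ge0 ?(ltW M00).
  - by move=> z; rewrite mule_ge0 ?src_ge0 // lee_fin.
  rewrite walk_sumZ ?lee_fin ?(ltW M00) // walk_sumZ ?lee_fin //; last first.
    by move=> z; exact: src_ge0.
  by rewrite leeD2l // lee_wpmul2l ?lee_fin // walk_source_le.
have potR : (pot R2 y x <= pot A0 y x)%E.
  rewrite lee_fin; apply: lerXn2r; rewrite ?nnegrE ?(ltW (isqrt_gt0 _)) ?ltr_wpDl ?sqnorm_ge0 //.
  by apply: le_isqrt; rewrite ?ltr_wpDl ?sqnorm_ge0 // lerD2l.
have {}U : (pot A0 y x <= M0%:E * walk_sum setT (fun z => (ind z)%:E) x + (2^-1)%:E * pot A0 y x)%E.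
  apply: (le_trans (pot_le_walk_source y x)); apply: (le_trans U).
  by rewrite leeD2l // lee_wpmul2l ?lee_fin.
have W : (walk_sum setT (fun z => (ind z)%:E) x <= K%:E * green x y)%E.
  apply: le_trans (hK x y).
  rewrite /walk_sum (esum_fiber _ (fun p => last x p - y)); last first.
    by move=> p; rewrite mule_ge0 // lee_fin.
  rewrite -esum_seq ?undup_uniq //; last by move=> v; exact: green_ge0.
  rewrite esum_mkcond [leRHS]esum_mkcond; apply: le_esum => v _.
  rewrite in_setT mem_setE; case: ifPn => [_|vs].
    apply: (esum_inj_le (i := id)) => //=.
    - by move=> p [_ <-]; rewrite addrC subrK.
    - by move=> p _; rewrite -[leRHS]mule1 lee_wpmul2l // lee_fin /ind lern1 leq_b1.
  rewrite esum1 // => p [_ pv]; rewrite /ind pv.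
  case: ltP => h; last by rewrite mule0.
  by rewrite hs in vs.
have P : (pot A0 y x <= (2 * M0)%:E * walk_sum setT (fun z => (ind z)%:E) x)%E.
  move: U; rewrite -leeBlDr // /pot -EFinM -EFinB => U.
  rewrite EFinM -muleA -lee_pdivrMl //.
  apply: le_trans U; rewrite -EFinM lee_fin; lra.
apply: (le_trans P); rewrite [in leRHS]EFinM -[leRHS]muleA lee_wpmul2l // lee_fin.
by rewrite mulr_ge0 // ltW.
Qed.

End green_bounds.

(** * The sup distance on the lattice *)

Section distance.
Variable d : nat.
Notation V := 'rV[int]_d.
Implicit Types x y z : V.

Definition dist x y : nat := absz `|x - y|.

Lemma distE x y : (dist x y)%:Z = `|x - y|.
Proof. by rewrite /dist gez0_abs. Qed.

Lemma dist_le x y (n : nat) : (`|x - y| <= n%:Z) = (dist x y <= n)%N.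
Proof. by rewrite -distE. Qed.

Lemma dist_sym x y : dist x y = dist y x.
Proof. by rewrite /dist distrC. Qed.

Lemma dist_triangle z x y : (dist x y <= dist x z + dist z y)%N.
Proof.
rewrite -dist_le PoszD !distE (_ : x - y = (x - z) + (z - y)); last by rewrite addrA subrK.
exact: ler_normD.
Qed.

Lemma dist_coord x y i : (`|(x 0%R i - y 0%R i)%R| <= dist x y)%N.
Proof.
rewrite -lez_nat distE /Num.Def.normr /= mx_normrE.
have := @le_bigmax _ _ _ 0 (fun ij => `|(x - y) ij.1 ij.2| : int) (0, i).
by rewrite !mxE /= abszE.
Qed.

Lemma dist_attained x y : (0 < dist x y)%N ->
  exists i, dist x y = `|(x 0%R i - y 0%R i)%R|%N.
Proof.
move=> h; have h0 : mx_norm (x - y) != 0 :> int.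
  by apply: contraTneq h => h; rewrite -ltz_nat distE /Num.Def.normr /= h.
have [[i j] hij] := mx_norm_neq0 h0; exists j.
apply/eqP; rewrite -eqz_nat distE /Num.Def.normr /= hij /= ord1 !mxE.
by rewrite abszE.
Qed.

Lemma dist_neighbor x y : neighbor x y -> (dist x y <= 1)%N.
Proof.
move=> /eqP h; have [->//|d0] := posnP (dist x y).
have [i ->] := dist_attained d0.
rewrite -lez_nat -[leRHS]h (bigD1 i) //= abszE lerDl; apply: sumr_ge0 => *; exact: normr_ge0.
Qed.

Lemma distxx x : dist x x = 0%N. Proof. by rewrite /dist subrr normr0. Qed.

End distance.

(** * Green function bounds in terms of the sup distance *)

Section green_dist.
Context {R : realType} (d : nat).
Notation V := 'rV[int]_d.
Notation k := (d - 2)%N.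
Notation weight := (@weight R d).
Hypothesis hd : (3 <= d)%N.

Lemma sqnorm_ge_dist (x y : V) : (dist x y)%:R ^+ 2 <= sqnorm (x - y) :> R.
Proof.
have [->|d0] := posnP (dist x y); first by rewrite expr0n sqnorm_ge0.
have [i ->] := dist_attained d0.
apply: le_trans (sqnorm_coord (x - y) i); rewrite !mxE.
by rewrite -[in leRHS]real_normK ?num_real // -intr_norm -abszE -pmulrn.
Qed.

Lemma sqnorm_le_dist (x y : V) : sqnorm (x - y) <= d%:R * (dist x y)%:R ^+ 2 :> R.
Proof.
rewrite /sqnorm mulr_natl -[X in _ *+ X]card_ord -sumr_const; apply: ler_sum => i _.
rewrite !mxE -[in leLHS]real_normK ?num_real // -intr_norm -abszE -pmulrn.
by rewrite ler_sqr ?nnegrE // ler_nat dist_coord.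
Qed.

Definition decay (n : nat) : R := (n%:R^-1) ^+ k.

Lemma decay_gt0 n : (0 < n)%N -> 0 < decay n.
Proof. by move=> n0; rewrite exprn_gt0 // invr_gt0 ltr0n. Qed.

Lemma decay_ge0 n : 0 <= decay n.
Proof. by rewrite exprn_ge0 // invr_ge0. Qed.

Lemma le_decay m n : (0 < m)%N -> (m <= n)%N -> decay n <= decay m.
Proof.
move=> m0 mn; have n0 := leq_trans m0 mn.
apply: lerXn2r; rewrite ?nnegrE ?invr_ge0 //.
by rewrite lef_pV2 ?posrE ?ltr0n // ler_nat.
Qed.

Lemma decayM m n : decay (m * n) = decay m * decay n.
Proof. by rewrite /decay natrM invfM exprMn. Qed.

Lemma potential_le_decay (A : R) (x y : V) : 0 <= A -> (0 < dist x y)%N ->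
  potential A (x - y) <= decay (dist x y).
Proof.
move=> A0 d0; have d0' : 0 < (dist x y)%:R :> R by rewrite ltr0n.
have h := sqnorm_ge_dist x y.
have s0 : 0 < sqnorm (x - y) :> R by apply: lt_le_trans h; rewrite exprn_gt0.
rewrite /decay -(@isqrt_sqr _ (dist x y)%:R) ?ler0n //.
apply: lerXn2r; rewrite ?nnegrE ?(ltW (isqrt_gt0 _)) ?exprn_gt0 //; first by lra.
by apply: le_isqrt; rewrite ?exprn_gt0 //; lra.
Qed.

Lemma potential_ge_decay (A : R) (x y : V) n : 0 < A -> (dist x y <= n)%N -> (0 < n)%N ->
  isqrt (d%:R + A) ^+ k * decay n <= potential A (x - y).
Proof.
move=> A0 dn n0; have n0' : 0 < n%:R :> R by rewrite ltr0n.
have n1 : 1 <= n%:R :> R by rewrite ler1n.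
have q0 : 0 < sqnorm (x - y) + A by rewrite ltr_wpDl ?sqnorm_ge0.
have dA : 0 < d%:R + A by rewrite ltr_wpDl.
rewrite /decay -(@isqrt_sqr _ n%:R) ?ler0n // -exprMn -isqrtM; last exact: ltW.
apply: lerXn2r; rewrite ?nnegrE ?(ltW (isqrt_gt0 _)) ?mulr_gt0 ?exprn_gt0 //.
apply: le_isqrt => //; rewrite mulrDl; apply: lerD.
  apply: (le_trans (sqnorm_le_dist x y)); rewrite ler_wpM2l //.
  by rewrite ler_sqr ?nnegrE // ler_nat.
by rewrite ler_peMr ?(ltW A0) // exprn_ege1.
Qed.

(** The last clause is a hitting estimate: a walk from distance n of [z] stops within distance L of
    [z] with probability at most C (L / n)^(d-2). *)
Definition green_estimates (c C : R) := [/\ 0 < c, 0 < C,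
  forall x y : V, (0 < dist x y)%N -> ((c * decay (dist x y))%:E <= green x y <= (C * decay (dist x y))%:E)%E,
  forall x y : V, (green x y <= C%:E)%E &
  forall (F : set (seq V)) (x z : V) L, prefix_free F -> (0 < L)%N ->
    (forall p, F p -> (dist (last x p) z <= L)%N) -> (0 < dist x z)%N ->
    (\esum_(p in F) weight x p <= (C * decay (dist x z) / decay L)%:E)%E].

(** The hitting estimate is optional stopping for the potential centred at [z], which is at least
    [i0 * decay L] on the ball. The factor [i0] arises from |x|^2 + A0 <= (d + A0) n^2 for sup norm
    at most n, with n >= 1. *)
Lemma green_dist : exists c C : R, green_estimates c C.
Proof.
have [A0 A06 sb] := source_bounds (R := R) hd.
have [C C0 gu] := green_upper hd A06 sb.
have [c c0 gl] := green_lower hd A06 sb.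
have A00 : 0 < A0 by lra.
pose i0 : R := isqrt (d%:R + A0) ^+ k.
have i00 : 0 < i0 by rewrite exprn_gt0 // isqrt_gt0 // ltr_wpDl.
exists (c * i0), (C + i0^-1); split.
- by rewrite mulr_gt0.
- by rewrite addr_gt0 // invr_gt0.
- move=> x y d0; apply/andP; split.
    apply: le_trans (gl x y); rewrite lee_fin -mulrA ler_wpM2l ?(ltW c0) //.
    exact: potential_ge_decay.
  apply: (le_trans (gu x y)); rewrite lee_fin ler_pM ?(ltW C0) //.
  + by rewrite ltW // potential_gt0 //; lra.
  + by rewrite lerDl invr_ge0 ltW.
  + by apply: potential_le_decay => //; exact: ltW.
- move=> x y; apply: (le_trans (gu x y)); rewrite lee_fin -[leRHS]mulr1 ler_pM ?(ltW C0) //.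
  + by rewrite ltW // potential_gt0 //; lra.
  + by rewrite lerDl invr_ge0 ltW.
  + by apply: potential_le1; lra.
move=> F x z L pf L0 FL d0; have dL := decay_gt0 L0.
have : (\esum_(p in F) (weight x p * (potential A0 (last x p - z))%:E) <= (potential A0 (x - z))%:E)%E.
  apply: (@stop_le _ _ F (fun y => (potential A0 (y - z))%:E) x) => //.
  - by move=> y; rewrite lee_fin ltW // potential_gt0.
  - move=> y; rewrite -[leRHS](pot_step z y A00) /walk_sum leeDr //.
    by rewrite lee_fin ltW // (source_gt0 hd A06 sb).
move=> h; have : ((i0 * decay L)%:E * (\esum_(p in F) weight x p) <= (potential A0 (x - z))%:E)%E.
  apply: le_trans h; rewrite -esumZl //; last by rewrite lee_fin mulr_ge0 ?ltW.
  apply: le_esum => p Fp; rewrite muleC lee_wpmul2l // lee_fin.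
  by apply: potential_ge_decay => //; exact: FL.
rewrite -lee_pdivlMl ?mulr_gt0 // => /le_trans; apply.
rewrite -EFinM lee_fin invfM mulrAC ler_wpM2r ?invr_ge0 ?(ltW dL) //.
apply: (@le_trans _ _ (i0^-1 * decay (dist x z))).
  by rewrite ler_wpM2l ?invr_ge0 ?(ltW i00) // potential_le_decay // ltW.
by rewrite ler_wpM2r ?decay_ge0 // lerDr ltW.
Qed.

(** On the ball the potential is at least [m], while its average after a suitable number of steps is
    at most [m * eps]. *)
Lemma leave_ball (x z : V) (M : nat) (eps : R) : 0 < eps -> exists n,
  (\esum_(p in [set p | size p = n /\ (dist (last x p) z <= M)%N]) weight x p <= eps%:E)%E.
Proof.
move=> e0; have [A0 A06 sb] := source_bounds (R := R) hd.
have A00 : 0 < A0 by lra.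
pose m : R := isqrt (d%:R + A0) ^+ k * decay M.+1.
have m0 : 0 < m by rewrite mulr_gt0 ?decay_gt0 // exprn_gt0 // isqrt_gt0 // ltr_wpDl.
have [n hn] := pot_vanish hd A06 sb z x (mulr_gt0 m0 e0).
exists n; rewrite -(@lee_pmul2l _ m%:E) ?lte_fin // -EFinM.
apply: le_trans hn; rewrite -esumZl ?lee_fin ?(ltW m0) //.
rewrite (le_trans (le_esum (b := fun p => weight x p * (potential A0 (last x p - z))%:E)%E _)) //.
  move=> p /= [_ hp]; rewrite muleC lee_wpmul2l // lee_fin.
  by apply: potential_ge_decay => //; exact: leqW.
apply: esum_subset => [p []//|p]; rewrite mule_ge0 // lee_fin ltW // potential_gt0 //; lra.
Qed.

End green_dist.

(** * Hitting and escape probabilities of balls *)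

Section first_hit.
Context {R : realType} (d : nat).
Notation V := 'rV[int]_d.
Notation weight := (@weight R d).
Implicit Types (A B D U : pred V) (p q r : seq V).

(* q stays in A until its last vertex, which is its only vertex in D. *)
Fixpoint first_hit A D q : bool :=
  if q is y :: q' then (if D y then q' == [::] else A y && first_hit A D q') else false.

Lemma first_hit_rcons A D q z :
  first_hit A D (rcons q z) = D z && all (fun y => A y && ~~ D y) q.
Proof.
elim: q => [|y q IH] /=; first by case: ifP; rewrite ?andbF.
case: ifPn => /= Dy; first by rewrite andbF andbF; case: q {IH}.
by rewrite IH andbT; case: (D z); rewrite ?andbF.
Qed.

Lemma first_hitP A D q : first_hit A D q ->
  exists q0 z, [/\ q = rcons q0 z, D z & all (fun y => A y && ~~ D y) q0].
Proof.
case/lastP: q => // q z; rewrite first_hit_rcons => /andP[Dz Aq].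
by exists q, z.
Qed.

Lemma first_hit_last A D x q : first_hit A D q -> D (last x q).
Proof. by move=> /first_hitP[q0 [z [-> Dz _]]]; rewrite last_rcons. Qed.

Lemma first_hit_prefix_free A D : prefix_free [set q | first_hit A D q].
Proof.
move=> p q /=; elim: p => //= y p IH; case: ifP => [_ /eqP -> //= /eqP //|_].
by move=> /andP[-> /IH].
Qed.

Lemma has_first_hit A D q : has D q -> all (fun y => A y || D y) q ->
  exists q1 q2, [/\ q = q1 ++ q2 & first_hit A D q1].
Proof.
elim: q => //= y q IH; case: (boolP (D y)) => /= Dy.
  by move=> _ _; exists [:: y], q; rewrite /= Dy.
rewrite orbF => hq /andP[Ay Aq]; have [q1 [q2 [-> h]]] := IH hq Aq.
by exists (y :: q1), q2; rewrite /= (negbTE Dy) Ay.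
Qed.

Lemma first_hit_sub A A' D q : (forall y, A y -> A' y) -> first_hit A D q ->
  first_hit A' D q.
Proof.
move=> AA'; elim: q => //= y q IH; case: ifP => // _ /andP[/AA' -> /IH ->] //.
Qed.

Lemma le_wsum x (F : set (seq V)) (f g : seq V -> \bar R) :
  (forall p, F p -> path (@neighbor d) x p -> (f p <= g p)%E) ->
  (\esum_(p in F) (weight x p * f p) <= \esum_(p in F) (weight x p * g p))%E.
Proof.
move=> h; apply: le_esum => p Fp.
have [pp|/weight_path ->] := boolP (path (@neighbor d) x p); last by rewrite !mul0e.
by rewrite lee_wpmul2l // h.
Qed.

Lemma wsum_le x (F : set (seq V)) (f : seq V -> \bar R) (c : \bar R) : (0 <= c)%E ->
  (forall p, F p -> path (@neighbor d) x p -> (f p <= c)%E) ->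
  (\esum_(p in F) (weight x p * f p) <= (\esum_(p in F) weight x p) * c)%E.
Proof.
move=> c0 h; rewrite -esumZr //; exact: (@le_wsum x F f (fun=> c)).
Qed.

Lemma wsum_ge x (F : set (seq V)) (f : seq V -> \bar R) (c : \bar R) : (0 <= c)%E ->
  (forall p, F p -> path (@neighbor d) x p -> (c <= f p)%E) ->
  ((\esum_(p in F) weight x p) * c <= \esum_(p in F) (weight x p * f p))%E.
Proof.
move=> c0 h; rewrite -esumZr //; exact: (@le_wsum x F (fun=> c) f).
Qed.

Lemma prefix_free_mass x (F : set (seq V)) : prefix_free F ->
  (\esum_(p in F) weight x p <= 1)%E.
Proof.
move=> pf; have := @stop_le R d F (fun=> 1%E) x pf (fun=> lee01) (@superharmonic1 R d).
by under eq_esum do rewrite mule1.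
Qed.

Definition hit_at A B (u x : V) : \bar R :=
  \esum_(p in [set p | first_hit A B p /\ last u p = x]) weight u p.

(** Only interior vertices are constrained. This makes the kernel symmetric under path reversal and
    lets either endpoint lie in the set that is being avoided. *)
Definition avoiding (A : pred V) (x y : V) : \bar R :=
  \esum_(p in [set p | all A p]) weight x (rcons p y).

Lemma avoiding_ge0 A x y : (0 <= avoiding A x y)%E. Proof. exact: esum_ge0. Qed.

Lemma avoiding_sym A x y : avoiding A x y = avoiding A y x.
Proof.
rewrite /avoiding (reindex_esum [set p | all A p] _ rev); last first.
  split; first by move=> p /=; rewrite all_rev.
    by move=> p q _ _ /(congr1 rev); rewrite !revK.
  by move=> p /= Ap; exists (rev p); rewrite /= ?all_rev ?revK.
apply: eq_esum => p _; rewrite -[LHS]weight_rev last_rcons belast_rcons.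
by rewrite rev_cons revK.
Qed.

(** Together with [avoiding_sym] this reads a hit of the ball at [x] backwards, as an escape from
    [x]. *)
Lemma hit_at_avoiding A B u x : B x ->
  hit_at A B u x = avoiding (fun y => A y && ~~ B y) u x.
Proof.
move=> Bx; rewrite /hit_at /avoiding.
apply: (@reindex_esum _ _ _ _ _ (fun p => rcons p x)); split.
- by move=> p /= Ap; rewrite first_hit_rcons Bx Ap last_rcons.
- by move=> p q _ _ /rcons_inj[].
- move=> p /= [/first_hitP[q [z [-> _ Aq]]]]; rewrite last_rcons => <-.
  by exists q.
Qed.

(* Probability to leave U before returning to B; the starting point may lie in B. *)
Definition escape B U (x : V) : \bar R :=
  \esum_(p in [set p | first_hit (predC B) (predC U) p]) weight x p.

Lemma escape_ge0 B U x : (0 <= escape B U x)%E. Proof. exact: esum_ge0. Qed.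

(** A path from [x] to the outside of [U] first leaves [U] without returning to [B]; what follows is
    bounded by all walks to [u]. *)
Lemma avoiding_escape_le B U A x u (g : \bar R) : (0 <= g)%E -> ~~ U u ->
  ~~ B u -> (forall y, A y -> ~~ B y) ->
  (forall p, first_hit (predC B) (predC U) p -> path (@neighbor d) x p ->
     (green (last x p) u <= g)%E) ->
  (avoiding A x u <= escape B U x * g)%E.
Proof.
move=> g0 Uu Bu AB h.
rewrite /avoiding.
have -> : \esum_(p in [set p | all A p]) weight x (rcons p u) =
    \esum_(p in [set p | exists2 q, p = rcons q u & all A q]) (weight x p * 1)%E.
  apply/esym; under eq_esum do rewrite mule1.
  apply: (@reindex_esum _ _ _ _ _ (fun p => rcons p u)); split.
  - by move=> p /= Ap; exists p.
  - by move=> p q _ _ /rcons_inj[].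
  - by move=> _ /= [p -> Ap]; exists p.
apply: le_trans (wsum_le (f := fun q => green (last x q) u) g0 h).
apply: (le_trans (split_le (B := [set p | first_hit (predC B) (predC U) p])
  (C := fun q => [set r | last (last x q) r = u]) (phi := fun=> 1%E) _ _)) => //.
  move=> p _ /= [q -> Aq].
  have [||q1 [q2 [e h1]]] := @has_first_hit (predC B) (predC U) (rcons q u).
  - by rewrite has_rcons /= Uu.
  - rewrite all_rcons /= Bu /=; apply/allP => y yq /=.
    by rewrite AB //; exact: (allP Aq).
  exists q1, q2; split => //=; by rewrite -last_cat -e last_rcons.
apply: le_esum => q _; rewrite lee_wpmul2l // /green.
by under eq_esum do rewrite mule1.
Qed.

Lemma avoiding_escape_ge B U A x u (g : \bar R) : (0 <= g)%E ->
  (forall y, U y -> ~~ B y -> A y) ->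
  (forall p, first_hit (predC B) (predC U) p -> path (@neighbor d) x p ->
     A (last x p) /\ (g <= avoiding A (last x p) u)%E) ->
  (escape B U x * g <= avoiding A x u)%E.
Proof.
move=> g0 UA h.
apply: (le_trans (wsum_ge (f := fun q => avoiding A (last x q) u) g0 _)).
  by move=> p h1 h2; have [] := h p h1 h2.
have -> : avoiding A x u =
    \esum_(p in [set p | exists2 q, p = rcons q u & all A q]) (weight x p * 1)%E.
  apply/esym; under eq_esum do rewrite mule1.
  apply: (@reindex_esum _ _ _ _ _ (fun p => rcons p u)); split.
  - by move=> p /= Ap; exists p.
  - by move=> p q _ _ /rcons_inj[].
  - by move=> _ /= [p -> Ap]; exists p.
apply: le_trans (split_ge (B := [set p | first_hit (predC B) (predC U) p])
  (C := fun q => [set r | exists2 r0, r = rcons r0 u & all A r0])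
  (phi := fun=> 1%E) _ _ _) => //.
- apply: le_esum => q _; rewrite lee_wpmul2l // /avoiding.
  rewrite [leRHS](@reindex_esum _ _ _ [set r | all A r] _ (fun p => rcons p u)).
    by apply: le_esum => r _; rewrite mule1.
  split.
  + by move=> p /= Ap; exists p.
  + by move=> p r _ _ /rcons_inj[].
  + by move=> _ /= [p -> Ap]; exists p.
- move=> q _ /= hq [r -> Ar] pqr; exists (q ++ r); first by rewrite rcons_cat.
  rewrite all_cat Ar andbT.
  have pq : path (@neighbor d) x q by move: pqr; rewrite cat_path => /andP[].
  have [Al _] := h q hq pq; have [q0 [z [qE _ hq0]]] := first_hitP hq.
  move: Al; rewrite qE last_rcons all_rcons => -> /=.
  by apply: sub_all hq0 => y /= /andP[By]; rewrite negbK => /UA; apply.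
- by move=> q r q' r' /= hq _ hq' _; exact: (prefix_free_uniq (@first_hit_prefix_free _ _)) hq hq'.
Qed.

End first_hit.

Section balls.
Context {R : realType} (d : nat).
Notation V := 'rV[int]_d.
Notation weight := (@weight R d).
Implicit Types (A B D U : pred V) (p q r : seq V).

Definition box z n : pred V := fun x => (dist x z <= n)%N.

Lemma exit_dist A z n x q : path (@neighbor d) x q ->
  first_hit A (predC (box z n)) q -> box z n x ->
  (n < dist (last x q) z <= n.+1)%N.
Proof.
elim: q x => //= y q IH x /andP[xy pq]; rewrite -/(box z n y).
case: (boolP (box z n y)) => /= hy; first by move=> /andP[_ h] _; exact: IH.
move=> /eqP -> /=; rewrite /box => hx; rewrite ltnNge hy /=.
have h1 := dist_neighbor xy; have h2 := dist_triangle x y z.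
by rewrite dist_sym in h1; lia.
Qed.

Lemma prefix_free_sub (F F' : set (seq V)) : prefix_free F -> F' `<=` F -> prefix_free F'.
Proof. by move=> pf FF p q /FF Fp /FF Fq; exact: pf Fp Fq. Qed.

Lemma exists_dist (z : V) n : (0 < d)%N -> exists u, dist u z = n.
Proof.
move=> d0; pose i := Ordinal d0; exists (z + n%:Z *: delta_mx 0 i).
have e j : `|((z + n%:Z *: delta_mx 0 i) 0 j - z 0 j)%R|%N = if j == i then n else 0%N.
  rewrite !mxE eqxx /= addrC addKr; case: eqP => _; rewrite ?mulr1 ?mulr0 //.
set u := z + _; have := dist_coord u z i; rewrite e eqxx => h.
have [d00|dp] := posnP (dist u z); first by lia.
by have [j hj] := dist_attained dp; move: h; rewrite hj e; case: eqP => _; lia.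
Qed.

Local Open Scope ereal_scope.

(** A walk to [u] either keeps its interior in [A] or is cut at its first exit from [A]. The
    condition [v <> u] excludes the empty walk, which neither term on the right would cover. *)
Lemma green_avoiding (A : pred V) v u : v <> u ->
  green v u <= avoiding A v u +
    \esum_(q in [set q | first_hit predT (predC A) q]) (weight v q * green (last v q) u) :> \bar R.
Proof.
move=> vu; rewrite /green.
rewrite (esumID [set p | exists2 q, p = rcons q u & all A q]) //.
apply: leeD.
  rewrite /avoiding (_ : [set p | _] `&` _ = [set p | exists2 q, p = rcons q u & all A q]).
    rewrite [leLHS](@reindex_esum _ _ _ [set p | all A p] _ (fun p => rcons p u)) //.
    split.
    - by move=> p /= Ap; exists p.
    - by move=> p q _ _ /rcons_inj[].
    - by move=> _ /= [p -> Ap]; exists p.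
  apply/seteqP; split => [p [] //|p /= [q -> Aq]].
  by rewrite last_rcons; split => //; exists q.
have E := @split_le R d v ([set p | last v p = u] `&` ~` [set p | exists2 q, p = rcons q u & all A q])
  [set q | first_hit predT (predC A) q] (fun q => [set r | last (last v q) r = u]) (fun=> 1).
under eq_esum do rewrite -[weight _ _]mule1.
apply: (le_trans (E _ _)) => //.
  move=> p _ [/= pu nA].
  have [||q1 [q2 [e h1]]] := @has_first_hit _ predT (predC A) p.
  - rewrite has_predC; apply/negP => Ap; apply: nA.
    case/lastP: p pu Ap => [/vu//|p y]; rewrite last_rcons => -> .
    by rewrite all_rcons => /andP[_ Ap]; exists p.
  - by apply/allP.
  by exists q1, q2; split => //=; rewrite -last_cat -e.
apply: le_esum => q _; rewrite lee_wpmul2l //.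
by under eq_esum do rewrite mule1.
Qed.

Lemma steps_mass1 n (x : V) : (0 < d)%N -> \esum_(p in [set p | size p = n]) weight x p = 1.
Proof.
move=> d0; elim: n x => [|n IH] x.
  rewrite (_ : [set p | size p = 0%N] = [set [::]]) ?esum_set1 ?weight_nil //.
  by apply/seteqP; split => p /=; [move=> /size0nil|move=> ->].
have := @stepsD R d 1 n (fun=> 1) x (fun=> lee01); rewrite /walk_sum add1n.
under eq_esum do rewrite mule1.
move=> ->; under eq_esum => q _.
  rewrite (eq_esum (b := fun p => weight (last x q) p)); last by move=> p _; rewrite mule1.
  rewrite IH; over.
rewrite (step1E (phi := fun=> 1)) // sumEFin -EFinM sum_nbrs sumr_const.
rewrite card_ord (_ : (1 + 1) *+ d = (2 * d)%:R :> R)%R; last by rewrite mulrnA.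
by rewrite mulVf // pnatr_eq0 muln_eq0 /= -lt0n.
Qed.

End balls.

(** * Hitting distribution of a ball seen from far away *)

Section hitting.
Context {R : realType} (d : nat).
Notation V := 'rV[int]_d.
Notation k := (d - 2)%N.
Notation weight := (@weight R d).
Notation decay := (@decay R d).
Hypothesis hd : (3 <= d)%N.
Variables (c C : R) (r : nat).
Hypothesis est : green_estimates d c C.
Hypothesis Hr : 4 * C ^+ 2 * decay r <= c * decay 2 ^+ 2.
Hypothesis Hr2 : 4 * C * decay r <= 1.

Variables (z z' : V) (L : nat).
Hypothesis L0 : (0 < L)%N.
Variable a : nat.
Hypothesis aE : a = (r * L)%N.
Hypothesis aL : (2 * L <= a)%N.
Let B := box z L.
Let B' := box z' L.
Let U := box z a.

(** Half of what the Green lower bound gives at twice the distance; the other half absorbs the paths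
    that run into a ball in [hit_lower]. *)
Definition lower_const := c * decay 2 / 2.

Lemma lower_const_gt0 : 0 < lower_const.
Proof. by have [c0 _ _ _ _] := est; rewrite divr_gt0 // mulr_gt0 // decay_gt0. Qed.

Lemma decay_half m n : (0 < m)%N -> (m <= 2 * n)%N -> decay n <= decay m / decay 2.
Proof.
move=> m0 mn; rewrite ler_pdivlMr ?decay_gt0 // mulrC -decayM; exact: le_decay.
Qed.

(** After reversal the path escapes from [x] to distance just above [a], from where [u] is still at
    least half as far as from [z]; this costs the factor [decay 2]. *)
Lemma hit_upper u x : (2 * (a + L) <= dist u z)%N -> B x ->
  (hit_at predT B u x <= escape B U x * (C * (decay (dist u z) / decay 2))%:E)%E.
Proof.
move=> hu Bx; have [c0 C0 gb _ _] := est; rewrite hit_at_avoiding // avoiding_sym.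
apply: avoiding_escape_le.
- by rewrite lee_fin !mulr_ge0 ?invr_ge0 ?decay_ge0 ?(ltW C0).
- by rewrite /U /box -ltnNge; move: hu L0; clear; lia.
- by rewrite /B /box -ltnNge; move: hu L0; clear; lia.
- by move=> y /=.
move=> p hp pp; have := exit_dist pp hp; rewrite {1}/box.
have -> : (dist x z <= a)%N by move: Bx aL; rewrite /B /box; clear; lia.
move=> /(_ isT) /andP[v1 v2]; set v := last x p in v1 v2 *.
have h := dist_triangle v u z; rewrite (dist_sym u v) in h.
have vu : (0 < dist v u)%N by move: h v1 v2 hu L0; clear; lia.
have /andP[_ h'] := gb v u vu; apply: (le_trans h').
rewrite lee_fin ler_wpM2l ?(ltW C0) // decay_half //; move: h v1 v2 hu L0; clear; lia.
Qed.

(** Reversed as in the upper bound. From the exit point of [U], walks to [u] that meet [B] or [B']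
    must be subtracted from the Green function; [Hr] makes this loss at most half of the Green lower
    bound. *)
Lemma hit_lower u x : (2 * (a + L) <= dist u z)%N -> (4 * dist u z <= dist z z')%N -> B x ->
  (escape B U x * (lower_const * decay (dist u z))%:E <= hit_at (predC B') B u x)%E.
Proof.
move=> hu hz Bx; have [c0 C0 gb _ hit] := est.
have d20 : 0 < decay 2 by exact: decay_gt0.
set D := dist u z in hu hz *; have D0 : 0 < decay D by apply: decay_gt0; move: hu L0; clear; lia.
rewrite hit_at_avoiding // avoiding_sym.
set A := (fun y => predC B' y && ~~ B y).
apply: avoiding_escape_ge.
- by rewrite lee_fin mulr_ge0 ?(ltW D0) // ltW // lower_const_gt0.
- move=> y; rewrite /U /A /B /B' /box /= => h1 ->; rewrite andbT -ltnNge.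
  have := dist_triangle y z z'; rewrite (dist_sym z y).
  by move: h1 hu hz L0; rewrite -/D; clear; lia.
move=> p hp pp; have := exit_dist pp hp; rewrite {1}/box.
have -> : (dist x z <= a)%N by move: Bx aL; rewrite /B /box; clear; lia.
move=> /(_ isT) /andP[v1 v2]; set v := last x p in v1 v2 *.
have hvz' := dist_triangle v z z'; rewrite (dist_sym z v) in hvz'.
split.
  rewrite /A /B /B' /box /= -!ltnNge.
  by move: hvz' v1 v2 hu hz L0 aL; rewrite -/D; clear; lia.
have h := dist_triangle v u z; rewrite (dist_sym u v) in h.
have h2 := dist_triangle z v u; rewrite (dist_sym z u) in h2.
have vu : (0 < dist v u)%N by move: h v1 v2 hu L0; clear; lia.
have /andP[gv _] := gb v u vu.
have vu' : v <> u by move=> e; move: vu; rewrite e distxx.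
set F := [set q | first_hit predT (predC A) q].
have pfF : prefix_free F := @first_hit_prefix_free _ _ _.
pose l := C * decay r * (C * (decay D / decay 2)).
have l0 : 0 <= l by rewrite !mulr_ge0 ?invr_ge0 ?decay_ge0 ?(ltW C0).
(* Either ball is at distance at least [a = r * L] from [v], so it is hit with probability at most
   [C * decay r], and from there [u] is at distance at least D / 2. *)
have loss (w : V) (Bw := box w L) : (a <= dist v w)%N ->
   (forall b, Bw b -> (D <= 2 * dist b u)%N) ->
   (\esum_(q in F `&` [set q | Bw (last v q)]) (weight v q * green (last v q) u) <= l%:E)%E.
  move=> hw hb.
  apply: (le_trans (wsum_le (c := (C * (decay D / decay 2))%:E) (f := fun q => green (last v q) u) _ _)).
  - by rewrite lee_fin !mulr_ge0 ?invr_ge0 ?decay_ge0 ?(ltW C0).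
  - move=> q [_ /= /hb hq] _.
    have bu : (0 < dist (last v q) u)%N by move: hq hu L0; clear; lia.
    have /andP[_ h'] := gb _ u bu; apply: (le_trans h').
    rewrite lee_fin ler_wpM2l ?(ltW C0) // decay_half //; move: hu L0; clear; lia.
  have -> : l%:E = ((C * decay r)%:E * (C * (decay D / decay 2))%:E)%E by rewrite -EFinM.
  apply: lee_wpmul2r.
    by rewrite lee_fin !mulr_ge0 ?invr_ge0 ?decay_ge0 ?(ltW C0).
  apply: (le_trans (hit _ v w L _ L0 _ _)).
  - by apply: (prefix_free_sub pfF) => q [].
  - by move=> q [_].
  - by move: hw L0 aL; clear; lia.
  rewrite lee_fin -mulrA ler_wpM2l ?(ltW C0) //.
  rewrite ler_pdivrMr ?decay_gt0 // -decayM -aE le_decay //; move: L0 aL; clear; lia.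
have := green_avoiding (R := R) A vu'.
have : (\esum_(q in F) (weight v q * green (last v q) u) <= (2 * l)%:E)%E.
  apply: (@le_trans _ _ (\esum_(q in F `&` [set q | B (last v q)]) (weight v q * green (last v q) u)
     + \esum_(q in F `&` [set q | B' (last v q)]) (weight v q * green (last v q) u))%E).
    rewrite (esumID [set q | B (last v q)]); last by move=> *; rewrite mule_ge0 // green_ge0.
    rewrite leeD2l //; apply: esum_subset => [q [Fq /= /negP nB]|q]; last first.
      by rewrite mule_ge0 // green_ge0.
    split => //=; have := first_hit_last v Fq.
    by rewrite /A /= nB andbT negbK.
  rewrite mulr2n mulrDl !mul1r EFinD; apply: leeD; apply: loss.
  - by rewrite ltnW.
  - by move=> b; rewrite /box => hb; have := dist_triangle b u z; move: hb hu L0 aL; rewrite (dist_sym u b) -/D; clear; lia.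
  - by move: hvz' v1 v2 hu hz L0 aL; rewrite -/D; clear; lia.
  - move=> b; rewrite /box => hb; have h3 := dist_triangle u z z'.
    have h4 := dist_triangle b u z'.
    move: h3 h4 hb hu hz L0; rewrite (dist_sym z u) (dist_sym u b) -/D; clear; lia.
move=> hl ha; rewrite -(@leeD2rE _ (2 * l)%:E) //.
apply: le_trans (_ : (green v u <= _)%E); last by apply: (le_trans ha); rewrite leeD2l.
apply: le_trans gv; rewrite -EFinD lee_fin.
apply: (@le_trans _ _ (c * decay (2 * D))); last first.
  rewrite ler_wpM2l ?(ltW c0) // le_decay //; move: h2 vu; rewrite -/D; move: v1 v2 hu L0; clear; lia.
rewrite decayM /lower_const /l.
have -> : c * decay 2 / 2 * decay D + 2 * (C * decay r * (C * (decay D / decay 2))) =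
   (c * decay 2 ^+ 2 / 2 + 4 * C ^+ 2 * decay r / 2) * (decay D / decay 2).
  by field; rewrite gt_eqF.
have -> : c * (decay 2 * decay D) = (c * decay 2 ^+ 2) * (decay D / decay 2).
  by field; rewrite gt_eqF.
have hr := Hr; rewrite ler_wpM2r ?divr_ge0 ?decay_ge0 //; lra.
Qed.

(** A capacity bound of order L^(d-2): hitting probabilities from [u] sum to at most 1, and each is
    bounded below by an escape probability times a fixed factor. *)
Lemma escape_sum : (8 * (a + L) <= dist z z')%N ->
  (\esum_(x in [set x | B x]) escape B U x <=
    ((lower_const * decay (2 * (a + L)))^-1)%:E)%E.
Proof.
move=> hz; have [u hu] := @exists_dist d z (2 * (a + L)) (ltn_trans (ltn0Sn _) hd).
set K := lower_const * _.
have K0 : 0 < K by rewrite mulr_gt0 ?lower_const_gt0 ?decay_gt0 //; move: L0; clear; lia.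
rewrite -[(K^-1)%:E]mule1 lee_pdivlMl // -esumZl; last 2 first.
- by rewrite lee_fin ltW.
- by move=> x; exact: escape_ge0.
apply: (@le_trans _ _ (\esum_(x in [set x | B x]) hit_at (predC B') B u x)%E).
  apply: le_esum => x Bx; rewrite muleC /K -hu; apply: hit_lower => //; rewrite hu //.
  by move: hz; clear; lia.
apply: le_trans (@prefix_free_mass R _ u _ (@first_hit_prefix_free _ (predC B') B)).
rewrite [leRHS](esum_fiber _ (fun p => last u p)) //.
rewrite esum_mkcond; apply: le_esum => x _.
by case: ifP => // _; apply: esum_ge0.
Qed.

(** Having left [U], the walk comes back to [B] with probability at most 1/4 by [Hr2]; so it leaves
    the larger box first with probability at least 1/2. *)
Lemma escape_far a' x : (a < a')%N -> B x ->
  (escape B U x * (2^-1)%:E <= escape B (box z a') x :> \bar R)%E.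
Proof.
move=> aa' Bx; have [c0 C0 gb _ hit] := est; set W := box z a'.
have B_U y : B y -> U y by move: aL; rewrite /B /U /box; clear; lia.
have U_W y : U y -> W y by move: aa'; rewrite /W /U /box; clear; lia.
apply: (@le_trans _ _ (\esum_(p in [set p | first_hit (predC B) (predC U) p])
    (weight x p * escape B W (last x p)))%E).
  apply: wsum_ge => [|p hp pp]; first by rewrite lee_fin.
  have := exit_dist pp hp (B_U _ Bx); set v := last x p => /andP[v1 v2].
  have Wv : W v by move: aa' v1 v2; rewrite /W /box; clear; lia.
  have d0 : (0 < d)%N by exact: leq_trans hd.
  (* With finite paths only, staying in [W] forever is excluded by a fixed time [n] at which the
     walk is still in [W] with probability at most 1/4. *)
  have [n hn] := leave_ball hd v z a' (ltac:(by []) : 0 < 4^-1 :> R).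
  have E (F : set (seq V)) : prefix_free F ->
      (\esum_(p in [set p | size p = n /\ exists q1 q2, p = q1 ++ q2 /\ F q1]) weight v p <=
       \esum_(q in F) weight v q)%E.
    move=> pf; under eq_esum do rewrite -[weight _ _]mule1.
    apply: (le_trans (split_le (B := F) (C := fun q => [set r | size r = (n - size q)%N]) (phi := fun=> 1%E) _ _)) => //.
      move=> p' _ /= [sp [q1 [q2 [e Fq]]]]; exists q1, q2; split => //=.
      by rewrite -sp e size_cat addKn.
    apply: le_esum => q _; rewrite -[leRHS]mule1 lee_wpmul2l //.
    exact: (@steps_mass R d _ (last v q)).
  have hB : (\esum_(q in [set q | first_hit predT B q]) weight v q <= (4^-1)%:E)%E.
    apply: (le_trans (hit _ v z L (@first_hit_prefix_free _ _ _) L0 _ _)).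
    - by move=> q /first_hit_last; exact.
    - by move: v1; clear; lia.
    have hh : decay (dist v z) <= decay r * decay L.
      by rewrite -decayM -aE le_decay ?(ltnW v1) //; move: L0 aL; clear; lia.
    rewrite lee_fin ler_pdivrMr ?decay_gt0 //.
    apply: (@le_trans _ _ (C * (decay r * decay L))); first by rewrite ler_wpM2l ?(ltW C0).
    by rewrite mulrA ler_wpM2r ?decay_ge0 //; have := Hr2; lra.
  have h1 : (1 <= escape B W v + (4^-1 : R)%:E + (4^-1 : R)%:E)%E.
    apply: (@le_trans _ _ (\esum_(p in [set p | size p = n]) weight v p)%E).
      by rewrite steps_mass1.
    set G1 := [set q | first_hit (predC B) (predC W) q].
    set G2 := [set q | first_hit predT B q].
    rewrite (esumID [set p | exists q1 q2, p = q1 ++ q2 /\ G1 q1]) // -addeA leeD //.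
      exact: (E G1 (@first_hit_prefix_free _ _ _)).
    rewrite (esumID [set p | exists q1 q2, p = q1 ++ q2 /\ G2 q1]) // leeD //.
      apply: le_trans hB; apply: le_trans (E G2 (@first_hit_prefix_free _ _ _)).
      by apply: esum_subset => // w [[]].
    apply: le_trans hn; apply: esum_subset => // w /= [[sp n1] n2]; split => //.
    rewrite -/(box z a' (last v w)) -/W; apply/negPn/negP => nW; apply: n1.
    have w0 : w != [::] by apply/eqP => w0; move: nW; rewrite w0 /= Wv.
    have [||q1 [q2 [e hq]]] := @has_first_hit _ (predC B) (predC W) w.
    - apply/hasP; exists (last v w) => //.
      by case: w w0 {sp n2 nW} => // b w _; rewrite /= mem_last.
    - apply/allP => y yw /=; rewrite -negb_and; apply/negP => /andP[By _]; apply: n2.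
      have [||q1 [q2 [e hq]]] := @has_first_hit _ predT B w.
      + by apply/hasP; exists y.
      + by apply/allP.
      + by exists q1, q2.
    - by exists q1, q2.
  move: h1; rewrite -addeA -EFinD -leeBlDr // -EFinB; apply: le_trans.
  by rewrite lee_fin; lra.
apply: le_trans (_ : (\esum_(p in [set p | first_hit (predC B) (predC W) p]) (weight x p * 1) <= _)%E); last first.
  by under eq_esum do rewrite mule1.
apply: le_trans (split_ge (B := [set p | first_hit (predC B) (predC U) p])
  (C := fun q => [set q' | first_hit (predC B) (predC W) q']) (phi := fun=> 1%E) _ _ _) => //.
- apply: le_esum => q _; rewrite lee_wpmul2l // /escape.
  by apply: le_esum => p _; rewrite mule1.
- move=> q q' /= hq hq' pqq; have pq : path (@neighbor d) x q by move: pqq; rewrite cat_path => /andP[].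
  have /andP[v1 v2] := exit_dist pq hq (B_U _ Bx).
  have hW y : (dist y z <= a.+1)%N -> W y by move: aa'; rewrite /W /box; clear; lia.
  move: hq v1 v2 {pqq pq}; elim: q x {Bx} => //= y q IH x.
  case: (boolP (U y)) => /= Uy.
    move=> /andP[By hq] v1 v2; rewrite (U_W _ Uy) /= By /=; exact: (IH y).
  move=> /eqP -> /= v1 v2; rewrite (hW _ v2) /= hq' andbT.
  by apply/negP => /B_U; rewrite (negbTE Uy).
- by move=> q q1 q' q1' /= hq _ hq' _; exact: (prefix_free_uniq (@first_hit_prefix_free _ _ _)) hq hq'.
Qed.

End hitting.

(** * Rotations and excursions of loops *)

Section loops.
Context {R : realType} (d : nat).
Notation V := 'rV[int]_d.
Notation weight := (@weight R d).
Local Open Scope ereal_scope.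
Implicit Types (s : seq V) (M : pred (seq V)).

(* Sequences that are not based loops get weight 0, so that loop sums range over [seq V]. *)
Definition cycle_weight s : \bar R :=
  (if is_based_loop s then ((2 * d)%:R^-1 ^+ size s)%R else 0%R)%:E.

Definition loop_weight s : \bar R := ((size s)%:R^-1)%:E * cycle_weight s.

Lemma cycle_weight_ge0 s : 0 <= cycle_weight s.
Proof.
by rewrite lee_fin; case: ifP => // _; rewrite exprn_ge0 // invr_ge0.
Qed.

Lemma loop_weight_ge0 s : 0 <= loop_weight s.
Proof. by rewrite mule_ge0 ?cycle_weight_ge0 // lee_fin invr_ge0. Qed.

Lemma cycle_weight_cons x p : cycle_weight (x :: p) = weight x (rcons p x).
Proof. by rewrite /cycle_weight /is_based_loop /= /weight /pweight size_rcons. Qed.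

Lemma cycle_weight_rot n s : cycle_weight (rot n s) = cycle_weight s.
Proof.
rewrite /cycle_weight /is_based_loop size_rot rot_cycle.
by rewrite -!size_eq0 size_rot.
Qed.

(** Rotations are counted by position, hence with multiplicity for a periodic sequence; this is what
    matches the factor 1/size of the loop measure. *)
Definition nmark M s : nat := (\sum_(i < size s) M (rot i s))%N.

Lemma nmark_rot M n s : nmark M (rot n s) = nmark M s.
Proof.
have rot1 t : nmark M (rot 1 t) = nmark M t.
  rewrite /nmark size_rot -!(big_mkord xpredT (fun i => M (rot i _) : nat)).
  case: t => [|x t]; first by rewrite !big_nil.
  transitivity (\sum_(0 <= i < size (x :: t)) M (rot i.+1 (x :: t)))%N.
    rewrite big_nat_cond [RHS]big_nat_cond; apply: eq_bigr => i; rewrite andbT => /andP[_ it].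
    by rewrite rot_rot -rotS.
  rewrite big_nat_recr // [RHS]big_nat_recl // rot0 addnC.
  by rewrite -[X in rot X.+1 _]/(size t) -[(size t).+1]/(size (x :: t)) rot_size.
elim: n => [|n IH]; first by rewrite rot0.
have [ns|ns] := ltnP n (size s); first by rewrite rotS // rot1.
by rewrite rot_oversize // ltnW.
Qed.

(* The factor 1/size of the loop measure is traded for a sum over marked roots. *)
Lemma rotation M (Phi : seq V -> \bar R) : (forall s, 0 <= Phi s) ->
  (forall n s, Phi (rot n s) = Phi s) ->
  \esum_(s in [set: seq V]) (loop_weight s * ((nmark M s)%:R%:E * Phi s)) =
  \esum_(s in [set s | M s]) (cycle_weight s * Phi s).
Proof.
move=> Phi0 Phirot.
have nm0 s : 0 <= (nmark M s)%:R%:E :> \bar R by rewrite lee_fin.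
have cw0 := cycle_weight_ge0; have lw0 := loop_weight_ge0.
rewrite [RHS]esum_mkcond (esum_fiber _ size); last by move=> s; rewrite !mule_ge0.
rewrite [RHS](esum_fiber _ size); last first.
  by move=> s; case: ifP => _ //; rewrite mule_ge0.
apply: eq_esum => N _.
set SN := [set s | [set: seq V] s /\ size s = N].
pose F s := if s \in [set s | M s] then cycle_weight s * Phi s else 0.
have F0 s : 0 <= F s by rewrite /F; case: ifP => // _; rewrite mule_ge0.
transitivity (\esum_(s in SN) (\sum_(i < N) (N%:R^-1)%:E * F (rot i s))).
  apply: eq_esum => s [_ sN].
  rewrite -ge0_sume_distrr /loop_weight; last by move=> *; exact: F0.
  rewrite sN -muleA; congr (_ * _).
  rewrite (eq_bigr (fun i : 'I_N => (M (rot i s))%:R%:E * (cycle_weight s * Phi s))); last first.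
    move=> i _; rewrite /F cycle_weight_rot Phirot mem_setE.
    by rewrite unfold_in; case: (M _); rewrite ?mul1e ?mul0e.
  rewrite -ge0_sume_distrl; last by move=> i _; rewrite lee_fin.
  rewrite muleCA; congr (_ * _).
  by rewrite sumEFin -natr_sum /nmark sN.
rewrite esum_sum; last by move=> s i _ _; apply: mule_ge0; [rewrite lee_fin invr_ge0|exact: F0].
have E (i : 'I_N) : \esum_(s in SN) ((N%:R^-1)%:E * F (rot i s)) =
    (N%:R^-1)%:E * \esum_(s in SN) F s.
  rewrite esumZl; [|by rewrite lee_fin invr_ge0|by move=> t; exact: F0].
  congr (_ * _); apply/esym; apply: (@reindex_esum _ _ _ _ _ (rot i)); split.
  - by move=> s [_ sN]; split; rewrite ?size_rot.
  - by move=> s t _ _ /rot_inj.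
  - by move=> s [_ sN]; exists (rotr i s); rewrite ?rotrK //; split; rewrite ?size_rotr.
under eq_bigr do rewrite E.
have sumc (e : \bar R) : 0 <= e -> \sum_(i < N) e = N%:R%:E * e.
  move=> e0; rewrite (eq_bigr (fun=> 1%:E * e)); last by move=> i _; rewrite mul1e.
  by rewrite -ge0_sume_distrl // sumEFin sumr_const card_ord.
rewrite sumc; last by rewrite mule_ge0 ?esum_ge0 // lee_fin invr_ge0.
rewrite muleA.
have [N00|N0] := posnP N.
  rewrite [in LHS]N00 !mul0e [RHS]esum1 // => s [_]; rewrite N00 => /size0nil ->; case: ifP => // _.
  by rewrite /cycle_weight /= mul0e.
by rewrite -EFinM divff ?mul1e // pnatr_eq0 -lt0n.
Qed.

End loops.

(** * Decomposition of a loop into excursions *)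

Section crossings.
Variable d : nat.
Notation V := 'rV[int]_d.
Variables B D : pred V.
Hypothesis BD : forall v, B v -> ~~ D v.
Implicit Types (p q s : seq V).

(* The flag records whether D has been visited more recently than B. *)
Definition flag (f : bool) p : bool :=
  foldl (fun st v => if D v then true else if B v then false else st) f p.

Arguments flag : simpl never.

Fixpoint crossings (f : bool) p : nat :=
  if p is v :: p' then ((B v && f) + crossings (flag f [:: v]) p')%N else 0.

(* The root is a visit to B which, cyclically, is the first one after a visit to D. *)
Definition marked s : bool := if s is x :: p then B x && flag false p else false.

Lemma flag_cons f v p :
  flag f (v :: p) = flag (if D v then true else if B v then false else f) p.
Proof. by []. Qed.

Lemma flag_nil f : flag f [::] = f. Proof. by []. Qed.

Lemma flag_cat f p q : flag f (p ++ q) = flag (flag f p) q.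
Proof. exact: foldl_cat. Qed.

Lemma crossings_cat f p q :
  crossings f (p ++ q) = (crossings f p + crossings (flag f p) q)%N.
Proof. by elim: p f => //= v p IH f; rewrite IH addnA. Qed.

Lemma crossings_rcons f p x : crossings f (rcons p x) = (crossings f p + (B x && flag f p))%N.
Proof. by rewrite -cats1 crossings_cat /= addn0. Qed.

Lemma crossings_sum x0 f p : crossings f p =
  (\sum_(0 <= j < size p) (B (nth x0 p j) && flag f (take j p)))%N.
Proof.
elim: p f => [|v p IH] f; first by rewrite big_nil.
by rewrite /= big_nat_recl //= IH.
Qed.

(** The root lies in [B] and resets the flag, so for a rotation the cyclic history before a vertex
    reduces to the flag computed from the root. The final visit to [x] in [rcons p x] accounts for
    the root itself. *)
Lemma nmark_crossings x p : marked (x :: p) ->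
  nmark marked (x :: p) = crossings false (rcons p x).
Proof.
move=> /= /andP[Bx fp]; rewrite crossings_rcons Bx fp /= (crossings_sum x).
rewrite /nmark -(big_mkord xpredT (fun i => marked (rot i (x :: p)) : nat)) /=.
rewrite big_nat_recl // rot0 /= Bx fp addnC; congr (_ + _)%N.
rewrite big_nat_cond [RHS]big_nat_cond; apply: eq_bigr => j; rewrite andbT => /andP[_ jp].
rewrite /rot /= (drop_nth x) //= flag_cat flag_cons (negbTE (BD Bx)) Bx.
by [].
Qed.

(* A concatenation of n blocks, each leading to D and then back to B. *)
Fixpoint chain (A : pred V) (n : nat) (q : seq V) : Prop :=
  if n is m.+1 then exists q1 q2 q3, [/\ q = q1 ++ (q2 ++ q3),
    first_hit predT D q1, first_hit A B q2 & chain A m q3]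
  else q = [::].

Lemma flag_first_hitD q : first_hit predT D q -> flag false q /\ crossings false q = 0%N.
Proof.
elim: q => //= v q IH; case: (boolP (D v)) => Dv /=.
  by move=> /eqP ->; rewrite !(flag_cons, flag_nil) Dv andbF.
by move=> /IH; rewrite !(flag_cons, flag_nil) (negbTE Dv) andbF if_same.
Qed.

Lemma flag_noB (f : bool) q : ~~ has B q -> f -> flag f q /\ crossings f q = 0%N.
Proof.
elim: q f => [|v q IH] f //=; rewrite negb_or => /andP[nB hq] ft.
rewrite !(flag_cons, flag_nil) (negbTE nB) /= add0n; apply: IH => //; by case: ifP.
Qed.

Lemma flag_first_hitB A q : first_hit A B q ->
  [/\ flag true q = false, crossings true q = 1%N &
   forall q0 x, q = rcons q0 x -> flag true q0].
Proof.
move=> /first_hitP[q0 [z [-> Bz hq]]].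
have nB : ~~ has B q0 by rewrite -all_predC; apply: sub_all hq => y /= /andP[].
have [f1 c1] := flag_noB nB (erefl true).
split.
- by rewrite -cats1 flag_cat flag_cons (negbTE (BD Bz)) Bz.
- by rewrite crossings_rcons c1 Bz f1.
- by move=> q1 x /rcons_inj[<-].
Qed.

Lemma chain_crossings A n q : chain A n q -> crossings false q = n /\ flag false q = false.
Proof.
elim: n q => [|n IH] q /=; first by move=> ->.
move=> [q1 [q2 [q3 [-> /flag_first_hitD[f1 c1] h2 /IH[c3 f3]]]]].
have [f2 c2 _] := flag_first_hitB h2.
by rewrite !(crossings_cat, flag_cat) f1 c1 f2 c2 c3 f3.
Qed.

Lemma chain_last A n p x : chain A n (rcons p x) -> B x && flag false p.
Proof.
elim: n p => [|n IH] p /=; first by case: p.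
move=> [q1 [q2 [q3 [e /flag_first_hitD[f1 c1] h2 h3]]]].
have [f2 c2 l2] := flag_first_hitB h2.
case/lastP: q3 h3 e => [_|q3 z h3].
  rewrite cats0; case/lastP: q2 h2 f2 c2 l2 => // q2 z; rewrite first_hit_rcons.
  move=> /andP[Bz _] _ _ /(_ _ _ erefl) f2.
  rewrite -rcons_cat => /rcons_inj[-> ->].
  by rewrite Bz flag_cat f1.
rewrite -2!rcons_cat => /rcons_inj[-> xz]; subst z.
by have := IH _ h3; rewrite !flag_cat f1 f2.
Qed.

Lemma flag_hasD q : flag false q -> has D q.
Proof.
have : forall f, flag f q -> f || has D q.
  elim: q => [|v q IH] f /=; first by rewrite orbF.
  by rewrite flag_cons => /IH; case: (D v); case: (B v); case: f; case: (has D q).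
by move=> /(_ false).
Qed.

Lemma chainI p x : B x -> flag false p ->
  chain predT (crossings false (rcons p x)) (rcons p x).
Proof.
have [n] := ubnP (size p); elim: n => // n IH in p *; rewrite ltnS => sp Bx fp.
have hD := flag_hasD fp.
have [||q1 [r [pE h1]]] := @has_first_hit _ predT D p; [done|exact/allP|].
have [f1 c1] := flag_first_hitD h1.
have [||q2 [q3 [rE h2]]] := @has_first_hit _ predT B (rcons r x).
- by rewrite has_rcons Bx.
- exact/allP.
have [f2 c2 _] := flag_first_hitB h2.
rewrite pE rcons_cat rE !crossings_cat f1 c1 f2 c2 add0n add1n /=.
exists q1, q2, q3; split => //.
case/lastP: q3 rE => [|q3 z]; first by [].
rewrite -rcons_cat => /rcons_inj[rE xz]; subst z.
apply: IH => //; last by move: fp; rewrite pE rE !flag_cat f1 f2.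
apply: leq_trans sp; rewrite pE rE !size_cat.
have s1 : (0 < size q1)%N by case: q1 h1 {pE f1 c1}.
by move: s1; clear; lia.
Qed.

End crossings.

(** * Sums over chains of excursions, block by block *)

Section chain_sums.
Context {R : realType} (d : nat) (I : finType).
Notation V := 'rV[int]_d.
Notation weight := (@weight R d).
Variables B D : pred V.
Variable tr : seq V -> {set I}.
Hypothesis tr_cat : forall p q, tr (p ++ q) = tr p :|: tr q.
Hypothesis tr_nil : tr [::] = finset.set0.
Local Open Scope ereal_scope.
Notation fn := ({set I} -> \bar R).
Implicit Types (A : pred V) (phi psi Phi : fn).

Local Notation nneg phi := (forall S : {set I}, 0 <= phi S).

Definition shift phi (S S' : {set I}) : \bar R := phi (S :|: S').

Definition block_sum A (x x' : V) Phi : \bar R :=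
  \esum_(q1 in [set q | first_hit predT D q]) (weight x q1 *
    \esum_(q2 in [set q | first_hit A B q /\ last (last x q1) q = x'])
      (weight (last x q1) q2 * Phi (tr (q1 ++ q2)))).

Lemma block_sum_ge0 A x x' Phi : nneg Phi -> 0 <= block_sum A x x' Phi.
Proof.
by move=> h; apply: esum_ge0 => q _; rewrite mule_ge0 // esum_ge0 // => *; rewrite mule_ge0.
Qed.

Lemma le_block_sum A x x' Phi Psi : (forall S, Phi S <= Psi S) ->
  block_sum A x x' Phi <= block_sum A x x' Psi.
Proof.
move=> h; apply: le_esum => q _; rewrite lee_wpmul2l //.
by apply: le_esum => r _; rewrite lee_wpmul2l.
Qed.

Lemma block_sum_sum A x x' (c : fn) (Phi : {set I} -> fn) :
  nneg c -> (forall T, nneg (Phi T)) ->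
  block_sum A x x' (fun S => \sum_T c T * Phi T S) = \sum_T c T * block_sum A x x' (Phi T).
Proof.
move=> c0 Phi0; rewrite /block_sum.
have in0 T q1 q2 : 0 <= weight (last x q1) q2 * Phi T (tr (q1 ++ q2)).
  by rewrite mule_ge0 //; exact: Phi0.
have in1 T q1 : 0 <= \esum_(q2 in [set q | first_hit A B q /\ last (last x q1) q = x'])
      (weight (last x q1) q2 * Phi T (tr (q1 ++ q2))) by exact: esum_ge0.
under [RHS]eq_bigr => T _ do (rewrite -esumZl //; last by move=> q; rewrite mule_ge0).
rewrite -esum_sum; last by move=> *; rewrite !mule_ge0.
apply: eq_esum => q1 _.
under [RHS]eq_bigr => T _ do rewrite muleCA.
rewrite -ge0_sume_distrr; last by move=> T _; rewrite mule_ge0.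
congr (_ * _); under [RHS]eq_bigr => T _ do (rewrite -esumZl //).
rewrite -esum_sum; last by move=> *; rewrite !mule_ge0.
apply: eq_esum => q2 _; rewrite ge0_sume_distrr; last by move=> T _; rewrite mule_ge0 //; exact: Phi0.
by apply: eq_bigr => T _; rewrite muleCA.
Qed.

(** The sum over chains is organised by the endpoints [x'] of the blocks, so that an inequality
    between single blocks with prescribed endpoints can be iterated. The trace of the blocks already
    read is carried along by [shift]. *)
Fixpoint chain_fun A n (x z : V) phi : \bar R :=
  if n is m.+1 then
    \esum_(x' in [set x' | B x']) block_sum A x x' (fun S => chain_fun A m x' z (shift phi S))
  else if x == z then phi finset.set0 else 0.

Lemma shift_nneg phi S : nneg phi -> nneg (shift phi S).
Proof. by move=> h S'; exact: h. Qed.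

Lemma chain_fun_ge0 A n x z phi : nneg phi -> 0 <= chain_fun A n x z phi.
Proof.
elim: n x phi => [|n IH] x phi h /=; first by case: ifP.
by apply: esum_ge0 => x' _; apply: block_sum_ge0 => S; apply: IH; exact: shift_nneg.
Qed.

Lemma le_chain_fun A n x z phi psi : (forall S, phi S <= psi S) ->
  chain_fun A n x z phi <= chain_fun A n x z psi.
Proof.
elim: n x phi psi => [|n IH] x phi psi h /=; first by case: ifP.
by apply: le_esum => x' _; apply: le_block_sum => S; apply: IH => S'; exact: h.
Qed.

Lemma chain_fun_sum A n x z (c : fn) (phi : {set I} -> fn) :
  nneg c -> (forall T, nneg (phi T)) ->
  chain_fun A n x z (fun S => \sum_T c T * phi T S) = \sum_T c T * chain_fun A n x z (phi T).
Proof.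
elim: n x phi => [|n IH] x phi c0 phi0 /=.
  by case: ifP => // _; rewrite big1 // => T _; rewrite mule0.
have ge T x' : nneg (fun S => chain_fun A n x' z (shift (phi T) S)).
  by move=> S; apply: chain_fun_ge0; exact: shift_nneg.
under [RHS]eq_bigr => T _ do (rewrite -esumZl //; last by move=> x'; exact: block_sum_ge0).
rewrite -esum_sum; last by move=> x' T _ _; rewrite mule_ge0 // block_sum_ge0.
apply: eq_esum => x' _; rewrite -block_sum_sum //; congr block_sum.
by apply/funext => S; rewrite /shift IH // => T S'; exact: phi0.
Qed.

Lemma chain_fun_flat A n x z phi : nneg phi ->
  chain_fun A n.+1 x z phi =
  \esum_(q1 in [set q | first_hit predT D q]) (weight x q1 *
    \esum_(q2 in [set q | first_hit A B q])
      (weight (last x q1) q2 *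
        chain_fun A n (last (last x q1) q2) z (shift phi (tr (q1 ++ q2))))).
Proof.
move=> h /=; rewrite /block_sum esum_exchange; last first.
  move=> x' q; rewrite mule_ge0 // esum_ge0 // => r _; rewrite mule_ge0 //.
  by apply: chain_fun_ge0; exact: shift_nneg.
apply: eq_esum => q1 _; rewrite esumZl //; last first.
  move=> x'; apply: esum_ge0 => r _; rewrite mule_ge0 //.
  by apply: chain_fun_ge0; exact: shift_nneg.
congr (_ * _).
rewrite [RHS](esum_fiber _ (fun q => last (last x q1) q)); last first.
  by move=> r; rewrite mule_ge0 //; apply: chain_fun_ge0; exact: shift_nneg.
rewrite esum_mkcond; apply: eq_esum => x' _; case: ifPn => [_|].
  by apply: eq_esum => r [_ ->].
move=> nB; rewrite esum1 // => r [/= hr rx]; exfalso; move/negP: nB; apply.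
by rewrite inE /= -rx; exact: first_hit_last hr.
Qed.

Definition chain_sum A n (x z : V) phi : \bar R :=
  \esum_(q in [set q | chain B D A n q /\ last x q = z]) (weight x q * phi (tr q)).

Lemma chain_sum_le A n x z phi : nneg phi -> chain_sum A n x z phi <= chain_fun A n x z phi.
Proof.
elim: n x phi => [|n IH] x phi h.
  rewrite /chain_sum /=; case: eqP => [xz|xz].
    rewrite (le_trans (esum_subset (B := [set [::]]) _ _)) //.
    - by move=> q [/= ->].
    - by move=> q; rewrite mule_ge0.
    - by rewrite esum_set1 ?mule_ge0 // weight_nil mul1e tr_nil.
  by rewrite esum1 // => q [/= ->].
rewrite chain_fun_flat //.
apply: (le_trans (split_le (B := [set q | first_hit predT D q])
  (C := fun q1 => [set r | exists q2 q3, [/\ r = q2 ++ q3, first_hit A B q2,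
     chain B D A n q3 & last (last (last x q1) q2) q3 = z]])
  (phi := fun q => phi (tr q)) _ _)) => //.
  move=> q _ [/= [q1 [q2 [q3 [-> h1 h2 h3]]]]] hl; exists q1, (q2 ++ q3); split => //.
  by exists q2, q3; split => //; move: hl; rewrite !last_cat.
apply: le_wsum => q1 _ _.
apply: (le_trans (split_le (B := [set q | first_hit A B q])
  (C := fun q2 => [set q3 | chain B D A n q3 /\ last (last (last x q1) q2) q3 = z])
  (phi := fun r => phi (tr (q1 ++ r))) _ _)) => //.
  by move=> r _ [q2 [q3 [-> h1 h2 h3]]]; exists q2, q3.
apply: le_wsum => q2 _ _; apply: le_trans (IH _ _ (shift_nneg _ h)).
by apply: le_esum => q3 _; rewrite catA tr_cat.
Qed.

Lemma chain_sum_ge A n x z phi : nneg phi -> chain_fun A n x z phi <= chain_sum A n x z phi.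
Proof.
elim: n x phi => [|n IH] x phi h.
  rewrite /chain_sum /=; case: eqP => [xz|xz]; last first.
    by apply: esum_ge0 => *; rewrite mule_ge0.
  rewrite (_ : [set q | _] = [set [::]]).
    by rewrite esum_set1 ?mule_ge0 // weight_nil mul1e tr_nil.
  by apply/seteqP; split => q /=; [move=> []|move=> ->].
rewrite chain_fun_flat //.
apply: le_trans (split_ge (B := [set q | first_hit predT D q])
  (C := fun q1 => [set r | exists q2 q3, [/\ r = q2 ++ q3, first_hit A B q2,
     chain B D A n q3 & last (last (last x q1) q2) q3 = z]])
  (phi := fun q => phi (tr q)) _ _ _) => //; last 2 first.
- move=> q1 _ h1 [q2 [q3 [-> h2 h3 h4]]] _; split; last by rewrite !last_cat.
  by exists q1, q2, q3.
- by move=> q r q' r' /= hq _ hq' _; exact: (prefix_free_uniq (@first_hit_prefix_free _ _ _)) hq hq'.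
apply: le_wsum => q1 _ _.
apply: le_trans (split_ge (B := [set q | first_hit A B q])
  (C := fun q2 => [set q3 | chain B D A n q3 /\ last (last (last x q1) q2) q3 = z])
  (phi := fun r => phi (tr (q1 ++ r))) _ _ _) => //; last 2 first.
- by move=> q2 q3 h2 [h3 h4] _; exists q2, q3.
- by move=> q r q' r' /= hq _ hq' _; exact: (prefix_free_uniq (@first_hit_prefix_free _ _ _)) hq hq'.
apply: le_wsum => q2 _ _; apply: (le_trans (IH _ _ (shift_nneg _ h))).
by apply: le_esum => q3 _; rewrite catA [tr (_ ++ q3)]tr_cat.
Qed.

Section comparison.
Variables (A : pred V) (lam : fn).
Hypothesis lam0 : nneg lam.

Definition spread phi : fn := fun S => \sum_T lam T * phi (S :|: T).

Hypothesis block_le : forall x x' Phi, nneg Phi -> B x -> B x' ->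
  block_sum predT x x' Phi <= block_sum A x x' (spread Phi).

Lemma spread_nneg phi : nneg phi -> nneg (spread phi).
Proof. by move=> h S; apply: sume_ge0 => T _; rewrite mule_ge0. Qed.

Lemma iter_spread_nneg n phi : nneg phi -> nneg (iter n spread phi).
Proof. by move=> h; elim: n => //= n IH; exact: spread_nneg. Qed.

Lemma iter_spread_shift n phi S : iter n spread (shift phi S) = shift (iter n spread phi) S.
Proof.
elim: n => //= n ->; apply/funext => S'; rewrite /spread /shift.
by apply: eq_bigr => T _; rewrite finset.setUA.
Qed.

(** Each block brings one [spread]. As [spread] only adds sets to the union, it commutes with
    [shift], and by linearity it passes through the remaining blocks. *)
Lemma chain_fun_compare n x z phi : nneg phi -> B x ->
  chain_fun predT n x z phi <= chain_fun A n x z (iter n spread phi).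
Proof.
elim: n x phi => [|n IH] x phi h Bx //=; apply: le_esum => x' Bx'.
pose Psi S := chain_fun A n x' z (shift (iter n spread phi) S).
have Psi0 : nneg Psi.
  by move=> S; apply: chain_fun_ge0; apply: shift_nneg; exact: iter_spread_nneg.
apply: (@le_trans _ _ (block_sum predT x x' Psi)).
  apply: le_block_sum => S; rewrite /Psi -iter_spread_shift.
  by apply: IH => //; exact: shift_nneg.
apply: (le_trans (block_le Psi0 Bx Bx')); apply: le_block_sum => S.
rewrite /spread -chain_fun_sum //; last first.
  by move=> T; apply: shift_nneg; exact: iter_spread_nneg.
apply: le_chain_fun => S'; rewrite /shift -/spread.
by apply: lee_sum => T _; rewrite finset.setUAC.
Qed.

End comparison.

Section tail.
Variables (qq : R) (rho : V -> \bar R).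
Hypothesis qq0 : (0 <= qq)%R.
Hypothesis rho0 : forall x, 0 <= rho x.
Hypothesis block_q : forall x x', B x -> B x' -> block_sum predT x x' (fun=> 1) <= qq%:E * rho x'.
Hypothesis rho1 : \esum_(x in [set x | B x]) rho x <= 1.

Lemma block_sumZ A' x x' (c : \bar R) : 0 <= c ->
  block_sum A' x x' (fun=> c) = c * block_sum A' x x' (fun=> 1).
Proof.
move=> c0; rewrite /block_sum -esumZl //; last first.
  by move=> q; rewrite mule_ge0 // esum_ge0 // => *; rewrite mule_ge0.
apply: eq_esum => q _; rewrite muleCA; congr (_ * _).
rewrite -esumZl //; last by move=> *; rewrite mule_ge0.
by apply: eq_esum => r _; rewrite muleCA mule1.
Qed.

(** The bound on a block does not involve its starting point, so summing over an intermediate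
    endpoint costs at most [qq] times the total mass of [rho]. *)
Lemma chain_fun_tail n x z : B x -> B z ->
  chain_fun predT n.+1 x z (fun=> 1) <= (qq ^+ n.+1)%:E * rho z.
Proof.
elim: n x => [|n IH] x Bx Bz.
  rewrite expr1 /=; apply: le_trans (block_q Bx Bz).
  rewrite -(@esum_set1 _ _ z (fun x' => block_sum predT x x' (fun=> 1))); last exact: block_sum_ge0.
  rewrite [leLHS]esum_mkcond [leRHS]esum_mkcond; apply: le_esum => x' _.
  rewrite in_set1; case: eqP => [->|h].
    by rewrite ifT ?inE //; apply: le_block_sum => S; rewrite eqxx.
  case: ifP => // _; rewrite /block_sum esum1 // => q _.
  by rewrite esum1 ?mule0 // => r _; rewrite mule0.
have -> : chain_fun predT n.+2 x z (fun=> 1) =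
  \esum_(x' in [set x' | B x']) block_sum predT x x' (fun=> chain_fun predT n.+1 x' z (fun=> 1)) by [].
have qn : 0 <= (qq ^+ n.+1)%:E by rewrite lee_fin exprn_ge0.
have q0 : 0 <= qq%:E by rewrite lee_fin.
apply: (@le_trans _ _ (\esum_(x' in [set x' | B x'])
    ((qq ^+ n.+1)%:E * rho z * (qq%:E * rho x')))).
  apply: le_esum => x' Bx'; rewrite block_sumZ; last exact: chain_fun_ge0.
  apply: lee_pmul; [exact: chain_fun_ge0|exact: block_sum_ge0|exact: IH|exact: block_q].
rewrite esumZl; [|by rewrite mule_ge0|by move=> y; rewrite mule_ge0].
rewrite esumZl // (exprS qq n.+1) [in leRHS]EFinM -muleA (muleCA (rho z)) muleCA.
rewrite -[leRHS]muleA lee_wpmul2l // lee_wpmul2l //.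
by rewrite -[leRHS]mule1 lee_wpmul2l.
Qed.

End tail.

Hypothesis BD : forall v, B v -> ~~ D v.

(** A loop [x :: p] rooted at a mark is read as the chain [rcons p x] from [x] back to [x], with as
    many blocks as the loop has marks. *)
Lemma marked_le n phi : nneg phi ->
  \esum_(s in [set s | marked B D s /\ nmark (marked B D) s = n]) (cycle_weight s * phi (tr s)) <=
  \esum_(x in [set x | B x]) chain_fun predT n x x phi.
Proof.
move=> h.
apply: (@le_trans _ _ (\esum_(x in [set x | B x]) chain_sum predT n x x phi)); last first.
  by apply: le_esum => x _; exact: chain_sum_le.
rewrite /chain_sum esum_esum; last by move=> *; rewrite mule_ge0.
apply: (esum_inj_le (i := fun s => if s is x :: p then (x, rcons p x) else (0%R, [::]))).
- move=> [|x p] [//= ms ns]; have /andP[Bx fp] := ms.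
  split => //=; rewrite last_rcons; split => //.
  by rewrite -ns nmark_crossings //; exact: chainI.
- by move=> [|x p] [|y q] [//= _ _] [//= _ _] [-> /rcons_inj[->]].
- move=> [|x p] [//= _ _]; rewrite cycle_weight_cons -cat1s -cats1 !tr_cat.
  by rewrite finset.setUC.
- by move=> k; rewrite mule_ge0.
Qed.

Lemma marked_ge (P A : pred V) n phi : nneg phi -> (0 < n)%N ->
  (forall x q, B x -> path (@neighbor d) x q -> chain B D A n q -> all P q) ->
  \esum_(x in [set x | B x]) chain_fun A n x x phi <=
  \esum_(s in [set s | [/\ marked B D s, nmark (marked B D) s = n & all P s]])
     (cycle_weight s * phi (tr s)).
Proof.
move=> h n0 hP.
apply: (@le_trans _ _ (\esum_(x in [set x | B x]) chain_sum A n x x phi)).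
  by apply: le_esum => x _; exact: chain_sum_ge.
rewrite /chain_sum esum_esum; last by move=> *; rewrite mule_ge0.
rewrite (_ : esum _ _ = \esum_(k in ([set x | B x] `*`` (fun x => [set q | chain B D A n q /\ last x q = x]))
   `&` [set k | path (@neighbor d) k.1 k.2]) (weight k.1 k.2 * phi (tr k.2))); last first.
  rewrite [RHS]esum_mkcondr; apply: eq_esum => -[x q] /= _.
  by case: ifPn => //; rewrite notin_setE /= => /negP /weight_path ->; rewrite mul0e.
have rc (q : seq V) x : chain B D A n q -> last x q = x -> exists p, q = rcons p x.
  move=> hq; case/lastP: q hq => [|p y]; last by rewrite last_rcons => _ ->; exists p.
  move=> hq _; exfalso; have [] := chain_crossings BD hq => /=.
  by case: n n0 {hP hq}.
have tk (p : seq V) x : take (size p) (rcons p x) = p by rewrite -cats1 take_size_cat.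
apply: (esum_inj_le (i := fun k => k.1 :: take (size k.2).-1 k.2)).
- move=> [x q] [/= [Bx [hq qx]] pq]; have [p qE] := rc _ _ hq qx.
  have := hP _ _ Bx pq hq; move: hq; rewrite qE size_rcons /= tk => hq.
  rewrite all_rcons => /andP[Px Pp]; have := chain_last BD hq => mp.
  split; [exact: mp| |by rewrite /= Px].
  by rewrite nmark_crossings //; have [] := chain_crossings BD hq.
- move=> [x q] [y q'] [/= [Bx [hq qx]] _] [/= [By [hq' qy]] _] [xy].
  subst y; have [p ->] := rc _ _ hq qx; have [p' ->] := rc _ _ hq' qy.
  by rewrite !size_rcons /= !tk => ->.
- move=> [x q] [/= [Bx [hq qx]] _]; have [p qE] := rc _ _ hq qx.
  rewrite qE size_rcons /= tk cycle_weight_cons.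
  by rewrite -(cat1s x p) -[in leLHS]cats1 !tr_cat finset.setUC cats1.
- by move=> s; rewrite mule_ge0 // cycle_weight_ge0.
Qed.

End chain_sums.

(** * Two distant balls *)

Section escape_avoiding.
Context {R : realType} (d : nat).
Notation V := 'rV[int]_d.
Notation weight := (@weight R d).

(** In contrast to [avoiding_escape_le], the continuation still has its interior in [A], so its
    bound may contain a second escape probability. The exit point must differ from [u], for
    otherwise the continuation would be empty. *)
Lemma avoiding_escape_avoiding (B U A : pred V) (x u : V) (g : \bar R) : (0 <= g)%E -> ~~ U u ->
  ~~ B u -> (forall y, A y -> ~~ B y) ->
  (forall p, first_hit (predC B) (predC U) p -> path (@neighbor d) x p ->
     last x p <> u /\ (avoiding A (last x p) u <= g)%E) ->
  (avoiding A x u <= escape B U x * g)%E.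
Proof.
move=> g0 Uu Bu AB h; pose F := [set p | first_hit (predC B) (predC U) p].
have -> : avoiding A x u = \esum_(p in [set p | all A p]) (weight x (rcons p u) * 1)%E.
  by apply: eq_esum => p _; rewrite mule1.
have -> : \esum_(p in [set p | all A p]) (weight x (rcons p u) * 1)%E =
    \esum_(p in [set p | exists2 q, p = rcons q u & all A q]) (weight x p * 1)%E.
  apply/esym; apply: (@reindex_esum _ _ _ _ _ (fun p => rcons p u)); split.
  - by move=> p /= Ap; exists p.
  - by move=> p q _ _ /rcons_inj[].
  - by move=> _ /= [p -> Ap]; exists p.
apply: (@le_trans _ _ (\esum_(q in F) (weight x q * (avoiding A (last x q) u))%E)); last first.
  by apply: wsum_le => // p Fp pp; have [] := h p Fp pp.
apply: (le_trans (split_le (B := F `&` [set q | last x q <> u])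
  (C := fun q => [set r | exists2 r0, r = rcons r0 u & all A r0]) (phi := fun=> 1%E) _ _)) => //.
  move=> p pp /= [q pE Aq].
  have [||q1 [q2 [e h1]]] := @has_first_hit _ (predC B) (predC U) (rcons q u).
  - by rewrite has_rcons /= Uu.
  - rewrite all_rcons /= Bu /=; apply/allP => y yq /=.
    by rewrite AB //; exact: (allP Aq).
  have pq1 : path (@neighbor d) x q1 by move: pp; rewrite pE e cat_path => /andP[].
  have [q1u _] := h q1 h1 pq1.
  exists q1, q2; split => //=; first by rewrite pE.
  case/lastP: q2 e => [|r0 y] e; first by move: q1u; rewrite -[q1]cats0 -e last_rcons.
  move: e; rewrite -rcons_cat => /rcons_inj[qE uy]; exists r0; rewrite ?uy //.
  by move: Aq; rewrite qE all_cat => /andP[].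
apply: (@le_trans _ _ (\esum_(q in F `&` [set q | last x q <> u]) (weight x q * (avoiding A (last x q) u))%E)).
  apply: le_esum => q _; rewrite lee_wpmul2l // /avoiding.
  rewrite [leLHS](@reindex_esum _ _ _ [set r | all A r] _ (fun p => rcons p u)).
    by apply: le_esum => p _; rewrite mule1.
  split.
  + by move=> p /= Ap; exists p.
  + by move=> p r _ _ /rcons_inj[].
  + by move=> _ /= [p -> Ap]; exists p.
by apply: esum_subset => [q []//|q]; rewrite mule_ge0 // avoiding_ge0.
Qed.

Lemma le_hit_at (A A' B : pred V) (u x : V) : (forall y, A y -> A' y) ->
  (hit_at A B u x <= hit_at A' B u x :> \bar R)%E.
Proof.
by move=> AA'; apply: esum_subset => // p [/= h1 h2]; split => //; exact: first_hit_sub h1.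
Qed.

Lemma last_split (B : pred V) (m : seq V) (y : V) : B y ->
  exists t2 t3, [/\ m = t2 ++ t3, B (last y t2) & ~~ has B t3].
Proof.
move=> By; have [hm|hm] := boolP (has B m); last by exists [::], m.
suff [t2 [t3 [-> h1 h2]]] : exists t2 t3, [/\ m = t2 ++ t3, B (last y t2) & ~~ has B t3] by exists t2, t3.
elim: m y By hm => //= v m IH y By.
have [hm|hm] := boolP (has B m).
  move=> _; have [Bv|Bv] := boolP (B v).
    by have [t2 [t3 [-> h1 h2]]] := IH v Bv hm; exists (v :: t2), t3.
  have [t2 [t3 [mE h1 h2]]] := IH y By hm.
  case: t2 mE h1 => [|w t2] mE h1; first by exfalso; move: hm; rewrite mE /= (negbTE h2).
  by exists (v :: w :: t2), t3; rewrite mE.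
by rewrite orbF => Bv; exists [:: v], m.
Qed.

End escape_avoiding.

(* Excursions run from the box of radius L to distance r' L, while escape
   probabilities are normalised by the box of radius r L. *)
Section two_balls.
Context {R : realType} (d : nat).
Notation V := 'rV[int]_d.
Notation weight := (@weight R d).
Notation decay := (@decay R d).
Hypothesis hd : (3 <= d)%N.
Variables (c C : R) (r r' : nat).
Hypothesis est : green_estimates d c C.
Hypothesis r2 : (2 <= r)%N.
Hypothesis Hr : 4 * C ^+ 2 * decay r <= c * decay 2 ^+ 2.
Hypothesis Hr2 : 4 * C * decay r <= 1.
Hypothesis rr' : (2 * r.+1 <= r')%N.
Let lc := lower_const d c.
Hypothesis Hq : 4 * (C * decay r') <= decay 2 * lc * decay (2 * r.+1).
Variables (I : finType) (tr : seq V -> {set I}).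
Hypothesis tr_cat : forall p q, tr (p ++ q) = tr p :|: tr q.
Hypothesis tr_nil : tr [::] = finset.set0.

Variables (L s : nat).
Hypothesis L0 : (0 < L)%N.
Hypothesis hs : (8 * r'.+1 <= s)%N.
Let a := (r * L)%N.
Let a' := (r' * L)%N.

Lemma scales : [/\ (2 * L <= a)%N, (2 * (a + L) <= a')%N & (8 * (a' + L) <= s * L)%N].
Proof. by rewrite -!mulSnr !mulnA !leq_mul2r r2 rr' hs !orbT. Qed.

Lemma lc_gt0 : 0 < lc. Proof. exact: lower_const_gt0 est. Qed.

(** * One ball: geometric decay in the number of excursions *)

Section one_ball.
Variables (x1 x2 : V).
Hypothesis x12 : dist x1 x2 = (s * L)%N.
Notation B := (box x1 L).
Notation D := (predC (box x1 a')).

(** A block reaches distance beyond [r' * L] and then returns at [x']; [hit_upper] bounds the return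
    by the escape probability at [x']. Normalised by [escape_sum] this is a subprobability in [x'],
    and [Hq] makes the remaining factor 1/4. *)
Lemma block_tail x x' : B x -> B x' ->
  (block_sum B D tr predT x x' (fun=> 1%E) <=
    (4^-1 : R)%:E * (escape B (box x1 a) x' * (lc * decay (2 * (a + L)))%:E))%E.
Proof.
move=> Bx Bx'; have [aL aa' a's] := scales; have [c0 C0 _ _ _] := est.
have l0 := lc_gt0; have e0 := escape_ge0 (R := R) B (box x1 a) x'.
pose g := (escape B (box x1 a) x' * (C * (decay a' / decay 2))%:E)%E.
have g0 : (0 <= g)%E.
  by rewrite mule_ge0 // lee_fin !mulr_ge0 ?invr_ge0 ?decay_ge0 ?(ltW C0).
apply: (@le_trans _ _ g).
  apply: (le_trans (wsum_le (c := g) (f := fun q1 => \esum_(q2 in [set q | first_hit predT B q /\ last (last x q1) q = x'])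
     (weight (last x q1) q2 * 1)%E) _ _)) => //.
    move=> p hp pp; have /andP[u1 _] : (a' < dist (last x p) x1 <= a'.+1)%N.
      apply: (exit_dist pp hp); move: Bx aa'; rewrite /box; clear; lia.
    rewrite (eq_esum (b := fun q2 => weight (last x p) q2)); last by move=> *; rewrite mule1.
    apply: (@le_trans _ _ (escape B (box x1 a) x' * (C * (decay (dist (last x p) x1) / decay 2))%:E)%E).
      by apply: (hit_upper est L0 aL) => //; move: u1 aa'; clear; lia.
    rewrite lee_wpmul2l // lee_fin ler_wpM2l ?(ltW C0) //.
    rewrite ler_wpM2r ?invr_ge0 ?decay_ge0 // le_decay ?(ltnW u1) //.
    by move: aa' L0; clear; lia.
  by rewrite -[leRHS]mul1e lee_wpmul2r // prefix_free_mass //; exact: first_hit_prefix_free.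
rewrite /g muleCA lee_wpmul2l // -EFinM lee_fin.
have -> : (2 * (a + L) = (2 * r.+1) * L)%N by rewrite /a -mulSnr mulnA.
rewrite /a' !decayM mulrA ler_pdivrMr ?decay_gt0 // [leLHS]mulrA.
have -> : 4^-1 * (lc * (decay 2 * decay r.+1 * decay L)) * decay 2 =
  4^-1 * (decay 2 * lc * decay (2 * r.+1)) * decay L by rewrite decayM; ring.
rewrite ler_wpM2r ?decay_ge0 //; have := Hq; lra.
Qed.

Lemma block_tail_mass :
  (\esum_(x in [set x | B x]) (escape B (box x1 a) x * (lc * decay (2 * (a + L)))%:E) <= 1)%E.
Proof.
have [aL aa' a's] := scales; have l0 := lc_gt0.
have k0 : 0 < lc * decay (2 * (a + L)) by rewrite mulr_gt0 // decay_gt0 //; move: L0; clear; lia.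
rewrite esumZr ?lee_fin ?(ltW k0) //; last by move=> x; exact: escape_ge0.
have h : (8 * (a + L) <= dist x1 x2)%N by rewrite x12; move: a's aa'; clear; lia.
have := escape_sum hd est Hr L0 (erefl _) aL h.
rewrite -/a -/lc => h'; apply: (le_trans (lee_wpmul2r _ h')); first by rewrite lee_fin ltW.
by rewrite -EFinM mulVf // gt_eqF.
Qed.

End one_ball.

(** * Replacing an excursion that visits the second ball *)

Section interaction.
Variables (x1 x2 : V).
Hypothesis x12 : dist x1 x2 = (s * L)%N.
Notation B1 := (box x1 L).
Notation B2 := (box x2 L).
Notation D1 := (predC (box x1 a')).
Notation D2 := (predC (box x2 a')).
Notation e1 := (escape (R := R) B1 (box x1 a)).
Notation e2 := (escape (R := R) B2 (box x2 a)).
Hypothesis tr_out : forall p, all (fun y => ~~ B1 y && ~~ B2 y) p -> tr p = finset.set0.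
Notation nneg phi := (forall S : {set I}, 0 <= phi S)%E.

(** [kappa] and [M] are hitting probabilities of a ball at a point after division by the escape
    probability there: [kappa] is a lower bound from distance at most [a' + L], [M] an upper bound
    from distance at least [s * L / 2], which explains the second [decay 2]. *)
Let kappa := lc * decay (a' + L).
Let M := C * (decay (s * L) / decay 2 / decay 2).

Lemma kappa_gt0 : 0 < kappa.
Proof. by rewrite mulr_gt0 ?lc_gt0 // decay_gt0 //; move: L0; clear; lia. Qed.

Lemma M_gt0 : 0 < M.
Proof.
have [_ C0 _ _ _] := est; have [aL aa' a's] := scales.
by rewrite mulr_gt0 // !divr_gt0 ?decay_gt0 //; move: L0 a's; clear; lia.
Qed.

(** The weight by the number of marks appears because a loop arises from one closed arc for each of
    its marked rotations. *)
Definition loop_mass (T : {set I}) : \bar R :=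
  \esum_(t in [set t | all (predC B1) t /\ tr t = T])
    (loop_weight t * (nmark (marked B2 D2) t)%:R%:E)%E.

Lemma loop_mass_ge0 T : (0 <= loop_mass T)%E.
Proof. by apply: esum_ge0 => t _; rewrite mule_ge0 ?loop_weight_ge0 // lee_fin. Qed.

Lemma tr_rot n t : tr (rot n t) = tr t.
Proof. by rewrite /rot tr_cat finset.setUC -tr_cat cat_take_drop. Qed.

Lemma loop_mass_sum (Psi : {set I} -> \bar R) : nneg Psi ->
  (\esum_(t in [set t | marked B2 D2 t /\ all (predC B1) t]) (cycle_weight t * Psi (tr t)) =
   \sum_T loop_mass T * Psi T)%E.
Proof.
move=> h; pose Phi (t : seq V) := if all (predC B1) t then Psi (tr t) else 0%E.
have Phi0 t : (0 <= Phi t)%E by rewrite /Phi; case: ifP.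
have Phirot n t : Phi (rot n t) = Phi t by rewrite /Phi tr_rot /rot all_cat andbC -all_cat cat_take_drop.
have := rotation (marked B2 D2) Phi0 Phirot => rotE.
transitivity (\esum_(t in [set t | marked B2 D2 t]) (cycle_weight t * Phi t))%E.
  rewrite (_ : [set t | _ /\ _] = [set t | marked B2 D2 t] `&` [set t | all (predC B1) t]) //.
  rewrite esum_mkcondr; apply: eq_esum => t _; rewrite /Phi.
  have [h3|/negP h3] := boolP (all (predC B1) t); first by rewrite mem_set.
  by rewrite memNset ?mule0.
rewrite -rotE (esum_fiber _ tr); last first.
  by move=> t; rewrite mule_ge0 ?loop_weight_ge0 // mule_ge0 ?lee_fin ?Phi0.
rewrite esum_fintype; last first.
  by move=> T; apply: esum_ge0 => t _; rewrite mule_ge0 ?loop_weight_ge0 // mule_ge0 ?lee_fin ?Phi0.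
apply: eq_bigr => T _; rewrite /loop_mass -esumZr //; last first.
  by move=> t; rewrite mule_ge0 ?loop_weight_ge0 // lee_fin.
rewrite esum_mkcond [RHS]esum_mkcond; apply: eq_esum => t _.
case: ifPn; case: ifPn => //; rewrite ?inE ?notin_setE /=.
- by move=> [Pt <-] _; rewrite /Phi Pt muleA.
- move=> h1 [_ h2]; rewrite /Phi; case: ifP => h3; last by rewrite !mule0.
  by exfalso; apply: h1.
- by move=> [h1 h2] h3; exfalso; apply: h3.
Qed.

(** The closing piece of an arc: away from the second ball up to distance [r' * L], then back to it
    at a prescribed point. *)
Let return_path y y' : set (seq V) := [set q | exists p1 p2, [/\ q = p1 ++ p2,
  first_hit (predC B2) D2 p1, first_hit (predC B1) B2 p2 & last (last y p1) p2 = y']].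

(** Getting away costs [e2 y] and the 1/2 of [escape_far]; coming back at [y'] while avoiding the
    first ball costs [e2 y'] and [kappa]. *)
Lemma return_lower y y' : B2 y -> B2 y' ->
  (e2 y * (e2 y' * (kappa / 2)%:E) <= \esum_(q in return_path y y') weight y q)%E.
Proof.
move=> By By'; have [aL aa' a's] := scales; have k0 := kappa_gt0.
have e0 := escape_ge0 (R := R) B2 (box x2 a).
have x21 : dist x2 x1 = (s * L)%N by rewrite dist_sym.
under eq_esum do rewrite -[weight _ _]mule1.
apply: le_trans (split_ge (B := [set q | first_hit (predC B2) D2 q])
  (C := fun p1 => [set p2 | first_hit (predC B1) B2 p2 /\ last (last y p1) p2 = y'])
  (phi := fun=> 1%E) _ _ _) => //; last 2 first.
- by move=> p1 p2 h1 [h2 h3] _; exists p1, p2.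
- by move=> q q1 q' q1' /= hq _ hq' _; exact: (prefix_free_uniq (@first_hit_prefix_free _ _ _)) hq hq'.
apply: le_trans (wsum_ge (c := (e2 y' * kappa%:E)%E) _ _).
- have h : (e2 y * (2^-1)%:E <= escape B2 (box x2 a') y)%E.
    by apply: (escape_far hd est Hr2 L0 (erefl _) aL) => //; move: aa' L0; clear; lia.
  apply: le_trans (lee_wpmul2r _ h); last by rewrite mule_ge0 // lee_fin ltW.
  rewrite -muleA lee_wpmul2l // EFinM [X in (_ <= X)%E]muleC -muleA.
  by rewrite lee_wpmul2l.
- by rewrite mule_ge0 // lee_fin ltW.
move=> p hp pp; have /andP[u1 u2] : (a' < dist (last y p) x2 <= a'.+1)%N.
  apply: (exit_dist pp hp); move: By aa'; rewrite /box; clear; lia.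
apply: (@le_trans _ _ (hit_at (predC B1) B2 (last y p) y')); last first.
  by apply: le_esum => q _; rewrite mule1.
apply: le_trans (hit_lower est Hr L0 (erefl _) aL _ _ _) => //.
- rewrite lee_wpmul2l // lee_fin ler_wpM2l ?(ltW lc_gt0) // le_decay //.
    by move: u1; clear; lia.
  by move: u2 L0; clear; lia.
- by move: u1 aa'; clear; lia.
- by rewrite x21; move: u2 a's L0; clear; lia.
Qed.

(** The cut is the last visit to the second ball strictly before the final vertex, so the
    concatenation determines it. *)
Lemma last_visit_uniq (y : V) t q t' q' : B2 (last y t) -> B2 (last y t') ->
  (exists q0 z, q = rcons q0 z /\ ~~ has B2 q0) ->
  (exists q0 z, q' = rcons q0 z /\ ~~ has B2 q0) -> t ++ q = t' ++ q' -> t = t'.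
Proof.
wlog tt' : t q t' q' / (size t <= size t')%N.
  move=> h; have [tt'|/ltnW tt'] := leqP (size t) (size t'); first exact: (h t q t' q').
  by move=> h1 h2 h3 h4 e; apply/esym; exact: (h t' q' t q).
move=> _ Bt' [q0 [z [qE nB]]] [q0' [z' [q'E _]]] e.
have [m t'E] : exists m, t' = t ++ m.
  exists (drop (size t) t'); rewrite -{1}[t'](cat_take_drop (size t)); congr (_ ++ _).
  by have := congr1 (take (size t)) e; rewrite take_size_cat // takel_cat.
move: e; rewrite t'E -catA => /eqP; rewrite eqseq_cat // eqxx /= => /eqP e.
case/lastP: m t'E e => [|m v] t'E e; first by rewrite cats0.
exfalso; move: e; rewrite qE q'E -rcons_cat => /rcons_inj[q0E _].
move: nB; rewrite q0E has_cat has_rcons negb_or => /andP[]; rewrite negb_or => /andP[nBv _] _.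
by move: Bt'; rewrite t'E -rcons_cat last_rcons (negbTE nBv).
Qed.

(** An arc from [y] through the complement of the first ball, closed by a return path to [y], is a
    loop marked at [y]. Apart from [y] itself the return path stays outside both balls, so the trace
    is still that of [y :: t]. *)
Lemma arcs_le_loop_mass (Psi : {set I} -> \bar R) : nneg Psi ->
  ((\esum_(y in [set y | B2 y]) (e2 y *
      \esum_(t in [set t | all (predC B1) t /\ B2 (last y t)])
         (weight y t * (e2 (last y t) * Psi (tr (y :: t)))))) * (kappa / 2)%:E
    <= \sum_T loop_mass T * Psi T)%E.
Proof.
move=> Psi0; have [aL aa' a's] := scales; have k0 := kappa_gt0.
have e0 := escape_ge0 (R := R) B2 (box x2 a).
have k20 : (0 <= (kappa / 2)%:E)%E by rewrite lee_fin divr_ge0 // ltW.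
have B12 v : B2 v -> ~~ B1 v.
  rewrite /box /= => h; rewrite -ltnNge.
  have := dist_triangle v x1 x2; rewrite x12 (dist_sym x1 v).
  by move: h a's L0; clear; lia.
rewrite -loop_mass_sum // -esumZr //; last first.
  by move=> y; rewrite mule_ge0 // esum_ge0 // => t _; rewrite !mule_ge0.
(* [Q y] consists of the marked loops rooted at [y] that avoid the first ball, with the root moved
   to the end. *)
pose Q y : set (seq V) := [set q | exists p, [/\ q = rcons p y, flag B2 D2 false p & all (predC B1) p]].
apply: (@le_trans _ _ (\esum_(y in [set y | B2 y]) \esum_(q in Q y) (weight y q * Psi (tr q)))%E).
  apply: le_esum => y By.
  apply: (@le_trans _ _ (\esum_(t in [set t | all (predC B1) t /\ B2 (last y t)])
     (weight y t * \esum_(q in return_path (last y t) y) (weight (last y t) q * Psi (tr (y :: t)))))%E).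
    rewrite -muleA muleC -muleA -esumZr //; last 2 first.
    - by rewrite mule_ge0.
    - by move=> t; rewrite !mule_ge0.
    apply: le_esum => t [_ Bt]; rewrite esumZr // -muleA lee_wpmul2l //.
    rewrite muleAC; apply: lee_wpmul2r; first exact: Psi0.
    by apply: le_trans (return_lower Bt By); rewrite (muleC _ (e2 y)).
  apply: le_trans (split_ge (B := [set t | all (predC B1) t /\ B2 (last y t)])
     (C := fun t => return_path (last y t) y `&` [set q | path (@neighbor d) (last y t) q])
     (phi := fun q => Psi (tr q)) _ _ _) => //.
  - apply: le_wsum => t [At Bt] pt.
    rewrite [X in (_ <= X)%E]esum_mkcondr; apply: le_esum => q [p1 [p2 [qE h1 h2 h3]]].
    case: ifPn => [|]; last by rewrite notin_setE /= => /negP /weight_path ->; rewrite mul0e.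
    rewrite inE /= => pq; rewrite lee_wpmul2l //.
    have [q0 [z [p2E Bz hq0]]] := first_hitP h2.
    have zy : z = y by move: h3; rewrite p2E last_rcons.
    have p1out : all (fun y => ~~ B1 y && ~~ B2 y) p1.
      have pp1 : path (@neighbor d) (last y t) p1 by move: pq; rewrite qE cat_path => /andP[].
      have /andP[v1 v2] : (a' < dist (last (last y t) p1) x2 <= a'.+1)%N.
        by apply: (exit_dist pp1 h1); move: Bt aa'; rewrite /box; clear; lia.
      have far v : (dist v x2 <= a'.+1)%N -> ~~ B1 v.
        rewrite /box -ltnNge => hv; have := dist_triangle v x1 x2.
        by rewrite x12 (dist_sym x1 v); move: hv a's L0; clear; lia.
      have [w [v [p1E Dv hw]]] := first_hitP h1.
      move: v2 v1; rewrite p1E last_rcons all_rcons => v2 v1.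
      rewrite far // /box -ltnNge (leq_ltn_trans _ v1) /=; last by move: aa'; clear; lia.
      apply: sub_all hw => b /= /andP[-> ]; rewrite negbK andbT => hb.
      by apply: far; exact: leqW.
    have -> : tr (t ++ q) = tr (y :: t) => //.
    rewrite qE p2E zy -cats1 !tr_cat (tr_out p1out) (tr_out (p := q0)); last first.
      by apply: sub_all hq0 => b /= /andP[-> ->].
    by rewrite !finset.set0U -(cat1s y t) tr_cat finset.setUC.
  - move=> t q [At Bt] [[p1 [p2 [-> h1 h2 h3]]] pq] _.
    have [q0 [z [p2E Bz hq0]]] := first_hitP h2.
    have zy : z = y by move: h3; rewrite p2E last_rcons.
    exists (t ++ (p1 ++ q0)); rewrite p2E zy !rcons_cat; split => //.
      have q0B : ~~ has B2 q0 by rewrite -all_predC; apply: sub_all hq0 => b /andP[].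
      have f1 : flag B2 D2 (flag B2 D2 false t) p1.
        have [w [v [-> Dv hw]]] := first_hitP h1.
        by rewrite -cats1 flag_cat flag_cons Dv.
      by rewrite !flag_cat; have [] := @flag_noB _ B2 D2 _ _ q0B f1.
    rewrite !all_cat At /=; apply/andP; split; last by apply: sub_all hq0 => b /= /andP[].
    have pp1 : path (@neighbor d) (last y t) p1.
      by move: pq; rewrite /= cat_path => /andP[].
    have /andP[v1 v2] : (a' < dist (last (last y t) p1) x2 <= a'.+1)%N.
      by apply: (exit_dist pp1 h1); move: Bt aa'; rewrite /box; clear; lia.
    have far v : (dist v x2 <= a'.+1)%N -> ~~ B1 v.
      rewrite /box -ltnNge => hv; have := dist_triangle v x1 x2.
      by rewrite x12 (dist_sym x1 v); move: hv a's L0; clear; lia.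
    have [w [v [p1E Dv hw]]] := first_hitP h1.
    move: v2; rewrite p1E last_rcons all_rcons /= => v2; rewrite far //=.
    apply: sub_all hw => b /= /andP[_]; rewrite negbK => hb.
    by apply: far; exact: leqW.
  - have rp v q : return_path v y q -> exists q0 z, q = rcons q0 z /\ ~~ has B2 q0.
      move=> [p1 [p2 [-> h1 h2 h3]]]; have [q0 [z [-> Bz hq0]]] := first_hitP h2.
      exists (p1 ++ q0), z; rewrite rcons_cat; split => //.
      rewrite has_cat negb_or -!all_predC; apply/andP; split; last by apply: sub_all hq0 => b /andP[].
      have [w [v' [-> Dv hw]]] := first_hitP h1; rewrite all_rcons /=.
      apply/andP; split; last by apply: sub_all hw => b /andP[].
      by move: Dv; rewrite /box /= -!ltnNge; move: aa'; clear; lia.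
    move=> t q t' q' [_ Bt] [hq _] [_ Bt'] [hq' _].
    exact: (last_visit_uniq Bt Bt' (rp _ _ hq) (rp _ _ hq')) .
rewrite esum_esum; last by move=> *; rewrite mule_ge0.
have tk (p : seq V) x : take (size p) (rcons p x) = p by rewrite -cats1 take_size_cat.
apply: (esum_inj_le (i := fun k => k.1 :: take (size k.2).-1 k.2)).
- move=> [y q] [/= By [p [-> fp Ap]]]; rewrite size_rcons /= tk; split; first by rewrite By.
  by rewrite B12.
- move=> [x q] [y q'] [/= _ [p [-> _ _]]] [/= _ [p' [-> _ _]]] [->].
  by rewrite !size_rcons /= !tk => ->.
- move=> [y q] [/= _ [p [-> _ _]]]; rewrite size_rcons /= tk cycle_weight_cons.
  by rewrite -(cat1s y p) -[in X in (X <= _)%E]cats1 !tr_cat finset.setUC cats1.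
- by move=> t; rewrite mule_ge0 // cycle_weight_ge0.
Qed.

(* Each of the two passages between the balls in a block visiting B2 contributes M.
   Closing up its arc around B2 into a loop costs kappa / 2, and a direct block
   has weight at least kappa. *)
Definition coupling : R := M ^+ 2 / (kappa * (kappa / 2)).

Lemma coupling_ge0 : 0 <= coupling.
Proof. by rewrite divr_ge0 ?sqr_ge0 // mulr_ge0 ?divr_ge0 // ltW // kappa_gt0. Qed.

(* Per block, either nothing is added or one loop around B2. *)
Definition spread_mass (T : {set I}) : \bar R :=
  ((T == finset.set0)%:R%:E + coupling%:E * loop_mass T)%E.

Lemma spread_mass_ge0 T : (0 <= spread_mass T)%E.
Proof. by rewrite adde_ge0 ?mule_ge0 ?loop_mass_ge0 // lee_fin // coupling_ge0. Qed.

Lemma spreadE (Phi : {set I} -> \bar R) S : nneg Phi ->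
  (spread spread_mass Phi S = Phi S + coupling%:E * \sum_T loop_mass T * Phi (S :|: T))%E.
Proof.
move=> h; rewrite /spread /spread_mass.
rewrite (eq_bigr (fun T => (T == finset.set0)%:R%:E * Phi (S :|: T) +
   coupling%:E * (loop_mass T * Phi (S :|: T)))%E); last first.
  by move=> T _; rewrite ge0_muleDl ?muleA ?lee_fin // mule_ge0 ?loop_mass_ge0 // lee_fin coupling_ge0.
rewrite big_split /= -ge0_sume_distrr; last by move=> T _; rewrite mule_ge0 ?loop_mass_ge0.
congr (_ + _)%E; rewrite (bigD1 finset.set0) //= eqxx mul1e finset.setU0 big1 ?adde0 //.
by move=> T /negbTE ->; rewrite mul0e.
Qed.

Lemma hit_far (x0 x' u y : V) : dist x0 x' = (s * L)%N -> box x0 L y ->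
  (s * L <= 2 * dist u x0)%N ->
  (hit_at (predC (box x' L)) (box x0 L) u y <= escape (box x0 L) (box x0 a) y * M%:E)%E.
Proof.
move=> hx By hu; have [aL aa' a's] := scales; have [_ C0 _ _ _] := est.
apply: (@le_trans _ _ (hit_at predT (box x0 L) u y)); first exact: le_hit_at.
apply: (le_trans (hit_upper est L0 aL _ By)).
  by move: hu a's aa'; clear; lia.
rewrite lee_wpmul2l ?escape_ge0 // lee_fin ler_wpM2l ?(ltW C0) //.
rewrite ler_wpM2r ?invr_ge0 ?decay_ge0 // decay_half //.
by move: a's L0; clear; lia.
Qed.

(** Both endpoints lie in balls and each contributes its escape probability: leaving the small box
    around [x2] gives [e2 y'], the rest is [hit_far] for the first ball. *)
Lemma cross_far (y' x' : V) : B2 y' -> B1 x' ->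
  (hit_at (predC B2) B1 y' x' <= e2 y' * (e1 x' * M%:E))%E.
Proof.
move=> By' Bx'; have [aL aa' a's] := scales.
have dd : dist x2 x1 = (s * L)%N by rewrite dist_sym.
have hx2 : (s * L <= L + dist x' x2)%N.
  have := dist_triangle x' x1 x2; rewrite x12 (dist_sym x1 x').
  by move: Bx'; rewrite /box; clear; lia.
rewrite hit_at_avoiding //; apply: avoiding_escape_avoiding.
- by rewrite mule_ge0 ?escape_ge0 // lee_fin ltW // M_gt0.
- by rewrite /box -ltnNge; move: hx2 a's aa' L0; clear; lia.
- by rewrite /box -ltnNge; move: hx2 a's aa' L0; clear; lia.
- by move=> y /andP[].
move=> p hp pp; have /andP[v1 v2] : (a < dist (last y' p) x2 <= a.+1)%N.
  apply: (exit_dist pp hp); move: By' aL; rewrite /box; clear; lia.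
split; first by move=> e; move: v2; rewrite e; move: hx2 a's aa' L0; clear; lia.
rewrite -hit_at_avoiding //; apply: hit_far => //.
have := dist_triangle (last y' p) x1 x2; rewrite x12 (dist_sym x1 (last y' p)).
by move: v2 a's aa' L0; clear; lia.
Qed.

Let arc_sum (Psi : {set I} -> \bar R) (y : V) : \bar R :=
  (\esum_(t in [set t | all (predC B1) t /\ B2 (last y t)])
         (weight y t * (e2 (last y t) * Psi (tr (y :: t)))))%E.

(** The excursion is cut at its first and its last visit to the second ball. The way there costs
    [e2 y * M], the way back from the end y' of the arc costs [e2 y' * e1 x' * M], and the pieces
    outside both balls leave no trace. *)
Lemma detour_le (Phi : {set I} -> \bar R) (S0 : {set I}) (u x' : V) :
  nneg Phi -> (a' < dist u x1 <= a'.+1)%N -> B1 x' ->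
  (\esum_(q in [set q | (first_hit predT B1 q /\ last u q = x') /\ has B2 q])
      (weight u q * Phi (S0 :|: tr q)) <=
   e1 x' * (M ^+ 2)%:E *
    \esum_(y in [set y | B2 y]) (e2 y * arc_sum (fun T => Phi (S0 :|: tr [:: x'] :|: T)) y))%E.
Proof.
move=> Phi0 /andP[u1 u2] Bx'; have [aL aa' a's] := scales.
have dd : dist x2 x1 = (s * L)%N by rewrite dist_sym.
have M0 := M_gt0.
have e10 := escape_ge0 (R := R) B1 (box x1 a); have e20 := escape_ge0 (R := R) B2 (box x2 a).
set Psi := (fun T => Phi (S0 :|: tr [:: x'] :|: T)).
have as0 y : (0 <= arc_sum Psi y)%E.
  by apply: esum_ge0 => t _; rewrite mule_ge0 // mule_ge0 // /Psi.
have c0 : (0 <= e1 x' * M%:E)%E by rewrite mule_ge0 // lee_fin ltW.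
apply: (le_trans (split_le (B := [set t | first_hit (predC B1) B2 t])
  (C := fun t1 => [set r | exists t2 t3, [/\ r = t2 ++ t3, all (predC B1) t2 /\ B2 (last (last u t1) t2),
     first_hit (predC B2) B1 t3 & last (last (last u t1) t2) t3 = x']])
  (phi := fun q => Phi (S0 :|: tr q)) _ _)) => //.
  move=> q _ /= [[hq qx'] hB2]; have [q0 [z [qE Bz hq0]]] := first_hitP hq.
  have zx : z = x' by move: qx'; rewrite qE last_rcons.
  have nB1 : all (predC B1) q0 by apply: sub_all hq0 => b /andP[].
  have [||t1 [m [q0E h1]]] := @has_first_hit _ (predC B1) B2 q0.
  - move: hB2; rewrite qE has_rcons => /orP[|//]; rewrite /box zx => h.
    exfalso; have := dist_triangle x' x1 x2; rewrite x12 (dist_sym x1 x').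
    by move: h Bx' a's L0; rewrite /box; clear; lia.
  - by apply: sub_all nB1 => b /= ->.
  have [t2 [t3 [mE h2 h3]]] := last_split m (first_hit_last u h1).
  move: nB1; rewrite q0E mE !all_cat => /and3P[n1 n2 n3].
  exists t1, (t2 ++ rcons t3 x'); split => //.
    by rewrite qE zx q0E mE -!rcons_cat.
  exists t2, (rcons t3 x'); split => //; last by rewrite last_rcons.
  rewrite first_hit_rcons Bx' /=; apply/allP => b bt3 /=.
  have /= -> := allP n3 b bt3; rewrite andbT.
  by apply: contra h3 => hb; apply/hasP; exists b.
apply: (@le_trans _ _ (\esum_(t1 in [set t | first_hit (predC B1) B2 t])
   (weight u t1 * (e1 x' * M%:E * arc_sum Psi (last u t1))))%E).
  apply: le_wsum => t1 h1 _; set y := last u t1.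
  apply: (le_trans (split_le (B := [set t | all (predC B1) t /\ B2 (last y t)])
    (C := fun t2 => [set t3 | first_hit (predC B2) B1 t3 /\ last (last y t2) t3 = x'])
    (phi := fun q => Phi (S0 :|: tr (t1 ++ q))) _ _)) => //.
    by move=> q _ [t2 [t3 [-> [h2 h2'] h3 h4]]]; exists t2, t3.
  rewrite /arc_sum -esumZl //; last by move=> t; rewrite mule_ge0 // mule_ge0 // /Psi.
  apply: le_esum => t2 [At2 Bt2]; rewrite muleCA lee_wpmul2l //.
  apply: (@le_trans _ _ (hit_at (predC B2) B1 (last y t2) x' * Psi (tr (y :: t2)))%E).
    rewrite /hit_at -esumZr //; last by rewrite /Psi.
    apply: le_esum => t3 [h3 t3x]; rewrite lee_wpmul2l // /Psi.
    have [q0 [z [t3E Bz hq0]]] := first_hitP h3.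
    have zx : z = x' by move: t3x; rewrite t3E last_rcons.
    have [p0 [v [t1E Bv hp0]]] := first_hitP h1.
    have vy : v = y by rewrite /y t1E last_rcons.
    rewrite t3E t1E zx vy -!cats1 -(cat1s y t2) !tr_cat.
    rewrite (tr_out (p := q0)); last by apply: sub_all hq0 => b /= /andP[h1' h2']; rewrite h2' h1'.
    rewrite (tr_out (p := p0)); last by apply: sub_all hp0 => b /= /andP[h1' h2']; rewrite h2' h1'.
    rewrite !finset.set0U -(finset.setUA S0) (finset.setUC (tr [:: x'])) ?finset.setUA //.
  rewrite muleA (muleC _ (e2 (last y t2))); apply: lee_wpmul2r; first by rewrite /Psi.
  exact: cross_far.
rewrite (esum_fiber _ (fun t => last u t)); last by move=> t; rewrite mule_ge0 // mule_ge0.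
rewrite -esumZl; [|by rewrite mule_ge0 // lee_fin sqr_ge0|by move=> y; rewrite mule_ge0].
rewrite [X in (_ <= X)%E]esum_mkcond; apply: le_esum => y _.
case: ifPn => [|nB]; last first.
  rewrite esum1 // => t [/= /(first_hit_last u) h] e; exfalso; move/negP: nB; apply.
  by rewrite inE /= -e.
rewrite inE /= => By.
apply: (@le_trans _ _ (hit_at (predC B1) B2 u y * (e1 x' * M%:E * arc_sum Psi y))%E).
  rewrite /hit_at -(@esumZr _ _ _ (e1 x' * M%:E * arc_sum Psi y)%E); [|by rewrite mule_ge0|by []].
  by apply: le_esum => t [_ ->].
have hu : (s * L <= 2 * dist u x2)%N.
  have := dist_triangle u x1 x2; rewrite x12 (dist_sym x1 u).
  by move: u2 a's aa' L0; clear; lia.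
apply: (le_trans (lee_wpmul2r _ (hit_far dd By hu))); first by rewrite mule_ge0.
have rearrange (w m e S : \bar R) : (w * m * (e * m * S) = e * (m * m) * (w * S))%E.
  by rewrite muleACA [RHS]muleACA (muleCA w) (muleA e w m) -(muleA (e * w)%E) -(muleA m m S).
by rewrite expr2 EFinM rearrange.
Qed.

(** Excursions missing the second ball appear on both sides. For the others, [e1 x'] occurs in the
    bound on detours and in the lower bound for direct returns and cancels; [coupling] is defined as
    the ratio of what remains. *)
Lemma block_spread x x' (Phi : {set I} -> \bar R) : nneg Phi -> B1 x -> B1 x' ->
  (block_sum B1 D1 tr predT x x' Phi <=
   block_sum B1 D1 tr (predC B2) x x' (spread spread_mass Phi))%E.
Proof.
move=> Phi0 Bx Bx'; have [aL aa' a's] := scales.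
have e10 := escape_ge0 (R := R) B1 (box x1 a); have e20 := escape_ge0 (R := R) B2 (box x2 a).
have k0 := kappa_gt0; have M0 := M_gt0.
apply: le_wsum => q1 hq1 pq1; set u := last x q1.
have hu : (a' < dist u x1 <= a'.+1)%N.
  by apply: (exit_dist pq1 hq1); move: Bx aa'; rewrite /box; clear; lia.
rewrite (esumID [set q | has B2 q]); last by move=> q _; rewrite mule_ge0.
pose S1 := [set q | first_hit (predC B2) B1 q /\ last u q = x'].
have E : (\esum_(q2 in S1) (weight u q2 * spread spread_mass Phi (tr (q1 ++ q2))) =
    \esum_(q2 in S1) (weight u q2 * (coupling%:E * \sum_T loop_mass T * Phi (tr (q1 ++ q2) :|: T))) +
    \esum_(q2 in S1) (weight u q2 * Phi (tr (q1 ++ q2))))%E.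
  have sm0 q2 : (0 <= \sum_T loop_mass T * Phi (tr (q1 ++ q2) :|: T))%E.
    by apply: sume_ge0 => T _; rewrite mule_ge0 ?loop_mass_ge0.
  have cs0 q2 : (0 <= coupling%:E * \sum_T loop_mass T * Phi (tr (q1 ++ q2) :|: T))%E.
    by rewrite mule_ge0 // lee_fin coupling_ge0.
  rewrite -esumD; [|by move=> q2 _; rewrite mule_ge0|by move=> q2 _; rewrite mule_ge0].
  apply: eq_esum => q2 _; rewrite spreadE // addeC ge0_muleDr //.
rewrite E; apply: leeD; last first.
  apply: esum_subset => [q [[h1 h2] /= /negP nB]|q]; last by rewrite mule_ge0.
  split => //; have [q0 [z [qE Bz hq0]]] := first_hitP h1.
  move: nB; rewrite qE has_rcons negb_or => /andP[_ nB].
  rewrite first_hit_rcons Bz /=; apply/allP => b hb /=.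
  have /= -> := allP hq0 b hb; rewrite andbT.
  by apply: contra nB => Bb; apply/hasP; exists b.
have -> : (\esum_(q2 in S1) (weight u q2 * (coupling%:E * \sum_T loop_mass T * Phi (tr (q1 ++ q2) :|: T))) =
   hit_at (predC B2) B1 u x' * (coupling%:E * \sum_T loop_mass T * Phi (tr q1 :|: tr [:: x'] :|: T)))%E.
  rewrite /hit_at -esumZr //; last first.
    rewrite mule_ge0 // ?lee_fin ?coupling_ge0 // sume_ge0 // => T _.
    by rewrite mule_ge0 ?loop_mass_ge0.
  apply: eq_esum => q2 [h1 h2]; have [q0 [z [qE Bz hq0]]] := first_hitP h1.
  have zx : z = x' by move: h2; rewrite qE last_rcons.
  rewrite qE zx -cats1 !tr_cat (tr_out (p := q0)) ?finset.set0U //.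
  by apply: sub_all hq0 => b /= /andP[h1' h2']; rewrite h1' h2'.
pose X := (\esum_(y in [set y | B2 y])
  (e2 y * arc_sum (fun T => Phi (tr q1 :|: tr [:: x'] :|: T)) y))%E.
have hX := detour_le (tr q1) Phi0 hu Bx'; rewrite -/X in hX.
apply: (@le_trans _ _ (e1 x' * (M ^+ 2)%:E * X)%E).
  apply: le_trans hX; rewrite (_ : _ `&` _ = [set q | (first_hit predT B1 q /\ last u q = x') /\ has B2 q]) //.
  by apply: le_esum => q _; rewrite tr_cat.
have arcs : (X * (kappa / 2)%:E <= \sum_T loop_mass T * Phi (tr q1 :|: tr [:: x'] :|: T))%E.
  exact: arcs_le_loop_mass.
have hl : (e1 x' * kappa%:E <= hit_at (predC B2) B1 u x')%E.
  have /andP[u1 u2] := hu.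
  apply: le_trans (hit_lower est Hr L0 (erefl _) aL _ _ _) => //.
  - rewrite lee_wpmul2l // lee_fin ler_wpM2l ?(ltW lc_gt0) // le_decay //.
      by move: u1; clear; lia.
    by move: u2 L0; clear; lia.
  - by move: u1 aa'; clear; lia.
  - by rewrite x12; move: u2 a's L0; clear; lia.
have X0 : (0 <= X)%E.
  by apply: esum_ge0 => y _; rewrite mule_ge0 // esum_ge0 // => t _; rewrite !mule_ge0.
apply: (@le_trans _ _ ((e1 x' * kappa%:E) * (coupling%:E * (X * (kappa / 2)%:E)))%E); last first.
  apply: lee_pmul => //; first by rewrite mule_ge0 // lee_fin ltW.
    by rewrite !mule_ge0 // lee_fin ?coupling_ge0 // divr_ge0 // ltW.
  by rewrite lee_wpmul2l // lee_fin coupling_ge0.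
rewrite -!muleA lee_wpmul2l // (muleC X) !muleA lee_wpmul2r // -!EFinM lee_fin.
rewrite /coupling le_eqVlt; apply/orP; left; apply/eqP.
by field; rewrite gt_eqF.
Qed.

End interaction.

End two_balls.

(** * Masses of traces of loops *)

Section loop_masses.
Context {R : realType} (d : nat) (I : finType).
Notation V := 'rV[int]_d.
Notation weight := (@weight R d).
Notation loop_weight := (@loop_weight R d).
Notation cycle_weight := (@cycle_weight R d).
Variable tr : seq V -> {set I}.
Hypothesis tr_cat : forall p q, tr (p ++ q) = tr p :|: tr q.
Hypothesis tr_nil : tr [::] = finset.set0.
Local Open Scope ereal_scope.
Notation nneg phi := (forall S : {set I}, 0 <= phi S).
Implicit Types (X Y : pred (seq V)) (Psi : {set I} -> \bar R).

Lemma esum_nat_le (f : nat -> \bar R) (M : \bar R) : (forall i, 0 <= f i) ->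
  (forall N, \sum_(i < N) f i <= M) -> \esum_(i in [set: nat]) f i <= M.
Proof.
move=> f0 h; rewrite -nneseries_esumT //; apply: lime_le; first exact: is_cvg_ereal_nneg_natsum.
by apply: nearW => N; rewrite big_mkord.
Qed.

Lemma trace_rot n t : tr (rot n t) = tr t.
Proof. by rewrite /rot tr_cat finset.setUC -tr_cat cat_take_drop. Qed.

Definition trace_mass X T : \bar R := \esum_(t in [set t | X t /\ tr t = T]) loop_weight t.

Lemma trace_mass_ge0 X T : 0 <= trace_mass X T.
Proof. by apply: esum_ge0 => t _; exact: loop_weight_ge0. Qed.

Lemma trace_mass_sum X Psi : nneg Psi ->
  \sum_T trace_mass X T * Psi T = \esum_(t in [set t | X t]) (loop_weight t * Psi (tr t)).
Proof.
move=> h; rewrite [RHS](esum_fiber _ tr); last by move=> t; rewrite mule_ge0 ?loop_weight_ge0.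
rewrite esum_fintype; last first.
  by move=> T; apply: esum_ge0 => t _; rewrite mule_ge0 ?loop_weight_ge0.
apply: eq_bigr => T _; rewrite /trace_mass -esumZr //; last by move=> t; exact: loop_weight_ge0.
by apply: eq_esum => t [_ ->].
Qed.

Lemma trace_mass_total X : \sum_T trace_mass X T = \esum_(t in [set t | X t]) loop_weight t.
Proof.
have := trace_mass_sum X (Psi := fun=> 1) (fun=> lee01).
under eq_bigr do rewrite mule1.
by move=> ->; apply: eq_esum => t _; rewrite mule1.
Qed.

Definition rotation_invariant X := forall n t, X (rot n t) = X t.

Lemma rotation_invariant_all (P : pred V) : rotation_invariant (all P).
Proof. by move=> n t; rewrite /rot all_cat andbC -all_cat cat_take_drop. Qed.

Lemma has_rotation (P : pred V) : rotation_invariant (has P).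
Proof. by move=> n t; rewrite /rot has_cat orbC -has_cat cat_take_drop. Qed.

Section one_ball.
Variables B D : pred V.
Hypothesis BD : forall v, B v -> ~~ D v.
Notation count := (nmark (marked B D)).

Lemma count_gt0_has t : (0 < count t)%N -> has B t.
Proof.
rewrite /nmark lt0n; apply: contraR => nB; rewrite big1 // => i _.
apply/eqP; rewrite eqb0; apply: contra nB; rewrite -(has_rotation B i).
by case: (rot i t) => //= x p /andP[->].
Qed.

(** Rotate the loop so that it ends in [D], and then further to the first visit to [B]: the
    resulting rotation is marked. *)
Lemma has_count_gt0 t : has B t -> has D t -> (0 < count t)%N.
Proof.
move=> hB /(has_nthP 0%R)[i it Di].
have [k [q [y [tE Dy]]]] : exists k q y, rot k t = rcons q y /\ D y.
  exists i.+1, (drop i.+1 t ++ take i t), (nth 0%R t i); split => //.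
  by rewrite /rot (take_nth 0%R) // -rcons_cat.
have hBq : has B q.
  move: hB; rewrite -(has_rotation B k) tE has_rcons => /orP[/BD|//].
  by rewrite Dy.
have [q1 [b [q2 [qE Bb nB]]]] : exists q1 b q2, [/\ q = q1 ++ b :: q2, B b & ~~ has B q1].
  have [||p1 [q2 [e /first_hitP[q1 [b [pE Bb nB]]]]]] := @has_first_hit _ predT B q.
  - by [].
  - exact/allP.
  exists q1, b, q2; split => //; first by rewrite e pE cat_rcons.
  by rewrite -all_predC; apply: sub_all nB => v.
have e : rot (size q1) (rot k t) = b :: (rcons q2 y ++ q1).
  by rewrite tE qE rcons_cat rcons_cons rot_size_cat.
have mk : marked B D (rot (size q1) (rot k t)).
  rewrite e /= Bb /= flag_cat -cats1 flag_cat flag_cons Dy flag_nil.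
  by have [] := @flag_noB _ B D true q1 nB isT.
rewrite -(nmark_rot _ k) -(nmark_rot _ (size q1)) /nmark.
move: mk; rewrite e; set u := b :: _ => mk; rewrite big_ord_recl rot0 mk; by [].
Qed.

Lemma marked_loops X n Psi : rotation_invariant X -> nneg Psi ->
  \esum_(s in [set s | [/\ marked B D s, count s = n & X s]]) (cycle_weight s * Psi (tr s)) =
  n%:R%:E * \esum_(t in [set t | count t = n /\ X t]) (loop_weight t * Psi (tr t)).
Proof.
move=> Xrot h; have lw0 := @loop_weight_ge0 R d; have cw0 := @cycle_weight_ge0 R d.
pose Phi (t : seq V) := if (count t == n) && X t then Psi (tr t) else 0.
have Phi0 t : 0 <= Phi t by rewrite /Phi; case: ifP.
have Phirot k t : Phi (rot k t) = Phi t by rewrite /Phi nmark_rot Xrot trace_rot.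
rewrite -esumZl; [|by rewrite lee_fin|by move=> t; rewrite mule_ge0].
transitivity (\esum_(s in [set s | marked B D s]) (cycle_weight s * Phi s)).
  rewrite (_ : [set s | _] = [set s | marked B D s] `&` [set s | (count s == n) && X s]); last first.
    apply/seteqP; split => s /=; first by move=> [-> -> ->]; rewrite eqxx.
    by move=> [-> /andP[/eqP -> ->]].
  rewrite esum_mkcondr; apply: eq_esum => t _; rewrite /Phi mem_setE unfold_in.
  by case: ifP => // _; rewrite mule0.
rewrite -rotation // [RHS]esum_mkcond; apply: eq_esum => t _.
rewrite /Phi; case: ifPn => [/andP[/eqP cn Xt]|nc].
  by rewrite mem_set /= ?cn // muleCA.
rewrite memNset ?mule0 // => -[/eqP cn Xt]; move: nc; by rewrite cn Xt.
Qed.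

Section tail.
Variable rho : V -> \bar R.
Hypothesis rho0 : forall x, 0 <= rho x.
Hypothesis block_q : forall x x', B x -> B x' ->
  block_sum B D tr predT x x' (fun=> 1) <= (4^-1)%:E * rho x'.
Hypothesis rho1 : \esum_(x in [set x | B x]) rho x <= 1.

(** The factor n on the left is the number of marked rotations; it turns unrooted loops into chains,
    to which [chain_fun_tail] applies. *)
Lemma layer_tail n : (0 < n)%N ->
  \esum_(t in [set t | count t = n]) (loop_weight t * n%:R%:E) <= (4^-1 ^+ n)%:E.
Proof.
case: n => // n _; have lw0 := @loop_weight_ge0 R d.
rewrite esumZr ?lee_fin // muleC.
have := @marked_loops predT n.+1 (fun=> 1) (fun _ _ => erefl) (fun=> lee01).
rewrite (_ : [set s | [/\ _, _ & _]] = [set s | marked B D s /\ count s = n.+1]); last first.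
  by apply/seteqP; split => s /=; [move=> []|move=> [-> ->]].
rewrite (_ : [set s | _ /\ predT _] = [set s | count s = n.+1]); last first.
  by apply/seteqP; split => s /=; [move=> []|move=> ->].
under [X in _ = _ * X]eq_esum do rewrite mule1.
move=> <-; apply: (le_trans (marked_le tr_cat tr_nil BD _ (fun=> lee01))).
apply: (@le_trans _ _ (\esum_(x in [set x | B x]) ((4^-1 ^+ n.+1)%:E * rho x))).
  apply: le_esum => x Bx; apply: chain_fun_tail => //.
rewrite esumZl // ?lee_fin ?exprn_ge0 // -[leRHS]mule1 lee_wpmul2l // lee_fin exprn_ge0 //.
Qed.

Lemma count_tail m :
  \esum_(t in [set t | (m < count t)%N]) (loop_weight t * (count t)%:R%:E) <= (4^-1 ^+ m)%:E.
Proof.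
have lw0 t : 0 <= loop_weight t * (count t)%:R%:E.
  by rewrite mule_ge0 ?loop_weight_ge0 // lee_fin.
have q0 n : (0 <= 4^-1 ^+ n :> R)%R by rewrite exprn_ge0.
rewrite (esum_fiber _ (fun t => count t)) //.
apply: (@le_trans _ _ (\esum_(j in [set: nat]) (if (m < j)%N then 4^-1 ^+ j else 0)%R%:E)).
  apply: le_esum => j _; case: ifPn => [mj|mj].
    apply: le_trans (layer_tail (leq_trans _ mj)) => //.
    apply: (@le_trans _ _ (\esum_(t in [set t | count t = j]) (loop_weight t * (count t)%:R%:E))).
      by apply: esum_subset => // t [].
    by apply: le_esum => t /= ->.
  rewrite esum1 // => t [/= mt tj]; by rewrite -tj mt in mj.
apply: esum_nat_le => [i|N]; first by case: ifP => // _; rewrite lee_fin.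
rewrite sumEFin lee_fin.
(* The induction keeps a reserve [2 * 4^-1 ^+ N] for the terms still to come; before [m] is passed,
   the reserve is the whole right side. *)
suff : (\sum_(i < N) (if (m < i)%N then 4^-1 ^+ i else 0) +
   (if (m < N)%N then 2 * 4^-1 ^+ N else 4^-1 ^+ m) <= 4^-1 ^+ m :> R)%R.
  by apply: le_trans; rewrite lerDl; case: ifP => _; rewrite ?mulr_ge0.
elim: N => [|N IH]; first by rewrite big_ord0 add0r.
rewrite big_ord_recr /= -addrA; apply: le_trans IH; rewrite lerD2l.
have := q0 N; have := q0 m; rewrite ltnS exprS.
by case: (ltngtP m N) => [mN|mN|->]; lra.
Qed.

End tail.

End one_ball.

End loop_masses.

(** * Poisson functionals of random finite sets *)

Section union_exponential.
Context {R : realType} (I : finType).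
Notation fn := ({set I} -> R).
Implicit Types (m f g h : fn) (S T U : {set I}).
Notation nneg m := (forall S : {set I}, 0 <= m S).

Definition spreadR m f : fn := fun S => \sum_T m T * f (S :|: T).
Definition mass m : R := \sum_T m T.

Lemma spreadR_ge0 m f : nneg m -> nneg f -> nneg (spreadR m f).
Proof. by move=> m0 f0 S; apply: sumr_ge0 => T _; rewrite mulr_ge0. Qed.

Lemma iter_spreadR_ge0 m f j : nneg m -> nneg f -> nneg (iter j (spreadR m) f).
Proof. by move=> m0 f0; elim: j => //= j IH; exact: spreadR_ge0. Qed.

Lemma mass_ge0 m : nneg m -> 0 <= mass m.
Proof. by move=> m0; apply: sumr_ge0. Qed.

Lemma iter_spreadR_norm m f j (M : R) : nneg m -> (forall S, `|f S| <= M) ->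
  forall S, `|iter j (spreadR m) f S| <= mass m ^+ j * M.
Proof.
move=> m0 fM; elim: j => [|j IH] S; first by rewrite expr0 mul1r.
apply: (le_trans (ler_norm_sum _ _ _)); rewrite exprS -mulrA /mass mulr_suml.
by apply: ler_sum => T _; rewrite normrM ger0_norm // ler_wpM2l ?IH.
Qed.

Definition ex_coeff m f S (j : nat) : R := iter j (spreadR m) f S / j`!%:R.

(** Exponential of the operator [spreadR m], which is convolution with [m] for the union of sets. *)
Definition Ex m f S : R := limn (series (ex_coeff m f S)).

Definition sup_norm f : R := \sum_S `|f S|.

Lemma sup_normP f S : `|f S| <= sup_norm f.
Proof. by rewrite /sup_norm (bigD1 S) //= lerDl; apply: sumr_ge0. Qed.

Lemma Ex_cvg m f S : nneg m -> cvgn (series (ex_coeff m f S)).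
Proof.
move=> m0; apply: normed_cvg.
apply: (@series_le_cvg _ _ (fun j => sup_norm f * exp_coeff (mass m) j)).
- by move=> j /=; exact: normr_ge0.
- by move=> j; rewrite mulr_ge0 ?sumr_ge0 // exp_coeff_ge0 // mass_ge0.
- move=> j /=; rewrite normrM (@ger0_norm _ _^-1) ?invr_ge0 // /exp_coeff mulrA.
  rewrite ler_wpM2r ?invr_ge0 // mulrC.
  by apply: iter_spreadR_norm => // S'; exact: sup_normP.
- rewrite [X in series X](_ : _ = (sup_norm f) *: (exp_coeff (mass m))) //.
  exact/is_cvg_seriesZ/is_cvg_series_exp_coeff.
Qed.

Lemma iter_spreadRD m f g j S :
  iter j (spreadR m) (fun S => f S + g S) S = iter j (spreadR m) f S + iter j (spreadR m) g S.
Proof.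
elim: j S => //= j IH S; rewrite /spreadR -big_split /=; apply: eq_bigr => T _.
by rewrite IH mulrDr.
Qed.

Lemma iter_spreadRZ m f (c : R) j S :
  iter j (spreadR m) (fun S => c * f S) S = c * iter j (spreadR m) f S.
Proof.
elim: j S => //= j IH S; rewrite /spreadR mulr_sumr; apply: eq_bigr => T _.
by rewrite IH mulrCA.
Qed.

Lemma ExD m f g S : nneg m -> Ex m (fun S => f S + g S) S = Ex m f S + Ex m g S.
Proof.
move=> m0; apply/cvg_lim => //.
rewrite (_ : series _ = series (ex_coeff m f S) \+ series (ex_coeff m g S)).
  by apply: cvgD; exact: Ex_cvg.
apply/funext => n; rewrite /series /= -big_split; apply: eq_bigr => j _ /=.
by rewrite /ex_coeff iter_spreadRD mulrDl.
Qed.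

Lemma ExZ m f (c : R) S : nneg m -> Ex m (fun S => c * f S) S = c * Ex m f S.
Proof.
move=> m0; apply/cvg_lim => //.
rewrite (_ : series _ = (fun n => c * series (ex_coeff m f S) n)).
  by apply: cvgM; [exact: cvg_cst|exact: Ex_cvg].
apply/funext => n; rewrite /series /= mulr_sumr; apply: eq_bigr => j _ /=.
by rewrite /ex_coeff iter_spreadRZ mulrA.
Qed.

Lemma Ex0 m S : nneg m -> Ex m (fun=> 0) S = 0.
Proof.
move=> m0; have e : (fun=> 0) = (fun T : {set I} => 0 * (0 : R)).
  by apply/funext => T; rewrite mul0r.
by rewrite e (ExZ (fun=> 0)) // mul0r.
Qed.

Lemma Ex_sum m (K : finType) (c : K -> R) (f : K -> fn) S : nneg m ->
  Ex m (fun S => \sum_k c k * f k S) S = \sum_k c k * Ex m (f k) S.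
Proof.
move=> m0.
suff: forall r : seq K, Ex m (fun S => \sum_(k <- r) c k * f k S) S = \sum_(k <- r) c k * Ex m (f k) S by [].
elim=> [|k r IH].
  rewrite big_nil (_ : (fun T => _) = (fun=> 0)) ?Ex0 //.
  by apply/funext => T; rewrite big_nil.
rewrite big_cons -IH -ExZ // -ExD //; congr (Ex m _ S); apply/funext => T; by rewrite big_cons.
Qed.

Lemma le_iter_spreadR_on (P : pred {set I}) m m' f g j : nneg m -> (forall T, m T <= m' T) ->
  (forall S T, P S -> m T != 0 -> P (S :|: T)) ->
  (forall S, P S -> f S <= g S) -> nneg g ->
  forall S, P S -> iter j (spreadR m) f S <= iter j (spreadR m') g S.
Proof.
move=> m0 mm' Pm fg g0; have m'0 T : 0 <= m' T := le_trans (m0 T) (mm' T).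
elim: j => [|j IH] S PS /=; first exact: fg.
apply: ler_sum => T _; have g0j := iter_spreadR_ge0 j m'0 g0.
have [->|mT] := eqVneq (m T) 0; first by rewrite mul0r mulr_ge0.
apply: (@le_trans _ _ (m T * iter j (spreadR m') g (S :|: T))).
  by rewrite ler_wpM2l // IH // Pm.
by rewrite ler_wpM2r.
Qed.

Lemma le_Ex_on (P : pred {set I}) m m' f g : nneg m -> (forall T, m T <= m' T) ->
  (forall S T, P S -> m T != 0 -> P (S :|: T)) ->
  (forall S, P S -> f S <= g S) -> nneg g ->
  forall S, P S -> Ex m f S <= Ex m' g S.
Proof.
move=> m0 mm' Pm fg g0 S PS; have m'0 T : 0 <= m' T := le_trans (m0 T) (mm' T).
apply: ler_lim; [exact: Ex_cvg|exact: Ex_cvg|].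
apply: nearW => n; apply: ler_sum => j _; rewrite ler_wpM2r ?invr_ge0 //.
exact: (le_iter_spreadR_on j m0 mm' Pm).
Qed.

Lemma le_Ex m m' f g S : nneg m -> (forall T, m T <= m' T) ->
  (forall S, f S <= g S) -> nneg g -> Ex m f S <= Ex m' g S.
Proof. by move=> m0 mm' fg g0; apply: (@le_Ex_on predT). Qed.

Lemma Ex_ge0 m f : nneg m -> nneg f -> nneg (Ex m f).
Proof. by move=> m0 f0 S; rewrite -(Ex0 S m0); apply: le_Ex. Qed.

Definition subset_indic U : fn := fun S => (S \subset U)%:R.

Definition hat m U : R := \sum_(T : {set I} | T \subset U) m T.

(** A union is contained in [U] exactly when each member is, so [subset_indic U] is an eigenvector
    of [spreadR m] with eigenvalue [hat m U]. *)
Lemma iter_void m U j S : iter j (spreadR m) (subset_indic U) S = hat m U ^+ j * subset_indic U S.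
Proof.
elim: j S => [|j IH] S; first by rewrite mul1r.
rewrite /= /spreadR (eq_bigr (fun T => (if T \subset U then m T else 0) * (hat m U ^+ j * subset_indic U S))).
  by rewrite -mulr_suml -big_mkcond exprS mulrA.
move=> T _; rewrite IH /subset_indic finset.subUset.
by case: (T \subset U); rewrite ?andbT ?andbF ?mulr0 ?mul0r.
Qed.

Lemma Ex_void m U S : nneg m -> Ex m (subset_indic U) S = expR (hat m U) * subset_indic U S.
Proof.
move=> m0; apply/cvg_lim => //.
rewrite (_ : series _ = (fun n => series (exp_coeff (hat m U)) n * subset_indic U S)).
  by apply: cvgM; [exact: is_cvg_series_exp_coeff|exact: cvg_cst].
apply/funext => n; rewrite /series /= mulr_suml; apply: eq_bigr => j _ /=.
by rewrite /ex_coeff iter_void /exp_coeff mulrAC.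
Qed.

Definition dirac_set S : fn := fun T => (T == S)%:R.

Lemma fn_dirac f : f = (fun T => \sum_S f S * dirac_set S T).
Proof.
apply/funext => T; rewrite (bigD1 T) //= /dirac_set eqxx mulr1 big1 ?addr0 //.
by move=> S ST; rewrite eq_sym (negbTE ST) mulr0.
Qed.

Definition finlin (phi : fn -> R) := forall f, phi f = \sum_S f S * phi (dirac_set S).

(* The indicators of [S \subset U] span all functions of S. *)
Lemma void_ext (phi psi : fn -> R) : finlin phi -> finlin psi ->
  (forall U, phi (subset_indic U) = psi (subset_indic U)) -> forall f, phi f = psi f.
Proof.
move=> lphi lpsi h f; rewrite lphi lpsi; apply: eq_bigr => S _; congr (_ * _).
have [n] := ubnP #|S|; elim: n => // n IH in S *; rewrite ltnS => Sn.
have := h S; rewrite lphi lpsi (bigD1 S) //= [RHS](bigD1 S) //=.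
rewrite /subset_indic subxx !mul1r => /eqP.
rewrite (eq_bigr (fun T => subset_indic S T * psi (dirac_set T))); first by rewrite (inj_eq (addIr _)) => /eqP.
move=> T TS; rewrite /subset_indic; case: (boolP (T \subset S)) => [TsS|]; last by rewrite !mul0r.
rewrite !mul1r IH //; apply: leq_trans Sn; apply: proper_card.
by rewrite finset.properEneq TS.
Qed.

Lemma finlin_Ex m S : nneg m -> finlin (fun f => Ex m f S).
Proof. by move=> m0 f; rewrite {1}[f]fn_dirac Ex_sum. Qed.

(** On the common eigenvectors [subset_indic U] this is the functional equation of the exponential,
    and [void_ext] extends it to all functions. *)
Lemma Ex_add m m' f S : nneg m -> nneg m' ->
  Ex (fun T => m T + m' T) f S = Ex m (Ex m' f) S.
Proof.
move=> m0 m'0; have mm0 T : 0 <= m T + m' T by rewrite addr_ge0.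
apply: (@void_ext (fun f => Ex (fun T => m T + m' T) f S) (fun f => Ex m (Ex m' f) S)).
- exact: finlin_Ex.
- move=> g /=; rewrite -Ex_sum //; congr Ex; apply/funext => T.
  by rewrite {1}[g]fn_dirac Ex_sum.
- move=> U; rewrite Ex_void // (_ : Ex m' (subset_indic U) = (fun T => expR (hat m' U) * subset_indic U T)).
    by rewrite ExZ // Ex_void // mulrA -expRD /hat big_split addrC.
  by apply/funext => T; rewrite Ex_void.
Qed.

Lemma ExE0 m f S : nneg m -> Ex m f S = Ex m (fun T => f (S :|: T)) finset.set0.
Proof.
move=> m0; congr (limn (series _)); apply/funext => j; congr (_ / _).
rewrite -{1}[S]finset.setU0; move: (finset.set0 : {set I}) => T.
elim: j T => //= j IH T; apply: eq_bigr => T' _; by rewrite -finset.setUA IH.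
Qed.

Lemma Ex1 m S : nneg m -> Ex m (fun=> 1) S = expR (mass m).
Proof.
move=> m0; have e : (fun=> 1) = subset_indic (finset.setT : {set I}).
  by apply/funext => T; rewrite /subset_indic finset.subsetT.
rewrite e Ex_void // /subset_indic finset.subsetT mulr1 /hat /mass; congr expR.
by apply: eq_bigl => T; rewrite finset.subsetT.
Qed.

Lemma Ex_cst m (c : R) S : nneg m -> Ex m (fun=> c) S = c * expR (mass m).
Proof. by move=> m0; rewrite -(Ex1 S m0) -ExZ //; congr Ex; apply/funext => T; rewrite mulr1. Qed.

(* The mean of f (S U X), where X is the union of a Poisson process of sets with intensity m. *)
Definition pois m f S : R := expR (- mass m) * Ex m f S.

End union_exponential.

(** * Inequalities for Poisson functionals *)

Section poisson_functional.
Context {R : realType} (I : finType).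
Notation fn := ({set I} -> R).
Implicit Types (m f g h : fn) (S T U : {set I}).
Notation nneg m := (forall S : {set I}, 0 <= m S).

Lemma Ex_ge_part m f S n : nneg m -> nneg f -> series (ex_coeff m f S) n <= Ex m f S.
Proof.
move=> m0 f0; apply: nondecreasing_cvgn_le; last exact: Ex_cvg.
apply/nondecreasing_seqP => k; rewrite /series /= big_nat_recr //= lerDl.
by rewrite divr_ge0 // iter_spreadR_ge0.
Qed.

Lemma Ex_ge m f S : nneg m -> nneg f -> f S <= Ex m f S.
Proof.
move=> m0 f0; apply: le_trans (Ex_ge_part S 1 m0 f0).
by rewrite /series /= big_nat1 /ex_coeff fact0 divr1.
Qed.

Lemma Ex_ge1 m f S : nneg m -> nneg f -> f S + spreadR m f S <= Ex m f S.
Proof.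
move=> m0 f0; apply: le_trans (Ex_ge_part S 2 m0 f0).
by rewrite /series /= !big_nat_recr //= big_nil /ex_coeff fact0 divr1 (_ : 1`! = 1%N) // divr1 add0r.
Qed.

Lemma ExB m f g S : nneg m -> Ex m (fun T => f T - g T) S = Ex m f S - Ex m g S.
Proof.
move=> m0; rewrite -mulN1r -ExZ // -ExD //; congr (Ex m _ S).
by apply/funext => T; rewrite mulN1r.
Qed.

Lemma Ex_le_add m f S : nneg m -> (forall S, 0 <= f S <= 1) ->
  Ex m f S <= f S + (expR (mass m) - 1).
Proof.
move=> m0 f01; have f0 T : 0 <= 1 - f T by have /andP[_] := f01 T; rewrite subr_ge0.
have := Ex_ge S m0 f0; rewrite (ExB (fun=> 1)) // Ex1 //; lra.
Qed.

Lemma iter_spreadR_scale m f (t : R) j S :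
  iter j (spreadR (fun T => t * m T)) f S = t ^+ j * iter j (spreadR m) f S.
Proof.
elim: j S => [|j IH] S; first by rewrite mul1r.
rewrite /= /spreadR exprS -mulrA !mulr_sumr; apply: eq_bigr => T _.
by rewrite IH; ring.
Qed.

(** The term of order 0 vanishes because [g S = 0], and every other term carries a power of [t] of
    order at least 1. *)
Lemma Ex_scale_le m g S (t : R) : nneg m -> nneg g -> g S = 0 -> 0 <= t <= 1 ->
  Ex (fun T => t * m T) g S <= t * Ex m g S.
Proof.
move=> m0 g0 gS /andP[t0 t1]; have tm0 T : 0 <= t * m T by rewrite mulr_ge0.
have h : cvgn (fun n => t * series (ex_coeff m g S) n).
  by apply: is_cvgM; [exact: is_cvg_cst|exact: Ex_cvg].
have <- : limn (fun n => t * series (ex_coeff m g S) n) = t * Ex m g S.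
  by apply/cvg_lim => //; apply: cvgM; [exact: cvg_cst|exact: Ex_cvg].
apply: ler_lim => //; first exact: Ex_cvg.
apply: nearW => n; rewrite /series /= mulr_sumr; apply: ler_sum => j _.
rewrite /ex_coeff iter_spreadR_scale [leRHS]mulrA ler_wpM2r ?invr_ge0 //.
case: j => [|j]; first by rewrite /= gS !mulr0.
by rewrite ler_wpM2r ?iter_spreadR_ge0 // exprS ler_piMr // exprn_ile1.
Qed.

Lemma pois_ge0 m f S : nneg m -> nneg f -> 0 <= pois m f S.
Proof. by move=> m0 f0; rewrite mulr_ge0 ?expR_ge0 // Ex_ge0. Qed.

Lemma le_pois_on (P : pred {set I}) m f g : nneg m ->
  (forall S T, P S -> m T != 0 -> P (S :|: T)) ->
  (forall S, P S -> f S <= g S) -> nneg g -> forall S, P S -> pois m f S <= pois m g S.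
Proof.
by move=> m0 Pm fg g0 S PS; rewrite ler_wpM2l ?expR_ge0 //; exact: (le_Ex_on m0 _ Pm).
Qed.

Lemma le_pois m f g S : nneg m -> (forall S, f S <= g S) -> nneg g -> pois m f S <= pois m g S.
Proof. by move=> m0 fg g0; apply: (@le_pois_on predT). Qed.

Lemma pois_cst m (c : R) S : nneg m -> pois m (fun=> c) S = c.
Proof. by move=> m0; rewrite /pois Ex_cst // mulrCA -expRD addNr expR0 mulr1. Qed.

Lemma poisD m f g S : nneg m -> pois m (fun T => f T + g T) S = pois m f S + pois m g S.
Proof. by move=> m0; rewrite /pois ExD // mulrDr. Qed.

Lemma poisZ m f (c : R) S : nneg m -> pois m (fun T => c * f T) S = c * pois m f S.
Proof. by move=> m0; rewrite /pois ExZ // mulrCA. Qed.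

Lemma pois_add m m' f S : nneg m -> nneg m' ->
  pois (fun T => m T + m' T) f S = pois m (pois m' f) S.
Proof.
move=> m0 m'0; rewrite /pois ExZ // Ex_add // mulrA -expRD; congr (expR _ * _).
by rewrite /mass big_split opprD.
Qed.

Lemma pois_le1 m f S : nneg m -> (forall S, 0 <= f S <= 1) -> 0 <= pois m f S <= 1.
Proof.
move=> m0 f01; rewrite pois_ge0 //=; last by move=> T; have /andP[] := f01 T.
by rewrite -[leRHS](pois_cst 1 S m0) le_pois // => T; have /andP[] := f01 T.
Qed.

(** The process is empty with probability [expR (- mass m)], at least [1 - mass m]; otherwise [f] is
    at most 1. *)
Lemma pois_le_add m f S : nneg m -> (forall S, 0 <= f S <= 1) -> pois m f S <= f S + mass m.
Proof.
move=> m0 f01; have /andP[f0 f1] := f01 S; have M0 := mass_ge0 m0.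
have h := Ex_le_add S m0 f01; have e0 := expR_gt0 (- mass m).
apply: (@le_trans _ _ (expR (- mass m) * (f S + (expR (mass m) - 1)))); first by rewrite ler_wpM2l // ltW.
have e1 : expR (- mass m) * expR (mass m) = 1 by rewrite -expRD addNr expR0.
have e2 := expR_ge1Dx (- mass m).
have -> : expR (- mass m) * (f S + (expR (mass m) - 1)) =
  expR (- mass m) * f S + expR (- mass m) * expR (mass m) - expR (- mass m) by ring.
rewrite e1.
have : expR (- mass m) * f S <= f S.
  by rewrite ler_piMl // -[leRHS]expR0 ler_expR oppr_le0.
lra.
Qed.

Lemma pois_ge_sub m f S : nneg m -> (forall S, 0 <= f S <= 1) -> f S - mass m <= pois m f S.
Proof.
move=> m0 f01; have g01 T : 0 <= 1 - f T <= 1 by have := f01 T; lra.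
have := pois_le_add S m0 g01.
rewrite (_ : (fun T => 1 - f T) = (fun T => 1 + (-1) * f T)); last by apply/funext => T; ring.
by rewrite (poisD (fun=> 1)) // poisZ // pois_cst //; lra.
Qed.

Definition union_increasing f := forall S T, f S <= f (S :|: T).

Lemma pois_ge_increasing m f S : nneg m -> nneg f -> union_increasing f -> f S <= pois m f S.
Proof.
move=> m0 f0 fi.
have -> : pois m f S = pois m (fun T => f (S :|: T)) finset.set0 by rewrite /pois ExE0.
rewrite -[leLHS](pois_cst (f S) finset.set0 m0); apply: le_pois => // T; exact: fi.
Qed.

(** Superposition: intensity [m'] is [m] together with an independent process of intensity [m' - m],
    which can only raise [f]. *)
Lemma le_pois_increasing m m' f S : nneg m -> (forall T, m T <= m' T) -> nneg f ->
  union_increasing f -> pois m f S <= pois m' f S.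
Proof.
move=> m0 mm' f0 fi; have d0 T : 0 <= m' T - m T by rewrite subr_ge0.
rewrite (_ : m' = (fun T => m T + (m' T - m T))); last by apply/funext => T; rewrite subrKC.
rewrite pois_add //; apply: le_pois => // T; [exact: pois_ge_increasing|exact: pois_ge0].
Qed.

Lemma spreadRC m m' f S : spreadR m (spreadR m' f) S = spreadR m' (spreadR m f) S.
Proof.
rewrite /spreadR; under eq_bigr do rewrite mulr_sumr.
rewrite exchange_big; apply: eq_bigr => T _; rewrite mulr_sumr; apply: eq_bigr => T' _.
by rewrite mulrCA finset.setUAC.
Qed.

Lemma iter_spreadRC m m' j f S :
  iter j (spreadR m) (spreadR m' f) S = spreadR m' (iter j (spreadR m) f) S.
Proof.
elim: j S => //= j IH S; rewrite spreadRC; apply: eq_bigr => T _; by rewrite IH.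
Qed.

Lemma iter_spreadR_shift m j f S :
  iter j (spreadR m) f S = iter j (spreadR m) (fun T => f (S :|: T)) finset.set0.
Proof.
rewrite -{1}[S]finset.setU0; move: (finset.set0 : {set I}) => T.
by elim: j T => //= j IH T; apply: eq_bigr => T' _; rewrite -finset.setUA IH.
Qed.

Lemma iter_spreadR_invariant m j f g S :
  (forall S T, m T != 0 -> f (S :|: T) = f S) ->
  iter j (spreadR m) (fun T => f T * g T) S = f S * iter j (spreadR m) g S.
Proof.
move=> fm; elim: j S => //= j IH S; rewrite /spreadR mulr_sumr; apply: eq_bigr => T _.
have [->|mT] := eqVneq (m T) 0; first by rewrite !mul0r mulr0.
by rewrite IH fm // mulrCA.
Qed.

Lemma le_iter_spreadR m j f g S : nneg m -> (forall S, f S <= g S) ->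
  iter j (spreadR m) f S <= iter j (spreadR m) g S.
Proof.
move=> m0 fg; elim: j S => //= j IH S; apply: ler_sum => T _; by rewrite ler_wpM2l.
Qed.

(** * Counting graftings *)

Section grafting.
Variable Lam : fn.
Hypothesis Lam0 : nneg Lam.

Definition grafting : fn := fun T => (T == finset.set0)%:R + Lam T.

Lemma grafting_ge0 : nneg grafting. Proof. by move=> T; rewrite addr_ge0. Qed.

Lemma mass_grafting : mass grafting = 1 + mass Lam.
Proof.
rewrite /mass big_split /= (bigD1 finset.set0) //= eqxx big1 ?addr0 //.
by move=> T /negbTE ->.
Qed.

Lemma spreadR_grafting f S : spreadR grafting f S = f S + spreadR Lam f S.
Proof.
rewrite /spreadR (eq_bigr (fun T => (T == finset.set0)%:R * f (S :|: T) + Lam T * f (S :|: T))).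
  rewrite big_split /= (bigD1 finset.set0) //= eqxx mul1r finset.setU0 big1 ?addr0 //.
  by move=> T /negbTE ->; rewrite mul0r.
by move=> T _; rewrite mulrDl.
Qed.

(** The operator form of (1 + x)^n <= exp(n x), valid because all coefficients are nonnegative. *)
Lemma iter_grafting_le_Ex n f S : nneg f ->
  iter n (spreadR grafting) f S <= Ex (fun T => n%:R * Lam T) f S.
Proof.
move=> f0; elim: n S => [|n IH] S.
  by apply: Ex_ge => // T; rewrite mul0r.
have nL0 T : 0 <= n%:R * Lam T by rewrite mulr_ge0.
rewrite (_ : (fun T => n.+1%:R * Lam T) = (fun T => Lam T + n%:R * Lam T)); last first.
  by apply/funext => T; rewrite -natr1; ring.
rewrite Ex_add //= spreadR_grafting; apply: (le_trans (Ex_ge1 _ _ _)) => //.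
  by move=> T; apply: iter_spreadR_ge0 => //; exact: grafting_ge0.
apply: le_Ex => //; exact: Ex_ge0.
Qed.

Variables (N : nat) (kn an : nat -> fn).
Hypothesis an0 : forall n, nneg (an n).
Hypothesis kn0 : forall n, nneg (kn n).
Hypothesis kn_le : forall n (phi : fn), nneg phi ->
  \sum_S kn n S * phi S <= \sum_S an n S * iter n (spreadR grafting) phi S.

Definition layer_sum (mn : nat -> fn) : fn := fun S => \sum_(n < N) mn n S.

Lemma total_ge0 mn : (forall n, nneg (mn n)) -> nneg (layer_sum mn).
Proof. by move=> h S; apply: sumr_ge0. Qed.

Variables (g : fn) (Gm beta : R) (m : nat).
Hypothesis g01 : forall S, 0 <= g S <= 1.
Hypothesis g_inv : forall n S T, an n T != 0 -> g (S :|: T) = g S.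
Hypothesis Gm0 : 0 <= Gm.
Hypothesis beta1 : 1 <= beta.
Hypothesis HG : forall n, (n <= m)%N -> iter n (spreadR grafting) g finset.set0 <= Gm.

(** An exponential moment: a set of layer n is charged the mass of n graftings and a further factor
    [beta] for each of them. It pays for configurations with more than [m] graftings. *)
Definition tilted_mass : R := \sum_(n < N) mass (an n) * (beta * mass grafting) ^+ n.

Lemma tilted_mass_ge0 : 0 <= tilted_mass.
Proof.
apply: sumr_ge0 => n _; rewrite mulr_ge0 ?mass_ge0 // exprn_ge0 // mulr_ge0 ?mass_ge0 //.
  by apply: le_trans beta1.
exact: grafting_ge0.
Qed.

(** [n0] is the number of graftings still pending. Graftings commute with the adjunction of sets, so
    those brought by a new set are added to the pending ones and performed only at the end. *)
Lemma iter_total_step j n0 F : nneg F ->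
  iter n0 (spreadR grafting) (spreadR (layer_sum kn) (iter j (spreadR (layer_sum kn)) F)) finset.set0 <=
  \sum_(n < N) \sum_T an n T *
    iter (n0 + n) (spreadR grafting) (iter j (spreadR (layer_sum kn)) (fun S => F (T :|: S))) finset.set0.
Proof.
move=> F0; set H := iter j _ F.
have H0 : nneg H by apply: iter_spreadR_ge0 => //; exact: total_ge0.
apply: (@le_trans _ _ (iter n0 (spreadR grafting) (fun S => \sum_(n < N) spreadR (an n) (iter n (spreadR grafting) H) S) finset.set0)).
  apply: le_iter_spreadR; first exact: grafting_ge0.
  move=> S; rewrite /spreadR /layer_sum; under eq_bigr do rewrite mulr_suml.
  rewrite exchange_big /=; apply: ler_sum => n _.
  apply: (le_trans (kn_le n (phi := fun T => H (S :|: T)) _)) => //.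
  apply: ler_sum => T _; rewrite ler_wpM2l //.
  by rewrite iter_spreadR_shift [leRHS]iter_spreadR_shift; under eq_fun do rewrite finset.setUA.
have -> : iter n0 (spreadR grafting) (fun S => \sum_(n < N) spreadR (an n) (iter n (spreadR grafting) H) S) finset.set0
   = \sum_(n < N) iter n0 (spreadR grafting) (spreadR (an n) (iter n (spreadR grafting) H)) finset.set0.
  elim: n0 (finset.set0 : {set I}) => //= p IH S; rewrite /spreadR exchange_big /=.
  by apply: eq_bigr => T _; rewrite IH mulr_sumr.
apply: ler_sum => n _; rewrite iter_spreadRC /spreadR; apply: ler_sum => T _.
rewrite finset.set0U -/(spreadR grafting) -iterD ler_wpM2l //.
rewrite iter_spreadR_shift /H le_eqVlt; apply/orP; left; apply/eqP.
congr (iter _ _ _ finset.set0); apply/funext => S.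
by rewrite iter_spreadR_shift [RHS]iter_spreadR_shift; under eq_fun do rewrite -finset.setUA.
Qed.

(* A set of layer n brings n graftings. As long as at most m are used, HG applies;
   beyond that, g <= 1 is paid for by a factor beta per grafting. *)
Lemma iter_total_le j n0 f : (forall S, 0 <= f S <= 1) ->
  (forall S T, Lam T != 0 -> f (S :|: T) = f S) ->
  iter n0 (spreadR grafting) (iter j (spreadR (layer_sum kn)) (fun S => f S * g S)) finset.set0 <=
  iter j (spreadR (layer_sum an)) f finset.set0 * Gm +
    beta ^- m * (beta * mass grafting) ^+ n0 * tilted_mass ^+ j.
Proof.
have b0 : 0 < beta := lt_le_trans ltr01 beta1.
have y0 : 0 <= mass grafting by apply: mass_ge0; exact: grafting_ge0.
have by0 : 0 <= beta * mass grafting by rewrite mulr_ge0 // ltW.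
have bm0 : 0 <= beta ^- m by rewrite invr_ge0 exprn_ge0 // ltW.
have Xi0 := tilted_mass_ge0.
elim: j n0 f => [|j IH] n0 f f01 finv.
  rewrite /= expr0 mulr1 iter_spreadR_invariant; last first.
    move=> S T; have [->|T0] := eqVneq T finset.set0; first by rewrite finset.setU0.
    by rewrite /grafting (negbTE T0) add0r => /finv.
  have /andP[f0 f1] := f01 finset.set0.
  have [n0m|mn0] := leqP n0 m.
    by rewrite ler_wpDr ?mulr_ge0 ?exprn_ge0 // ler_wpM2l ?HG.
  rewrite ler_wpDl ?mulr_ge0 //.
  apply: (@le_trans _ _ (mass grafting ^+ n0)).
    have := iter_spreadR_norm (f := g) (M := 1) n0 grafting_ge0 _ finset.set0.
    have gn S : `|g S| <= 1 by have /andP[h1 h2] := g01 S; rewrite ger0_norm.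
    move=> /(_ gn); rewrite mulr1 => /(le_trans (ler_norm _)) h.
    apply: le_trans h; rewrite ler_piMl // iter_spreadR_ge0 //; first exact: grafting_ge0.
    by move=> S; have /andP[] := g01 S.
  rewrite exprMn mulrA ler_peMl ?exprn_ge0 // ler_pdivlMl ?exprn_gt0 // mulr1.
  exact: ler_weXn2l (ltnW mn0).
have F0 : nneg (fun S => f S * g S).
  by move=> S; have /andP[? _] := f01 S; have /andP[? _] := g01 S; rewrite mulr_ge0.
apply: (le_trans (iter_total_step j n0 F0)).
apply: (@le_trans _ _ (\sum_(n < N) \sum_T an n T *
   (iter j (spreadR (layer_sum an)) (fun S => f (T :|: S)) finset.set0 * Gm +
    beta ^- m * (beta * mass grafting) ^+ (n0 + n) * tilted_mass ^+ j))).
  apply: ler_sum => n _; apply: ler_sum => T _.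
  have [->|anT] := eqVneq (an n T) 0; first by rewrite !mul0r.
  rewrite ler_wpM2l //.
  have -> : (fun S => f (T :|: S) * g (T :|: S)) = (fun S => f (T :|: S) * g S).
    by apply/funext => S; rewrite [T :|: S]finset.setUC (g_inv _ anT) finset.setUC.
  apply: (IH (n0 + n)%N (fun S => f (T :|: S))) => // S T' LT'.
  by rewrite finset.setUA finv.
under eq_bigr => n _.
  under eq_bigr do rewrite mulrDr; rewrite big_split /= -[X in _ + X]mulr_suml.
  over.
rewrite big_split /=; apply: lerD.
  rewrite /= /spreadR /layer_sum mulr_suml.
  under [leRHS]eq_bigr do (rewrite mulr_suml mulr_suml).
  rewrite exchange_big /=; apply: ler_sum => n _; apply: ler_sum => T _.
  by rewrite finset.set0U mulrA [iter j _ f n]iter_spreadR_shift.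
rewrite le_eqVlt; apply/orP; left; apply/eqP.
transitivity (\sum_(n < N) (mass (an n) * (beta * mass grafting) ^+ n) *
    (beta ^- m * (beta * mass grafting) ^+ n0 * tilted_mass ^+ j)).
  by apply: eq_bigr => n _; rewrite exprD -/(mass _); ring.
by rewrite -mulr_suml -/tilted_mass exprS; ring.
Qed.

Lemma pois_total_le f : (forall S, 0 <= f S <= 1) ->
  (forall S T, Lam T != 0 -> f (S :|: T) = f S) ->
  (forall n S, an n S <= kn n S) ->
  pois (layer_sum kn) (fun S => f S * g S) finset.set0 <=
  pois (layer_sum kn) f finset.set0 * Gm +
    beta ^- m * expR (tilted_mass - mass (layer_sum kn)).
Proof.
move=> f01 finv ak; have f0 S : 0 <= f S by have /andP[] := f01 S.
have a0 := total_ge0 an0; have k0 := total_ge0 kn0.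
apply: (@le_trans _ _ (expR (- mass (layer_sum kn)) *
   (Ex (layer_sum an) f finset.set0 * Gm + beta ^- m * expR tilted_mass))).
  rewrite ler_wpM2l ?expR_ge0 //.
  pose u n := series (ex_coeff (layer_sum an) f finset.set0) n * Gm + beta ^- m * series (exp_coeff tilted_mass) n.
  have u_cvg : u n @[n --> \oo] --> Ex (layer_sum an) f finset.set0 * Gm + beta ^- m * expR tilted_mass.
    apply: cvgD; first by apply: cvgM; [exact: Ex_cvg|exact: cvg_cst].
    by apply: cvgM; [exact: cvg_cst|exact: is_cvg_series_exp_coeff].
  rewrite -(cvg_lim _ u_cvg) //; apply: ler_lim; [exact: Ex_cvg|by apply/cvg_ex; eexists; exact: u_cvg|].
  apply: nearW => n; rewrite /u /series /= mulr_suml mulr_sumr -big_split.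
  apply: ler_sum => j _ /=; rewrite /ex_coeff /exp_coeff.
  rewrite mulrAC [X in _ + X]mulrA -mulrDl ler_wpM2r ?invr_ge0 //.
  have := iter_total_le j 0 f01 finv; by rewrite expr0 mulr1.
rewrite mulrDr; apply: lerD; last first.
  by rewrite mulrCA -expRD addrC.
rewrite mulrA ler_wpM2r // ler_wpM2l ?expR_ge0 //; apply: le_Ex => // S.
by apply: ler_sum => n _; exact: ak.
Qed.

End grafting.

End poisson_functional.

(** * Decoupling by grafting *)

Lemma pois_invariant (R : realType) (I : finType) (mu f g : {set I} -> R) (S : {set I}) :
  (forall T, 0 <= mu T) -> (forall S T, mu T != 0 -> f (S :|: T) = f S) ->
  pois mu (fun T => f T * g T) S = f S * pois mu g S.
Proof.
move=> mu0 fi; rewrite -poisZ // /pois /Ex; congr (_ * _); congr (limn (series _)).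
by apply/funext => j; rewrite /ex_coeff iter_spreadR_invariant // iter_spreadRZ.
Qed.

(* In the application, [kn n] are the loops with n excursions from the first ball and
   [an n] those which avoid the second one; [b] are the loops that avoid the first
   ball, [b'] those among them with between 1 and m excursions from the second one. *)
Section decoupling.
Context {R : realType} (I : finType).
Notation fn := ({set I} -> R).
Implicit Types (f g : fn) (S T U : {set I}).
Notation nneg m := (forall S : {set I}, 0 <= m S).

Variables (de eta beta : R) (m : nat) (kn an : nat -> fn) (b b' rest Lam rho : fn).
Hypothesis de0 : 0 < de.
Hypothesis de1 : de <= 1.
Hypothesis eta0 : 0 <= eta.
Hypothesis beta1 : 1 <= beta.
Hypothesis kn0 : forall n, nneg (kn n).
Hypothesis an0 : forall n, nneg (an n).
Hypothesis b'0 : nneg b'.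
Hypothesis b'b : forall S, b' S <= b S.
Hypothesis rest0 : nneg rest.
Hypothesis Lam0 : nneg Lam.
Hypothesis rho0 : nneg rho.
Hypothesis an_le : forall n S, an n S <= kn n S.
Hypothesis kn_le : forall n (phi : fn), nneg phi ->
  \sum_S kn n S * phi S <= \sum_S an n S * iter n (spreadR (grafting Lam)) phi S.
Hypothesis Lam_le : forall S, Lam S <= eta * b' S + rho S.
Hypothesis eta_small : m%:R * eta <= de * expR (-1).
Hypothesis b'1 : mass b' <= 1.
Hypothesis tilt : \sum_(n < m.+1) mass (an n) * (beta * mass (grafting Lam)) ^+ n <=
  \sum_(n < m.+1) mass (kn n) + 1.

Let b0 : nneg b. Proof. by move=> S; apply: le_trans (b'b S). Qed.

(** Effect of the part [rho] of the grafting intensity that is not dominated by a multiple of [b'];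
    [expR 1] bounds the unnormalised mass of the dominated part. *)
Definition graft_error : R := expR 1 * (expR (m%:R * mass rho) - 1).

Lemma graft_error_ge0 : 0 <= graft_error.
Proof.
by rewrite mulr_ge0 ?expR_ge0 // subr_ge0 -[leLHS]expR0 ler_expR mulr_ge0 ?mass_ge0.
Qed.

Lemma massZ (t : R) (mu : fn) : mass (fun S => t * mu S) = t * mass mu.
Proof. by rewrite /mass mulr_sumr. Qed.

(* Since g vanishes at the empty set, scaling an intensity by t <= 1 gains a factor t. *)
Lemma iter_grafting_le_pois g n : (forall S, 0 <= g S <= 1) -> union_increasing g ->
  g finset.set0 = 0 -> (n <= m)%N ->
  iter n (spreadR (grafting Lam)) g finset.set0 <=
  pois (fun S => de * b S) g finset.set0 + graft_error.
Proof.
move=> g01 gi gS nm; have g0 S : 0 <= g S by have /andP[] := g01 S.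
have e1 : expR (-1) <= 1 :> R by rewrite -[leRHS]expR0 ler_expR; lra.
have h := eta_small; have h0 := de0; have h1 := de1; have M0 := mass_ge0 rho0.
have B0 := mass_ge0 b'0; have B1 := b'1.
have me0 : 0 <= m%:R * eta by rewrite mulr_ge0.
have mb0 S : 0 <= m%:R * eta * b' S by rewrite mulr_ge0.
have mr0 S : 0 <= m%:R * rho S by rewrite mulr_ge0.
have db0 S : 0 <= de * b' S by rewrite mulr_ge0 // ltW.
have x0 : 0 <= expR (m%:R * mass rho) - 1.
  by rewrite subr_ge0 -[leLHS]expR0 ler_expR mulr_ge0.
apply: (@le_trans _ _ (Ex (fun S => m%:R * eta * b' S + m%:R * rho S) g finset.set0)).
  apply: (le_trans (iter_grafting_le_Ex Lam0 n finset.set0 g0)).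
  apply: le_Ex => // [S|S]; first by rewrite mulr_ge0.
  apply: (@le_trans _ _ (m%:R * Lam S)); first by rewrite ler_wpM2r // ler_nat.
  by rewrite -mulrA -mulrDr ler_wpM2l.
rewrite Ex_add //.
apply: (@le_trans _ _ (Ex (fun S => m%:R * eta * b' S) (fun S => g S + (expR (m%:R * mass rho) - 1)) finset.set0)).
  apply: le_Ex => // S; last by rewrite addr_ge0.
  by rewrite -massZ; apply: Ex_le_add.
rewrite (ExD _ (fun=> expR (m%:R * mass rho) - 1)) // Ex_cst // massZ; apply: lerD; last first.
  rewrite /graft_error mulrC ler_wpM2r // ler_expR.
  apply: (@le_trans _ _ (de * expR (-1))); last by nra.
  by nra.
apply: (@le_trans _ _ (pois (fun S => de * b' S) g finset.set0)); last first.
  by apply: le_pois_increasing => // S; rewrite ler_wpM2l // ltW.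
have dn0 : de != 0 by rewrite gt_eqF.
rewrite (_ : (fun S => m%:R * eta * b' S) = (fun S => (m%:R * eta / de) * (de * b' S))); last first.
  by apply/funext => S; field.
(* Here the factor [expR (-1)] of [eta_small] is spent: graftings give an unnormalised exponential,
   and [expR (-1)] is at most the Poisson normalisation because [de * mass b' <= 1]. *)
have t1 : m%:R * eta / de <= expR (-1) by rewrite ler_pdivrMr // (mulrC _ de).
have t0 : 0 <= m%:R * eta / de by rewrite divr_ge0 // ltW.
have t01 : 0 <= m%:R * eta / de <= 1 by rewrite t0 (le_trans t1).
apply: (le_trans (Ex_scale_le db0 g0 gS t01)).
rewrite /pois ler_wpM2r ?Ex_ge0 // (le_trans t1) // ler_expR massZ.
by rewrite lerN2; nra.
Qed.

Let K := layer_sum m.+1 kn.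
Let K0 : nneg K. Proof. exact: total_ge0. Qed.

Section increasing_observable.
Variables (al : R) (f1 f2 : fn).
Hypothesis al0 : 0 < al.
Hypothesis f1_01 : forall S, 0 <= f1 S <= 1.
Hypothesis f2_01 : forall S, 0 <= f2 S <= 1.
Hypothesis f2i : union_increasing f2.
Hypothesis f1_b : forall S T, b T != 0 -> f1 (S :|: T) = f1 S.
Hypothesis f1_Lam : forall S T, Lam T != 0 -> f1 (S :|: T) = f1 S.
Hypothesis f2_an : forall n S T, an n T != 0 -> f2 (S :|: T) = f2 S.

Lemma tilted_le : tilted_mass Lam m.+1 (fun n S => al * an n S) beta -
  mass (layer_sum m.+1 (fun n S => al * kn n S)) <= al.
Proof.
have -> : mass (layer_sum m.+1 (fun n S => al * kn n S)) = al * \sum_(n < m.+1) mass (kn n).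
  rewrite /mass /layer_sum exchange_big mulr_sumr; apply: eq_bigr => n _.
  by rewrite mulr_sumr.
rewrite /tilted_mass; under eq_bigr do rewrite massZ -mulrA.
have h := tilt; have h0 := al0; rewrite -mulr_sumr -mulrBr ler_piMr ?(ltW al0) //; lra.
Qed.

(** [S0] is the trace of the loops in [b], on which one conditions. Subtracting [f2 S0] produces an
    increment that vanishes at the empty set, as the scaling argument for graftings requires; the
    constant part separates exactly. *)
Lemma pois_graft S0 : (forall S, f1 (S0 :|: S) = f1 S) ->
  pois (fun S => al * K S) (fun S => f1 S * f2 S) S0 <=
  pois (fun S => al * K S) f1 finset.set0 * pois (fun S => de * b S) f2 S0 +
  (graft_error + beta ^- m * expR al).
Proof.
move=> P0; have aK0 S : 0 <= al * K S by rewrite mulr_ge0 // ltW.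
have dbn S : 0 <= de * b S by rewrite mulr_ge0 // ltW.
pose g S := f2 (S0 :|: S) - f2 S0.
have g01 S : 0 <= g S <= 1.
  have := f2i S0 S; have := f2_01 S0; have := f2_01 (S0 :|: S); rewrite /g; lra.
have gi : union_increasing g by move=> S T; rewrite /g lerD2r finset.setUA f2i.
have gS : g finset.set0 = 0 by rewrite /g finset.setU0 subrr.
have -> : pois (fun S => al * K S) (fun S => f1 S * f2 S) S0 =
   f2 S0 * pois (fun S => al * K S) f1 finset.set0 +
   pois (fun S => al * K S) (fun S => f1 S * g S) finset.set0.
  rewrite /pois ExE0 // -[LHS]/(pois (fun S => al * K S) _ finset.set0) -poisZ // -poisD //.
  by congr pois; apply/funext => S; rewrite P0 /g; ring.
have -> : pois (fun S => de * b S) f2 S0 = f2 S0 + pois (fun S => de * b S) g finset.set0.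
  rewrite /pois ExE0 // -[LHS]/(pois (fun S => de * b S) _ finset.set0).
  rewrite -[X in _ = X + _](pois_cst (f2 S0) finset.set0 dbn) -(poisD (fun=> f2 S0)) //.
  by congr pois; apply/funext => S; rewrite /g subrKC.
have KE : (fun S => al * K S) = layer_sum m.+1 (fun n S => al * kn n S).
  by apply/funext => S; rewrite /K /layer_sum mulr_sumr.
have Gm0 : 0 <= pois (fun S => de * b S) g finset.set0 + graft_error.
  by rewrite addr_ge0 ?graft_error_ge0 // pois_ge0 // => S; have /andP[] := g01 S.
have h : pois (layer_sum m.+1 (fun n S => al * kn n S)) (fun S => f1 S * g S) finset.set0 <=
   pois (layer_sum m.+1 (fun n S => al * kn n S)) f1 finset.set0 *
     (pois (fun S => de * b S) g finset.set0 + graft_error) +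
   beta ^- m * expR (tilted_mass Lam m.+1 (fun n S => al * an n S) beta -
     mass (layer_sum m.+1 (fun n S => al * kn n S))).
  apply: pois_total_le => //.
  - by move=> n S; rewrite mulr_ge0 // ltW.
  - by move=> n S; rewrite mulr_ge0 // ltW.
  - move=> n phi phi0; under eq_bigr do rewrite -mulrA.
    under [leRHS]eq_bigr do rewrite -mulrA.
    by rewrite -!mulr_sumr ler_wpM2l ?(ltW al0) // kn_le.
  - move=> n S T; rewrite mulf_eq0 negb_or => /andP[_ aT].
    by rewrite /g finset.setUA (f2_an _ aT).
  - by move=> n nm; apply: iter_grafting_le_pois.
  - by move=> n S; rewrite ler_wpM2l // ltW.
move: h; rewrite -KE => h.
have /andP[A0 A1] := pois_le1 finset.set0 aK0 f1_01.
have b0' : 0 <= beta ^- m by rewrite invr_ge0 exprn_ge0 // (le_trans ler01 beta1).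
have e := tilted_le; rewrite -KE in e.
have {e} : beta ^- m * expR (tilted_mass Lam m.+1 (fun n S => al * an n S) beta -
     mass (fun S => al * K S)) <= beta ^- m * expR al by rewrite ler_wpM2l // ler_expR.
have : pois (fun S => al * K S) f1 finset.set0 * graft_error <= graft_error.
  by rewrite ler_piMl // graft_error_ge0.
by move: h; lra.
Qed.

(** The loops in [rest] are discarded on the left and put back in the mean of [f1], each at the
    price [al * mass rest]. Conditionally on the loops in [b], [pois_graft] applies, and the
    sprinkling [de * b] superposes with [al * b]. *)
Theorem pois_decouple :
  pois (fun S => al * (K S + b S + rest S)) (fun S => f1 S * f2 S) finset.set0 <=
  pois (fun S => al * (K S + b S + rest S)) f1 finset.set0 *
    pois (fun S => (al + de) * b S) f2 finset.set0 +
  (2 * al * mass rest + graft_error + beta ^- m * expR al).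
Proof.
have aK0 S : 0 <= al * K S by rewrite mulr_ge0 // ltW.
have ab0 S : 0 <= al * b S by rewrite mulr_ge0 // ltW.
have ar0 S : 0 <= al * rest S by rewrite mulr_ge0 // ltW.
have db0 S : 0 <= de * b S by rewrite mulr_ge0 // ltW.
have h0 := al0; have h1 := de0.
set W := (fun S => al * (K S + b S + rest S)).
have WE : W = (fun S => al * rest S + (al * b S + al * K S)).
  by apply/funext => S; rewrite /W; ring.
have abK0 S : 0 <= al * b S + al * K S by rewrite addr_ge0.
have F01 S : 0 <= f1 S * f2 S <= 1.
  have /andP[? ?] := f1_01 S; have /andP[? ?] := f2_01 S.
  by rewrite mulr_ge0 //= mulr_ile1.
set A := pois (fun S => al * K S) f1 finset.set0.
have /andP[A0 A1] : 0 <= A <= 1 by apply: pois_le1.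
have AE : pois (fun S => al * b S + al * K S) f1 finset.set0 = A.
  rewrite (_ : (fun S => _ + _) = (fun S => al * K S + al * b S)); last first.
    by apply/funext => S; rewrite addrC.
  rewrite pois_add // /A; congr (pois _ _ _); apply/funext => S.
  rewrite -[RHS]mulr1 -[X in _ * X](pois_cst 1 S ab0) -(pois_invariant _ _ ab0).
    by congr pois; apply/funext => T; rewrite mulr1.
  by move=> T T'; rewrite mulf_eq0 negb_or => /andP[_ bT]; rewrite f1_b.
have EA : A <= pois W f1 finset.set0 + al * mass rest.
  rewrite WE pois_add // -AE -massZ -lerBlDr; apply: pois_ge_sub => // S.
  exact: pois_le1.
set G := pois (fun S => (al + de) * b S) f2 finset.set0.
have /andP[G0 G1] : 0 <= G <= 1 by apply: pois_le1 => // S; rewrite mulr_ge0 // addr_ge0 // ltW.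
have main : pois (fun S => al * b S + al * K S) (fun S => f1 S * f2 S) finset.set0 <=
   A * G + (graft_error + beta ^- m * expR al).
  rewrite pois_add //.
  set err := graft_error + _.
  have err0 : 0 <= err.
    rewrite addr_ge0 ?graft_error_ge0 // mulr_ge0 ?expR_ge0 // invr_ge0 exprn_ge0 //.
    exact: le_trans ler01 beta1.
  apply: (@le_trans _ _ (pois (fun S => al * b S) (fun S => A * pois (fun S => de * b S) f2 S + err) finset.set0)).
    (* [pois_graft] needs a trace that [f1] does not see. The predicate records this; it holds at
       the empty set and is preserved by adding sets charged by [b]. *)
    apply: (@le_pois_on _ _ (fun S0 => [forall S : {set I}, f1 (S0 :|: S) == f1 S])) => //.
    + move=> S T /forallP PS; rewrite mulf_eq0 negb_or => /andP[_ bT].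
      apply/forallP => S'; rewrite finset.setUAC f1_b //; exact: PS.
    + by move=> S /forallP PS; apply: pois_graft => T; apply/eqP.
    + move=> S; rewrite addr_ge0 // mulr_ge0 // pois_ge0 // => T.
      by have /andP[] := f2_01 T.
    + by apply/forallP => S; rewrite finset.set0U.
  rewrite (poisD _ (fun=> err)) // pois_cst // poisZ // -pois_add //.
  rewrite (_ : (fun S => al * b S + de * b S) = (fun S => (al + de) * b S)) //.
  by apply/funext => S; rewrite mulrDl.
have first : pois W (fun S => f1 S * f2 S) finset.set0 <=
   pois (fun S => al * b S + al * K S) (fun S => f1 S * f2 S) finset.set0 + al * mass rest.
  rewrite WE pois_add // -massZ; apply: pois_le_add => // S; exact: pois_le1.
have r0 : 0 <= al * mass rest by rewrite mulr_ge0 ?mass_ge0 // ltW.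
have : A * G <= (pois W f1 finset.set0 + al * mass rest) * G by rewrite ler_wpM2r.
have : al * mass rest * G <= al * mass rest by rewrite ler_piMr.
by rewrite mulrDl; move: main first; lra.
Qed.

End increasing_observable.

(* Removing the loops that hit the first ball can only increase f2; what remains is
   the increasing case for the observables 1 and 1 - f2. *)
Theorem pois_decouple_decreasing (al al' : R) (f1 f2 : fn) :
  0 <= al -> 0 <= al' <= al -> (al' == 0) || (al' + de == al) ->
  (forall S, 0 <= f1 S <= 1) -> (forall S, 0 <= f2 S <= 1) ->
  (forall S T, f2 (S :|: T) <= f2 S) ->
  (forall S T, b T != 0 -> f1 (S :|: T) = f1 S) ->
  (forall n S T, an n T != 0 -> f2 (S :|: T) = f2 S) ->
  pois (fun S => al * (K S + b S + rest S)) (fun S => f1 S * f2 S) finset.set0 <=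
  pois (fun S => al * (K S + b S + rest S)) f1 finset.set0 *
    pois (fun S => al' * (K S + b S + rest S)) f2 finset.set0 +
  (4 * al * mass rest + graft_error + beta ^- m * expR al).
Proof.
move=> al0 /andP[al'0 al'al] al'E f1_01 f2_01 f2d f1_b f2_an.
have aK0 S : 0 <= al * K S by rewrite mulr_ge0.
have ab0 S : 0 <= al * b S by rewrite mulr_ge0.
have ar0 S : 0 <= al * rest S by rewrite mulr_ge0.
have bm0 : 0 <= beta ^- m by rewrite invr_ge0 exprn_ge0 // (le_trans ler01 beta1).
have ge0 := graft_error_ge0.
have bal0 : 0 <= beta ^- m * expR al by rewrite mulr_ge0 ?expR_ge0.
have r0 : 0 <= mass rest by exact: mass_ge0.
set W := (fun S => al * (K S + b S + rest S)).
have WE : W = (fun S => al * rest S + (al * K S + al * b S)).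
  by apply/funext => S; rewrite /W; ring.
have abK0 S : 0 <= al * K S + al * b S by rewrite addr_ge0.
have F01 S : 0 <= f1 S * f2 S <= 1.
  have /andP[? ?] := f1_01 S; have /andP[? ?] := f2_01 S.
  by rewrite mulr_ge0 //= mulr_ile1.
have f10 S : 0 <= f1 S by have /andP[] := f1_01 S.
have f1_ab S T : al * b T != 0 -> f1 (S :|: T) = f1 S.
  by rewrite mulf_eq0 negb_or => /andP[_ bT]; rewrite f1_b.
set A := pois (fun S => al * K S + al * b S) f1 finset.set0.
set G := pois (fun S => al * b S) f2 finset.set0.
have /andP[G0 G1] : 0 <= G <= 1 by apply: pois_le1.
have EA : A <= pois W f1 finset.set0 + al * mass rest.
  rewrite WE pois_add // -massZ -lerBlDr; apply: pois_ge_sub => // S.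
  exact: pois_le1.
have AE : A = pois (fun S => al * K S) f1 finset.set0.
  rewrite /A pois_add //; congr (pois _ _ _); apply/funext => S.
  rewrite -[RHS]mulr1 -[X in _ * X](pois_cst 1 S ab0) -(pois_invariant _ _ ab0) //.
  by congr pois; apply/funext => T; rewrite mulr1.
have main : pois (fun S => al * K S + al * b S) (fun S => f1 S * f2 S) finset.set0 <= A * G.
  rewrite pois_add // AE mulrC -poisZ //; apply: le_pois => // S; last by rewrite mulr_ge0.
  rewrite pois_invariant // mulrC ler_wpM2r // /G {1}/pois ExE0 //.
  rewrite ler_wpM2l ?expR_ge0 //; apply: le_Ex => // T; first by rewrite finset.setUC f2d.
  by have /andP[] := f2_01 T.
have first : pois W (fun S => f1 S * f2 S) finset.set0 <=
   pois (fun S => al * K S + al * b S) (fun S => f1 S * f2 S) finset.set0 + al * mass rest.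
  rewrite WE pois_add // -massZ; apply: pois_le_add => // S; exact: pois_le1.
set G' := pois (fun S => al' * _) f2 finset.set0.
have a'r : al' * mass rest <= al * mass rest by rewrite ler_wpM2r.
have GG' : G <= G' + (2 * al' * mass rest + graft_error + beta ^- m * expR al).
  have [a0|/negPf a0] := eqVneq al' 0.
    have -> : G' = f2 finset.set0.
      rewrite /G' a0 (_ : (fun S => _) = (fun=> 0)); last by apply/funext => S; rewrite mul0r.
      apply/eqP; rewrite eq_le; apply/andP; split.
        have := @pois_le_add _ _ (fun=> 0) f2 finset.set0 (fun=> lexx 0) f2_01.
        by rewrite /mass big1 // addr0.
      have := @pois_ge_sub _ _ (fun=> 0) f2 finset.set0 (fun=> lexx 0) f2_01.
      by rewrite /mass big1 // subr0.
    apply: (@le_trans _ _ (f2 finset.set0)).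
      rewrite -[leRHS](pois_cst (f2 finset.set0) finset.set0 ab0); apply: le_pois => // S.
        by rewrite -{1}[S]finset.set0U f2d.
      by have /andP[] := f2_01 finset.set0.
    by rewrite lerDl a0; nra.
  move: al'E; rewrite a0 /= => /eqP al'E.
  have a'0 : 0 < al' by rewrite lt_neqAle eq_sym a0.
  have a'W0 S : 0 <= al' * (K S + b S + rest S) by rewrite mulr_ge0 // !addr_ge0.
  have h01 S : 0 <= 1 - f2 S <= 1 by have := f2_01 S; lra.
  have h : pois (fun S => al' * (K S + b S + rest S)) (fun S => 1 * (1 - f2 S)) finset.set0 <=
      pois (fun S => al' * (K S + b S + rest S)) (fun=> 1) finset.set0 *
        pois (fun S => (al' + de) * b S) (fun S => 1 - f2 S) finset.set0 +
      (2 * al' * mass rest + graft_error + beta ^- m * expR al').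
    apply: pois_decouple => //.
    - by move=> S; rewrite lexx ler01.
    - by move=> S T; rewrite lerD2l lerN2 f2d.
    - by move=> n S T aT; rewrite (f2_an _ _ _ aT).
  have oneB mu : nneg mu -> pois mu (fun S => 1 - f2 S) finset.set0 = 1 - pois mu f2 finset.set0.
    move=> mu0; rewrite -[X in _ = X - _](pois_cst 1 finset.set0 mu0) -mulN1r -poisZ //.
    rewrite -(poisD (fun=> 1)) //; congr pois; apply/funext => S; by rewrite mulN1r.
  move: h; rewrite al'E (pois_cst 1) // mul1r.
  rewrite (_ : (fun S => 1 * (1 - f2 S)) = (fun S => 1 - f2 S)); last first.
    by apply/funext => S; rewrite mul1r.
  rewrite !oneB // -/G -/G'.
  have : beta ^- m * expR al' <= beta ^- m * expR al by rewrite ler_wpM2l // ler_expR.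
  lra.
have /andP[E0 E1] : 0 <= pois W f1 finset.set0 <= 1.
  by apply: pois_le1 => // S; rewrite WE addr_ge0.
have : A * G <= (pois W f1 finset.set0 + al * mass rest) * G by rewrite ler_wpM2r.
have : al * mass rest * G <= al * mass rest by rewrite ler_piMr // mulr_ge0.
set err := 2 * al' * mass rest + graft_error + beta ^- m * expR al in GG'.
have err0 : 0 <= err by rewrite !addr_ge0 // !mulr_ge0.
have : pois W f1 finset.set0 * G <= pois W f1 finset.set0 * (G' + err) by rewrite ler_wpM2l.
have : pois W f1 finset.set0 * err <= err by rewrite ler_piMl.
by rewrite mulrDr mulrDl /err; move: main first; lra.
Qed.

End decoupling.

(** * Finiteness of the mass of loops meeting a finite set *)

Section finite_loop_mass.
Context {R : realType} (d : nat).
Notation V := 'rV[int]_d.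
Local Open Scope ereal_scope.

Lemma box_seq (z : V) (n : nat) : exists F : seq V, forall y, box z n y -> y \in F.
Proof.
have [F hF] := bounded_seq d n; exists [seq (y + z)%R | y <- F] => y hy.
apply/mapP; exists (y - z)%R; last by rewrite subrK.
apply: hF => i; rewrite !mxE -abszE lez_nat; exact: leq_trans (dist_coord y z i) hy.
Qed.

(** Mark the visits to [F]: every loop meeting [F] has at least one mark, and loops rooted at a mark
    [x] are walks from [x] to [x], counted by [green x x]. *)
Lemma loops_hit_finite (c C : R) (F : seq V) : green_estimates d c C ->
  \esum_(t in [set t | has (mem F) t]) (loop_weight t : \bar R) < +oo.
Proof.
move=> [_ C0 _ gC _]; have lw0 := @loop_weight_ge0 R d.
pose M (s : seq V) := if s is x :: _ then x \in F else false.
apply: (@le_lt_trans _ _ (\sum_(x <- undup F) green x x)); last first.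
  apply/lte_sum_pinfty => x _; exact: le_lt_trans (gC x x) (ltry _).
apply: (@le_trans _ _ (\esum_(t in [set: seq V]) (loop_weight t * ((nmark M t)%:R%:E * 1)))).
  rewrite esum_mkcond; apply: le_esum => t _; case: ifPn => [|_]; last first.
    by rewrite mule_ge0 // mule1 lee_fin.
  rewrite inE /= => /(has_nthP 0%R)[i it Fi].
  rewrite mule1 -[leLHS]mule1 lee_wpmul2l // lee_fin ler1n /nmark (bigD1 (Ordinal it)) //=.
  by rewrite /rot (drop_nth 0%R) //=; move: Fi => /= ->.
rewrite rotation //; apply: (@le_trans _ _ (\esum_(x in [set` undup F]) green x x)); last first.
  by rewrite esum_seq ?undup_uniq // => x; exact: green_ge0.
rewrite /green esum_esum //.
apply: (esum_inj_le (i := fun s => if s is x :: p then (x, rcons p x) else (0%R, [::]))).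
- by move=> [|x p] //= xF; rewrite mem_undup last_rcons.
- by move=> [|x p] [|y q] //= _ _ [-> /rcons_inj[->]].
- by move=> [|x p] //= _; rewrite mule1 cycle_weight_cons.
- by move=> k.
Qed.

End finite_loop_mass.

(** * Loops around two distant balls *)

Section two_ball_masses.
Context {R : realType} (d : nat).
Notation V := 'rV[int]_d.
Notation loop_weight := (@loop_weight R d).
Notation decay := (@decay R d).
Hypothesis hd : (3 <= d)%N.
Variables (c C : R) (r r' : nat).
Hypothesis est : green_estimates d c C.
Hypothesis r2 : (2 <= r)%N.
Hypothesis Hr : 4 * C ^+ 2 * decay r <= c * decay 2 ^+ 2.
Hypothesis Hr2 : 4 * C * decay r <= 1.
Hypothesis rr' : (2 * r.+1 <= r')%N.
Hypothesis Hq : 4 * (C * decay r') <= decay 2 * lower_const d c * decay (2 * r.+1).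
Variables (I : finType) (tr : seq V -> {set I}).
Hypothesis tr_cat : forall p q, tr (p ++ q) = tr p :|: tr q.
Hypothesis tr_nil : tr [::] = finset.set0.
Variables (L s : nat).
Hypothesis L0 : (0 < L)%N.
Hypothesis hs : (8 * r'.+1 <= s)%N.
Variables (x1 x2 : V).
Hypothesis x12 : dist x1 x2 = (s * L)%N.
Notation B1 := (box x1 L).
Notation B2 := (box x2 L).
Notation D1 := (predC (box x1 (r' * L))).
Notation D2 := (predC (box x2 (r' * L))).
Notation n1 := (nmark (marked B1 D1)).
Notation n2 := (nmark (marked B2 D2)).
Hypothesis tr_out : forall p, all (fun y => ~~ B1 y && ~~ B2 y) p -> tr p = finset.set0.
Notation nneg phi := (forall S : {set I}, 0 <= phi S)%E.
Implicit Types (X Y Z : pred (seq V)) (T : {set I}).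

Let lw0 := @loop_weight_ge0 R d.

Lemma ball_exit (x v : V) : box x L v -> ~~ (predC (box x (r' * L))) v.
Proof.
rewrite /box /= negbK => h; apply: leq_trans h _; rewrite leq_pmull //.
by apply: leq_trans rr'; rewrite muln_gt0.
Qed.

Lemma far_boxes v : B2 v -> D1 v.
Proof.
have [aL aa' a's] := scales r2 rr' L hs.
rewrite /box /= -ltnNge => h; have := dist_triangle v x1 x2; rewrite x12 (dist_sym x1 v).
by move: h a's L0; clear; lia.
Qed.

Definition local X := forall t, X t -> has B1 t || has B2 t.

Lemma local_finite X : local X -> (\esum_(t in [set t | X t]) loop_weight t < +oo)%E.
Proof.
move=> hX; have [F1 hF1] := box_seq x1 L; have [F2 hF2] := box_seq x2 L.
apply: le_lt_trans (loops_hit_finite (F1 ++ F2) est); apply: esum_subset => // t /= /hX.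
case/orP; apply: sub_has => v /= Bv; rewrite mem_cat; first by rewrite hF1.
by rewrite hF2 ?orbT.
Qed.

Definition rmass X T : R := fine (trace_mass tr X T).

Lemma rmass_ge0 X T : 0 <= rmass X T.
Proof. by rewrite fine_ge0 // trace_mass_ge0. Qed.

Lemma rmassE X T : local X -> (rmass X T)%:E = trace_mass tr X T :> \bar R.
Proof.
move=> hX; rewrite fineK // ge0_fin_numE ?trace_mass_ge0 //.
by apply: le_lt_trans (local_finite hX); apply: esum_subset => // t [].
Qed.

Lemma mass_rmass X : local X -> (mass (rmass X))%:E = (\esum_(t in [set t | X t]) loop_weight t)%E :> \bar R.
Proof.
move=> hX; rewrite -(trace_mass_total tr) /mass -sumEFin; apply: eq_bigr => T _.
exact: rmassE.
Qed.

Lemma local_sub X Y : (forall t, X t -> Y t) -> local Y -> local X.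
Proof. by move=> XY hY t /XY /hY. Qed.

Lemma le_rmass X Y T : (forall t, X t -> Y t) -> local Y -> rmass X T <= rmass Y T.
Proof.
move=> XY hY; rewrite -lee_fin !rmassE //; last exact: local_sub hY.
by apply: esum_subset => // t [/XY ? ?].
Qed.

Lemma rmassU X Y Z T : local Z -> (forall t, Z t = X t || Y t) -> (forall t, X t -> ~~ Y t) ->
  rmass Z T = rmass X T + rmass Y T.
Proof.
move=> hZ ZE XY; apply: EFin_inj; rewrite EFinD !rmassE //; last 2 first.
- by apply: local_sub hZ => t; rewrite ZE orbC => ->.
- by apply: local_sub hZ => t; rewrite ZE => ->.
rewrite /trace_mass (esumID [set t | X t]); last by move=> *; exact: lw0.
congr (_ + _)%E; congr (esum _ _); apply/seteqP; split => t /=; rewrite ?ZE.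
- by move=> [[_ ?] ?].
- by move=> [-> ->].
- by move=> [[/orP[->|->] ?] nX].
- by move=> [Yt ->]; rewrite Yt orbT; split => // /XY; rewrite Yt.
Qed.

Lemma rmass_neq0 X T : rmass X T != 0 -> exists2 t, X t & tr t = T.
Proof.
move=> h; apply: contrapT => h'; move: h; rewrite /rmass /trace_mass.
rewrite (_ : [set t | _] = set0) ?esum_set0 ?eqxx //.
by apply/seteqP; split => t //= [Xt tT]; apply: h'; exists t.
Qed.

Lemma n1_local t : (0 < n1 t)%N -> has B1 t. Proof. exact: count_gt0_has. Qed.

Lemma n2_local t : (0 < n2 t)%N -> has B2 t. Proof. exact: count_gt0_has. Qed.

Lemma lower_scale_ge0 : 0 <= lower_const d c * decay (2 * (r * L + L)).
Proof.
by rewrite mulr_ge0 ?decay_ge0 // ltW // (lower_const_gt0 est).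
Qed.

Section tails.
Variables (y y' : V).
Hypothesis yy' : dist y y' = (s * L)%N.
Notation count := (nmark (marked (box y L) (predC (box y (r' * L))))).

Let profile v : \bar R := (escape (box y L) (box y (r * L)) v *
  (lower_const d c * decay (2 * (r * L + L)))%:E)%E.

Let profile_ge0 v : (0 <= profile v)%E.
Proof. by apply: mule_ge0; [exact: escape_ge0|rewrite lee_fin lower_scale_ge0]. Qed.

Lemma ball_tail m :
  (\esum_(t in [set t | (m < count t)%N]) (loop_weight t * (count t)%:R%:E) <= (4^-1 ^+ m)%:E)%E.
Proof.
apply: (@count_tail _ _ _ _ tr_cat tr_nil _ _ (@ball_exit y) profile) => //.
- by move=> v v'; exact: (block_tail est r2 rr' Hq tr L0 hs).
- exact: (block_tail_mass hd est r2 Hr rr' L0 hs yy').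
Qed.

Lemma ball_layer n : (0 < n)%N ->
  (\esum_(t in [set t | count t = n]) (loop_weight t * n%:R%:E) <= (4^-1 ^+ n)%:E)%E.
Proof.
apply: (@layer_tail _ _ _ _ tr_cat tr_nil _ _ (@ball_exit y) profile) => //.
- by move=> v v'; exact: (block_tail est r2 rr' Hq tr L0 hs).
- exact: (block_tail_mass hd est r2 Hr rr' L0 hs yy').
Qed.

End tails.

(** Only the returns are required to avoid the second ball. On the way out, the walk stays within
    distance [r' * L + 1] of [x1], hence away from that ball. *)
Lemma chain_avoid n x q : B1 x -> path (@neighbor d) x q ->
  chain B1 D1 (predC B2) n q -> all (predC B2) q.
Proof.
have [aL aa' a's] := scales r2 rr' L hs.
have far v : (dist v x1 <= (r' * L).+1)%N -> predC B2 v.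
  rewrite /box /= -ltnNge; have := dist_triangle v x1 x2; rewrite x12 (dist_sym x1 v).
  move: a's L0; clear; lia.
elim: n x q => [|n IH] x q Bx /=; first by move=> _ ->.
move=> pq [q1 [q2 [q3 [qE h1 h2 h3]]]]; move: pq; rewrite qE !cat_path => /and3P[p1 p2 p3].
have [q0 [z [q1E Dz hq0]]] := first_hitP h1.
have bx : box x1 (r' * L) x.
  by have := ball_exit Bx; rewrite /= negbK.
have /andP[_ u2] := exit_dist p1 h1 bx.
rewrite !all_cat; apply/and3P; split.
- rewrite q1E all_rcons far /=; last by move: u2; rewrite q1E last_rcons.
  by apply: sub_all hq0 => v; rewrite /= negbK => h; apply: far; exact: leqW.
- have [q0' [z' [q2E Bz hq0']]] := first_hitP h2.
  rewrite q2E all_rcons; apply/andP; split; last by apply: sub_all hq0' => v /andP[].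
  by apply: far; apply: leqW; have := ball_exit Bz; rewrite /= negbK.
- apply: IH p3 h3; exact: first_hit_last h2.
Qed.

Notation smass := (spread_mass c C r' tr L s x1 x2).

(** Multiplication by n passes to loops rooted at a mark, that is to closed chains, where the blocks
    are compared one at a time; the same factor n occurs on both sides. *)
Lemma layer_compare n (phi : {set I} -> \bar R) : (0 < n)%N -> nneg phi ->
  (\esum_(t in [set t | n1 t = n]) (loop_weight t * phi (tr t)) <=
   \esum_(t in [set t | n1 t = n /\ all (predC B2) t])
     (loop_weight t * iter n (spread smass) phi (tr t)))%E.
Proof.
move=> n0 phi0; have BD := @ball_exit x1.
have nE : (0 < n%:R%:E :> \bar R)%E by rewrite lte_fin ltr0n.
have sm0 : nneg smass by move=> T; exact: (spread_mass_ge0 r' est tr s L0 x1 x2).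
have it0 := iter_spread_nneg sm0 n phi0.
rewrite -(@lee_pmul2l _ n%:R%:E) // -marked_loops //; last exact: rotation_invariant_all.
have -> : [set t | n1 t = n] = [set t | n1 t = n /\ predT t].
  by apply/seteqP; split => t /=; [move=> ->|move=> []].
rewrite -(@marked_loops _ _ _ _ tr_cat _ _ predT) //.
rewrite (_ : [set s | [/\ marked B1 D1 s, _ & predT s]] = [set s | marked B1 D1 s /\ n1 s = n]); last first.
  by apply/seteqP; split => t /=; [move=> []|move=> [-> ->]].
apply: (le_trans (marked_le tr_cat tr_nil BD n phi0)).
apply: le_trans (marked_ge tr_cat tr_nil BD it0 n0 _); last first.
  by move=> x q; exact: chain_avoid.
apply: le_esum => x Bx; apply: chain_fun_compare => // x' x'' Phi Phi0 Bx' Bx''.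
exact: (block_spread hd est r2 Hr Hr2 rr' tr_cat L0 hs x12 tr_out).
Qed.

(** The condition [has B1] matters for n = 0: it keeps the loops that meet the first ball without
    leaving the large box and excludes those that miss the ball. *)
Definition layer n : pred (seq V) := fun t => (n1 t == n) && has B1 t.
Definition layer_avoiding n : pred (seq V) := fun t => layer n t && ~~ has B2 t.
Definition second_only : pred (seq V) := fun t => ~~ has B1 t && has B2 t.
Definition second_below m : pred (seq V) := fun t => second_only t && (0 < n2 t <= m)%N.
Definition layers_above m : pred (seq V) := fun t => (m < n1 t)%N.
Definition hitting : pred (seq V) := fun t => has B1 t || has B2 t.

Lemma local_layer n : local (layer n). Proof. by move=> t /andP[_ ->]. Qed.

Lemma local_layer_avoiding n : local (layer_avoiding n).
Proof. by move=> t /andP[/andP[_ ->]]. Qed.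

Lemma local_second_only : local second_only.
Proof. by move=> t /andP[_ ->]; rewrite orbT. Qed.

Lemma local_layers_above m : local (layers_above m).
Proof. by move=> t /(leq_ltn_trans (leq0n _)) /n1_local ->. Qed.

Lemma local_second_below m : local (second_below m).
Proof. by move=> t /andP[/local_second_only]. Qed.

Lemma hitting_split m T : rmass hitting T =
  layer_sum m.+1 (fun n => rmass (layer n)) T + rmass second_only T + rmass (layers_above m) T.
Proof.
have lB1 N : local (fun t => has B1 t && (n1 t < N)%N) by move=> t /andP[->].
have h N : rmass (fun t => has B1 t && (n1 t < N)%N) T = layer_sum N (fun n => rmass (layer n)) T.
  elim: N => [|N IH]; rewrite /layer_sum ?big_ord0 ?big_ord_recr /=.
    apply/eqP; apply: contraT => /rmass_neq0[t]; by rewrite ltn0 andbF.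
  move: IH; rewrite /layer_sum => <-; apply: rmassU => // t.
    by rewrite ltnS leq_eqVlt /layer; case: (has B1 t); rewrite ?andbT ?andbF // orbC.
  by rewrite /layer => /andP[_ h]; rewrite negb_and ltn_eqF.
rewrite -h; have lb : local (has B1) by move=> t ->.
rewrite (rmassU (X := has B1) (Y := second_only)) //; last 2 first.
- by move=> t; rewrite /hitting /second_only; case: (has B1 t).
- by move=> t; rewrite /second_only => ->.
rewrite (rmassU (X := fun t => has B1 t && (n1 t < m.+1)%N) (Y := layers_above m)) //.
- by rewrite addrAC.
- move=> t; rewrite /layers_above ltnS; case: leqP => h'; rewrite ?andbT ?orbF ?andbF //=.
  by apply/n1_local/(leq_ltn_trans _ h').
- by move=> t /andP[_]; rewrite ltnS /layers_above -leqNgt.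
Qed.

Definition count_mass X T : \bar R :=
  (\esum_(t in [set t | X t /\ tr t = T]) (loop_weight t * (n2 t)%:R%:E))%E.

Let lwn t : (0 <= loop_weight t * (n2 t)%:R%:E :> \bar R)%E.
Proof. by rewrite mule_ge0 // lee_fin. Qed.

Let x21 : dist x2 x1 = (s * L)%N. Proof. by rewrite dist_sym. Qed.

Lemma count_mass_ge0 X T : (0 <= count_mass X T)%E.
Proof. exact: esum_ge0. Qed.

Lemma count_mass_fin X T : count_mass X T \is a fin_num.
Proof.
rewrite ge0_fin_numE ?count_mass_ge0 //; apply: le_lt_trans (ltry 1).
apply: le_trans (ball_tail x21 0); rewrite /count_mass (esumID [set t | (0 < n2 t)%N]) //.
rewrite [X in (_ + X)%E]esum1 ?adde0; last first.
  by move=> t [_ /= /negP]; rewrite -eqn0Ngt => /eqP ->; rewrite mule0.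
by apply: esum_subset => // t [].
Qed.

(** [graft 0] is the full grafting intensity. [graft m] is its part from loops with more than [m]
    excursions from the second ball, whose weight [n2] is not bounded by [m]. *)
Definition graft m T : R := coupling d c C r' L s * fine (count_mass (fun t => all (predC B1) t && (m < n2 t)%N) T).

Lemma count_mass_total m : (\sum_T count_mass (fun t => all (predC B1) t && (m < n2 t)%N) T <= (4^-1 ^+ m)%:E)%E.
Proof.
apply: le_trans (ball_tail x21 m).
rewrite -esum_fintype; last by move=> T; exact: count_mass_ge0.
rewrite -esum_fiber //; apply: esum_subset => // t /= /andP[//].
Qed.

Let cp0 : 0 <= coupling d c C r' L s. Proof. exact: (coupling_ge0 r' est s L0). Qed.

Lemma graft_ge0 m T : 0 <= graft m T.
Proof. by rewrite mulr_ge0 ?fine_ge0 ?count_mass_ge0. Qed.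

Lemma mass_graft m : mass (graft m) <= coupling d c C r' L s * 4^-1 ^+ m.
Proof.
rewrite /mass /graft -mulr_sumr ler_wpM2l // -lee_fin -sumEFin.
apply: le_trans (count_mass_total m); rewrite le_eqVlt; apply/orP; left; apply/eqP.
by apply: eq_bigr => T _; rewrite fineK // count_mass_fin.
Qed.

Lemma graft0E T : graft 0 T = coupling d c C r' L s * fine (loop_mass r' tr L x1 x2 T).
Proof.
congr (_ * fine _); rewrite /count_mass [LHS]esum_mkcond [RHS]esum_mkcond.
apply: eq_esum => t _; case: ifPn; case: ifPn => //; rewrite ?inE ?notin_setE /=.
- by move=> h [/andP[h1 _] h2]; exfalso; apply: h.
- move=> [h1 h2] h; have [->|n0] := posnP (n2 t); first by rewrite mule0.
  by exfalso; apply: h; rewrite h1.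
Qed.

(** On loops with at most [m] excursions the weight [n2] is at most [m]. This gives
    [eta = coupling * m]; the other factor [m] in the sprinkling comes from the number of
    graftings. *)
Lemma graft_le m T : graft 0 T <= coupling d c C r' L s * m%:R * rmass (second_below m) T + graft m T.
Proof.
rewrite -mulrA -mulrDr ler_wpM2l // -lee_fin EFinD EFinM rmassE; last exact: local_second_below.
rewrite !fineK ?count_mass_fin // /count_mass (esumID [set t | (m < n2 t)%N]) // addeC.
apply: leeD; last by apply: esum_subset => // t [[/andP[h1 _] h2] h3]; split => //; apply/andP; split.
rewrite /trace_mass -esumZl ?lee_fin // [leLHS]esum_mkcond [leRHS]esum_mkcond; apply: le_esum => t _.
case: ifPn => [|_]; last by case: ifP => // _; rewrite mule_ge0 ?lw0 // lee_fin.
rewrite inE /= => -[[/andP[h1 h2] h3] /negP]; rewrite -leqNgt => h4.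
rewrite mem_set /=; last first.
  by rewrite /second_below /second_only -all_predC h1 (n2_local h2) h2 h4.
by rewrite muleC lee_wpmul2r // lee_fin ler_nat.
Qed.

Lemma layer0_avoid t : layer 0 t -> ~~ has B2 t.
Proof.
move=> /andP[/eqP n0 hB1]; apply/negP => hB2; have : (0 < n1 t)%N.
  apply: (has_count_gt0 (@ball_exit x1)) => //; apply: sub_has hB2 => v; exact: far_boxes.
by rewrite n0.
Qed.

Lemma iter_spreadE n (phi : {set I} -> R) T :
  (iter n (spreadR (grafting (graft 0))) phi T)%:E = iter n (spread smass) (fun T => (phi T)%:E) T.
Proof.
elim: n T => //= n IH T; rewrite /spreadR /spread -sumEFin; apply: eq_bigr => T' _.
rewrite EFinM IH; congr (_ * _)%E; rewrite /grafting /spread_mass EFinD graft0E EFinM fineK //.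
exact: count_mass_fin.
Qed.

Lemma rmass_sum X (phi : {set I} -> R) : local X -> (forall T, 0 <= phi T) ->
  (\sum_T rmass X T * phi T)%:E = (\esum_(t in [set t | X t]) (loop_weight t * (phi (tr t))%:E))%E.
Proof.
move=> hX phi0; rewrite -(trace_mass_sum tr X (Psi := fun T => (phi T)%:E)); last first.
  by move=> T; rewrite lee_fin.
by rewrite -sumEFin; apply: eq_bigr => T _; rewrite EFinM rmassE.
Qed.

Lemma layer_le n (phi : {set I} -> R) : (forall T, 0 <= phi T) ->
  \sum_T rmass (layer n) T * phi T <=
  \sum_T rmass (layer_avoiding n) T * iter n (spreadR (grafting (graft 0))) phi T.
Proof.
move=> phi0; case: n => [|n].
  apply: ler_sum => T _; rewrite ler_wpM2r // le_rmass //; last exact: local_layer_avoiding.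
  by move=> t h; rewrite /layer_avoiding h layer0_avoid.
have g0 := grafting_ge0 (graft_ge0 0).
have it0 := iter_spreadR_ge0 n.+1 g0 phi0.
rewrite -lee_fin (rmass_sum (@local_layer n.+1) phi0) (rmass_sum (@local_layer_avoiding n.+1) it0).
rewrite (_ : [set t | layer n.+1 t] = [set t | n1 t = n.+1]); last first.
  apply/seteqP; split => t /=; first by move=> /andP[/eqP].
  by move=> h; rewrite /layer h eqxx n1_local // h.
rewrite (_ : [set t | layer_avoiding n.+1 t] = [set t | n1 t = n.+1 /\ all (predC B2) t]); last first.
  apply/seteqP; split => t /=; first by move=> /andP[/andP[/eqP -> _]]; rewrite all_predC.
  by move=> [h1 h2]; rewrite /layer_avoiding /layer -all_predC h1 eqxx h2 n1_local // h1.
have ln := @layer_compare n.+1 (fun T => (phi T)%:E) isT (fun T => phi0 T).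
apply: (le_trans ln); apply: le_esum => t _.
by rewrite -iter_spreadE.
Qed.

Lemma mass_second_below m : mass (rmass (second_below m)) <= 1.
Proof.
rewrite -lee_fin mass_rmass; last exact: local_second_below.
apply: le_trans (ball_tail x21 0).
apply: (@le_trans _ _ (\esum_(t in [set t | second_below m t]) (loop_weight t * (n2 t)%:R%:E))%E).
  apply: le_esum => t /andP[_ /andP[h _]].
  by rewrite -[leLHS]mule1 lee_wpmul2l // lee_fin ler1n.
by apply: esum_subset => // t /= /andP[_ /andP[]].
Qed.

Lemma mass_layers_above m : mass (rmass (layers_above m)) <= 4^-1 ^+ m.
Proof.
rewrite -lee_fin mass_rmass; last exact: local_layers_above.
apply: le_trans (ball_tail x12 m); apply: le_esum => t /= h.
by rewrite -[leLHS]mule1 lee_wpmul2l // lee_fin ler1n (leq_ltn_trans _ h).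
Qed.

Lemma mass_layer n : (0 < n)%N -> mass (rmass (layer n)) <= 4^-1 ^+ n.
Proof.
move=> n0; rewrite -lee_fin mass_rmass; last exact: local_layer.
apply: le_trans (ball_layer x12 n0).
apply: (@le_trans _ _ (\esum_(t in [set t | layer n t]) (loop_weight t * n%:R%:E))%E).
  by apply: le_esum => t _; rewrite -[leLHS]mule1 lee_wpmul2l // lee_fin ler1n.
by apply: esum_subset => [t /andP[/eqP]//|t]; rewrite mule_ge0 // lee_fin.
Qed.

Lemma le_mass (mu nu : {set I} -> R) : (forall T, mu T <= nu T) -> mass mu <= mass nu.
Proof. by move=> h; apply: ler_sum. Qed.

Lemma le_layer_avoiding n T : rmass (layer_avoiding n) T <= rmass (layer n) T.
Proof. by apply: le_rmass; [move=> t /andP[]|exact: local_layer]. Qed.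

(** A coupling of at most 1/3 gives grafting mass at most 4/3, so with [beta = 3 / 2] each excursion
    is charged at most 2. Layer n has mass at most 4^-n, and the sum of 2^-n over n >= 1 is at most
    1. *)
Lemma layers_tilt m : coupling d c C r' L s <= 3^-1 ->
  \sum_(n < m.+1) mass (rmass (layer_avoiding n)) * (3 / 2 * mass (grafting (graft 0))) ^+ n <=
  \sum_(n < m.+1) mass (rmass (layer n)) + 1.
Proof.
move=> cp; have y2 : 0 <= 3 / 2 * mass (grafting (graft 0)) <= 2.
  have h1 := mass_graft 0; rewrite expr0 mulr1 in h1.
  have h2 := mass_ge0 (graft_ge0 0); rewrite mass_grafting; lra.
have rm0 X : 0 <= mass (rmass X) by apply: mass_ge0; exact: rmass_ge0.
rewrite !big_ord_recl /= expr0 mulr1 -addrA; apply: lerD; first exact/le_mass/le_layer_avoiding.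
apply: (@le_trans _ _ (\sum_(i < m) 2^-1 ^+ i.+1)).
  apply: ler_sum => i _; rewrite /bump /= add1n.
  have /andP[y0 y1] := y2.
  apply: (@le_trans _ _ (4^-1 ^+ i.+1 * 2 ^+ i.+1)); last by rewrite -exprMn (_ : 4^-1 * 2 = 2^-1 :> R) //; field.
  apply: ler_pM => //; first by rewrite exprn_ge0.
    by apply: le_trans (mass_layer _) => //; apply/le_mass/le_layer_avoiding.
  by rewrite lerXn2r // nnegrE.
apply: (@le_trans _ _ 1); last by rewrite lerDr; apply: sumr_ge0.
suff : \sum_(i < m) 2^-1 ^+ i.+1 + 2^-1 ^+ m = 1 :> R.
  by move=> h; rewrite -[leRHS]h lerDl exprn_ge0.
elim: m => [|m IH]; first by rewrite big_ord0 add0r.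
by rewrite big_ord_recr /= -addrA -[RHS]IH exprS; congr (_ + _); field.
Qed.

(** * The error in terms of the truncation depth m *)

Section decoupling_error.
Variables (de : R) (m : nat).
Hypothesis de0 : 0 < de.
Hypothesis de1 : de <= 1.
Hypothesis cp3 : coupling d c C r' L s <= 3^-1.
Hypothesis cpm : m%:R * (coupling d c C r' L s * m%:R) <= de * expR (-1).
Variables (f1 f2 : {set I} -> R).
Hypothesis f1_01 : forall T, 0 <= f1 T <= 1.
Hypothesis f2_01 : forall T, 0 <= f2 T <= 1.
Hypothesis f1_out : forall T t, ~~ has B1 t -> f1 (T :|: tr t) = f1 T.
Hypothesis f2_out : forall T t, ~~ has B2 t -> f2 (T :|: tr t) = f2 T.

(** 4 for the layers above [m], 1 for more than [m] graftings, and [expR 1 * expR 1] for grafted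
    loops with more than [m] excursions. *)
Definition error_const : R := 5 + expR 1 * expR 1.

Lemma error_le (al x : R) : 0 <= al -> 0 <= x -> x <= 4^-1 ^+ m ->
  4 * al * x + graft_error m (graft m) + (3 / 2) ^- m * expR al <=
  error_const * (expR al * (2 / 3) ^+ m).
Proof.
move=> al0 x0 xm; have q0 : 0 <= (2 / 3) ^+ m :> R by rewrite exprn_ge0 //; lra.
have qE : (3 / 2) ^- m = (2 / 3) ^+ m :> R.
  by rewrite -exprVn; congr (_ ^+ _); field.
have x_q : x <= (2 / 3) ^+ m.
  by apply: (le_trans xm); rewrite lerXn2r ?nnegrE; lra.
have eal : al <= expR al by have := expR_ge1Dx al; lra.
have eal1 : 1 <= expR al by have := expR_ge1Dx al; lra.
have t1 : 4 * al * x <= 4 * (expR al * (2 / 3) ^+ m).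
  rewrite -mulrA ler_wpM2l //; exact: ler_pM.
have e11 := expR_gt0 (1 : R).
set z := m%:R * mass (graft m).
have M0 := mass_ge0 (graft_ge0 m).
have z0 : 0 <= z by rewrite mulr_ge0.
(* The number [m] of graftings is bounded crudely by 2^m, which the tail 4^-m of the excursion count
   absorbs. *)
have zq : z <= (2 / 3) ^+ m.
  apply: (@le_trans _ _ (2 ^+ m * 4^-1 ^+ m)).
    apply: ler_pM => //; first by rewrite -natrX ler_nat ltnW // ltn_expl.
    apply: (le_trans (mass_graft m)); rewrite ler_piMl ?exprn_ge0 //.
    by apply: (le_trans cp3); lra.
  by rewrite -exprMn lerXn2r ?nnegrE; lra.
have z1 : z <= 1 by apply: (le_trans zq); rewrite exprn_ile1 //; lra.
have t2 : graft_error m (graft m) <= expR 1 * expR 1 * (expR al * (2 / 3) ^+ m).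
  rewrite /graft_error -/z -[leRHS]mulrA ler_wpM2l ?(ltW e11) //.
  apply: (@le_trans _ _ (z * expR z)).
    have := expR_ge1Dx (- z); rewrite expRN => h.
    have ez := expR_gt0 z.
    have : (1 - z) * expR z <= 1 by rewrite -ler_pdivlMr ?div1r.
    lra.
  rewrite [leLHS]mulrC; apply: ler_pM => //; first by rewrite ler_expR.
  by apply: (le_trans zq); rewrite ler_peMl.
rewrite qE /error_const; lra.
Qed.

Let rm0 X := @rmass_ge0 X.
Let Lam0 := graft_ge0 0.

Let f1_second T T' : rmass second_only T' != 0 -> f1 (T :|: T') = f1 T.
Proof. by move=> /rmass_neq0[t /andP[h _] <-]; exact: f1_out. Qed.

Let f1_graft T T' : graft 0 T' != 0 -> f1 (T :|: T') = f1 T.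
Proof.
move=> h; have [t ht <-] : exists2 t, ~~ has B1 t & tr t = T'; last exact: f1_out.
apply: contrapT => h'; move: h; rewrite graft0E /loop_mass (_ : [set t | _] = set0).
  by rewrite esum_set0 mulr0 eqxx.
by apply/seteqP; split => t //= [h1 h2]; apply: h'; exists t => //; rewrite -all_predC.
Qed.

Let f2_layer n T T' : rmass (layer_avoiding n) T' != 0 -> f2 (T :|: T') = f2 T.
Proof. by move=> /rmass_neq0[t /andP[_ h] <-]; exact: f2_out. Qed.

Let below_le T : rmass (second_below m) T <= rmass second_only T.
Proof. by apply: le_rmass; [move=> t /andP[]|exact: local_second_only]. Qed.

Let hitE (al : R) : (fun T => al * rmass hitting T) = (fun T => al *
  (layer_sum m.+1 (fun n => rmass (layer n)) T + rmass second_only T + rmass (layers_above m) T)).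
Proof. by apply/funext => T; rewrite (hitting_split m). Qed.

Theorem two_ball_increasing (al : R) : 0 < al -> union_increasing f2 ->
  pois (fun T => al * rmass hitting T) (fun T => f1 T * f2 T) finset.set0 <=
  pois (fun T => al * rmass hitting T) f1 finset.set0 *
    pois (fun T => (al + de) * rmass hitting T) f2 finset.set0 +
  error_const * (expR al * (2 / 3) ^+ m).
Proof.
move=> al0 f2i; have ald : 0 <= al + de by rewrite addr_ge0 // ltW.
have h : pois (fun T => (al + de) * rmass second_only T) f2 finset.set0 <=
   pois (fun T => (al + de) * rmass hitting T) f2 finset.set0.
  apply: le_pois_increasing => // T; first by rewrite mulr_ge0.
    rewrite ler_wpM2l //; apply: le_rmass => // t; by rewrite /hitting => /andP[_ ->]; rewrite orbT.
  by have /andP[] := f2_01 T.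
have E0 : 0 <= pois (fun T => al * rmass hitting T) f1 finset.set0.
  by apply: pois_ge0 => T; [rewrite mulr_ge0 // ltW|have /andP[] := f1_01 T].
apply: (@le_trans _ _ (pois (fun T => al * rmass hitting T) f1 finset.set0 *
   pois (fun T => (al + de) * rmass second_only T) f2 finset.set0 +
   (2 * al * mass (rmass (layers_above m)) + graft_error m (graft m) + (3 / 2) ^- m * expR al))).
  rewrite !hitE; apply: (pois_decouple de0 de1 (eta := coupling d c C r' L s * m%:R)
    (b' := rmass (second_below m)) (Lam := graft 0) (an := fun n => rmass (layer_avoiding n))) => //.
  - by rewrite mulr_ge0.
  - lra.
  - exact: graft_ge0.
  - by move=> n T; exact: le_layer_avoiding.
  - exact: layer_le.
  - exact: graft_le.
  - exact: mass_second_below.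
  - exact: layers_tilt.
apply: lerD; first by rewrite ler_wpM2l.
have M0 : 0 <= mass (rmass (layers_above m)) by apply: mass_ge0.
have := error_le (ltW al0) M0 (mass_layers_above m).
have : 0 <= al * mass (rmass (layers_above m)) by rewrite mulr_ge0 // ltW.
lra.
Qed.

Theorem two_ball_decreasing (al al' : R) : 0 <= al -> 0 <= al' <= al ->
  (al' == 0) || (al' + de == al) -> (forall T T', f2 (T :|: T') <= f2 T) ->
  pois (fun T => al * rmass hitting T) (fun T => f1 T * f2 T) finset.set0 <=
  pois (fun T => al * rmass hitting T) f1 finset.set0 *
    pois (fun T => al' * rmass hitting T) f2 finset.set0 +
  error_const * (expR al * (2 / 3) ^+ m).
Proof.
move=> al0 al'al al'E f2d.
have M0 : 0 <= mass (rmass (layers_above m)) by apply: mass_ge0.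
apply: le_trans (lerD (lexx _) (error_le al0 M0 (mass_layers_above m))).
rewrite !hitE; apply: (pois_decouple_decreasing de0 de1 (eta := coupling d c C r' L s * m%:R)
    (b' := rmass (second_below m)) (Lam := graft 0) (an := fun n => rmass (layer_avoiding n))) => //.
- by rewrite mulr_ge0.
- lra.
- exact: graft_ge0.
- by move=> n T; exact: le_layer_avoiding.
- exact: layer_le.
- exact: graft_le.
- exact: mass_second_below.
- exact: layers_tilt.
Qed.

End decoupling_error.

End two_ball_masses.

(** * The range of the loop soup in a finite window *)

Section poisson_link.
Context {R : realType} (d : nat).
Notation V := 'rV[int]_d.
Notation loop_weight := (@loop_weight R d).

Lemma based_loop_sum (X : pred (seq V)) :
  (\esum_(b in [set b : based_loop d | X (val b)]) (based_loop_weight R b)%:E =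
   \esum_(t in [set t | X t]) loop_weight t)%E.
Proof.
transitivity (\esum_(t in [set t | X t] `&` [set t | is_based_loop t]) loop_weight t)%E.
  rewrite [RHS](@reindex_esum _ _ _ [set b : based_loop d | X (val b)] _ val); last first.
    split.
    - by move=> b /= Xb; split => //; exact: valP.
    - by move=> b b' _ _; exact: val_inj.
    - by move=> t /= [Xt bt]; exists (Sub t bt).
  apply: eq_esum => b _; rewrite /loop_weight /cycle_weight (valP b) -EFinM.
  by rewrite /based_loop_weight.
rewrite esum_mkcondr; apply: eq_esum => t _; case: ifPn => // h.
rewrite /loop_weight /cycle_weight ifN ?mule0 //; apply: contra h => h; by rewrite inE.
Qed.

Definition visiting (D : seq V) : set (loop d) :=
  [set e | exists2 b : based_loop d, \pi_(loop d)%qT b = e & has (mem D) (val b)].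

Lemma loop_measure_visiting (D : seq V) :
  (loop_measure R (visiting D) = \esum_(t in [set t | has (mem D) t]) loop_weight t)%E.
Proof.
rewrite -based_loop_sum /loop_measure /based_loop_measure; congr (esum _ _).
apply/seteqP; split => b /=; last by exists b.
move=> [b' /eqquotP /rot_equivP[k kE]]; rewrite -kE.
by rewrite /rot has_cat orbC -has_cat cat_take_drop.
Qed.

(** The sites of [D] are all unvisited exactly when no point of the process lies in [visiting D], so
    only the one-set Poisson law at 0 is used. *)
Lemma void_probability (alpha : R) (Q : probability (config d) R) (D : seq V) (c C : R) :
  green_estimates d c C -> 0 <= alpha -> range_law alpha Q ->
  measurable [set omega : config d | forall x, x \in D -> omega x = false] ->
  Q [set omega : config d | forall x, x \in D -> omega x = false] =
  (expR (- (alpha * fine (\esum_(t in [set t | has (mem D) t]) loop_weight t)%E)))%:E.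
Proof.
move=> est a0 [disp [W0 [P [N [hN QE]]]]] mD; rewrite QE //.
have fin : (\esum_(t in [set t | has (mem D) t]) loop_weight t)%E \is a fin_num.
  rewrite ge0_fin_numE; first exact: loops_hit_finite est.
  by apply: esum_ge0 => t _; exact: loop_weight_ge0.
have [_ hP _ _] := hN.
have := hP (visiting D); rewrite loop_measure_visiting fin_numM // => /(_ isT 0).
set W := [set w | point_count R N _ w = _].
have -> : W = [set w | forall x, x \in D -> range_indicator (N w) x = false].
  apply/seteqP; split => w /=.
    move=> h x xD; apply/negP; rewrite /range_indicator => /set_mem[b Nb xb].
    have : (((N w (\pi_(loop d)%qT b))%:R)%:E <= point_count R N (visiting D) w)%E.
      rewrite -(@esum_set1 _ _ (\pi_(loop d)%qT b) (fun e => ((N w e)%:R)%:E : \bar R)) ?lee_fin //.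
      apply: esum_subset => [_ ->|e]; last by rewrite lee_fin.
      by exists b => //; apply/hasP; exists x.
    by rewrite h lee_fin ler_nat leqNgt Nb.
  move=> h; rewrite /W /= /point_count esum1 // => e [b <- /hasP[x xb xD]].
  have /negP := negbT (h x xD); rewrite /range_indicator => hx.
  have [->//|Nb] := posnP (N w (\pi_(loop d)%qT b)).
  by exfalso; apply: hx; apply/mem_set; exists b.
move=> ->; rewrite fineM //= /poisson_prob; case: ifPn => [r0|].
  rewrite esum_set1 ?lee_fin ?poisson_pmf_ge0 // /poisson_pmf r0 expr0 fact0 invr1 !mul1r.
  by [].
(* When the rate is not positive, [poisson_prob] falls back to a Dirac mass; the rate is then 0 and
   both sides equal 1. *)
rewrite -leNgt => r0; have -> : alpha * fine (\esum_(t in [set t | has (mem D) t]) loop_weight t)%E = 0.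
  apply/eqP; rewrite eq_le r0 mulr_ge0 // fine_ge0 //.
  by apply: esum_ge0 => t _; exact: loop_weight_ge0.
by rewrite oppr0 expR0 diracE mem_set.
Qed.

(** * Observables of a finite window as Poisson functionals of traces *)

Section finite_window.
Variable F : seq V.
Notation I := (seq_sub F).
Implicit Types (S U : {set I}) (omega : config d).

Definition trace (t : seq V) : {set I} := finset.finset (fun i : I => val i \in t).

Definition window_config (S : {set I}) : config d := fun x => [exists i : I, (i \in S) && (val i == x)].

Definition cell (S : {set I}) : set (config d) := [set omega | forall i : I, omega (val i) = (i \in S)].

Lemma measurable_site (x : V) (b : bool) : measurable [set omega : config d | omega x = b].
Proof.
have h : measurable [set omega : config d | omega x].
  by apply: sub_sigma_algebra; exists x.
case: b; first exact: h.
rewrite (_ : [set _ | _] = ~` [set omega : config d | omega x]); first exact: measurableC.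
by apply/seteqP; split => omega /=; [move=> ->|move/negP/negbTE].
Qed.

Lemma measurable_cell S : measurable (cell S).
Proof.
rewrite (_ : cell S = \bigcap_(i in [set: I]) [set omega : config d | omega (val i) = (i \in S)]).
  by apply: fin_bigcap_measurable => [|i _]; [exact: finite_finset|exact: measurable_site].
by apply/seteqP; split => omega h i; [move=> _; exact: h|exact: h].
Qed.

Lemma measurable_void (D : seq V) : measurable [set omega : config d | forall x, x \in D -> omega x = false].
Proof.
rewrite (_ : [set _ | _] = \bigcap_(x in [set` D]) [set omega : config d | omega x = false]).
  by apply: fin_bigcap_measurable => [|x _]; [exact: finite_seq|exact: measurable_site].
by apply/seteqP; split => omega h x; exact: h.
Qed.

Definition window (omega : config d) : {set I} := finset.finset (fun i : I => omega (val i)).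

Lemma window_configE (omega : config d) x : x \in F -> window_config (window omega) x = omega x.
Proof.
move=> xF; apply/existsP/idP => [[i /andP[]]|ox].
  by rewrite finset.in_set => h /eqP <-.
by exists (SeqSub xF); rewrite finset.in_set ox eqxx.
Qed.

Variable Q : probability (config d) R.

(** Measurability of [f] is not assumed: depending on finitely many sites, [f] is a finite
    combination of indicators of cells. *)
Lemma expectation_window (f : config d -> R) : (forall omega, 0 <= f omega) ->
  depends_on f [set` F] ->
  'E_Q[f]%E = (\sum_S f (window_config S) * fine (Q (cell S)))%:E.
Proof.
move=> f0 hf; rewrite unlock.
under eq_integral => omega _.
  have -> : (f omega)%:E = (\sum_S (f (window_config S) * \1_(cell S) omega)%:E)%E.
    have cellE S : (omega \in cell S) = (S == window omega).
      apply/idP/eqP => [/set_mem h|->].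
        by apply/setP => i; rewrite finset.in_set h.
      by apply/mem_set => i; rewrite finset.in_set.
    rewrite (bigD1 (window omega)) //= big1 ?adde0.
      rewrite indicE cellE eqxx mulr1; congr _%:E; apply: hf => x xF.
      by rewrite window_configE.
    by move=> S /negbTE nS; rewrite indicE cellE nS mulr0.
  over.
rewrite ge0_integral_sum //; last first.
- by move=> S omega _; rewrite lee_fin mulr_ge0.
- move=> S; apply/measurable_EFinP; apply: measurable_funM => //.
  exact: measurable_indic (measurable_cell S).
rewrite -sumEFin; apply: eq_bigr => S _.
rewrite (integralZl_indic _ (fun=> cell S)) //.
- rewrite integral_indic ?setIT ?EFinM ?fineK //; last exact: measurable_cell.
  exact: fin_num_measure (measurable_cell S).
- by move=> /lt_geF; rewrite f0.
- exact: measurable_cell.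
Qed.

Definition window_mass (T : {set I}) : R := fine (trace_mass trace (has (mem F)) T).

Lemma window_mass_ge0 T : 0 <= window_mass T.
Proof. by rewrite fine_ge0 // trace_mass_ge0. Qed.

Variables (c C alpha : R).
Hypothesis est : green_estimates d c C.
Hypothesis alpha0 : 0 <= alpha.
Hypothesis Qlaw : range_law alpha Q.

Lemma window_massE T : (window_mass T)%:E = trace_mass trace (has (mem F)) T.
Proof.
rewrite fineK // ge0_fin_numE ?trace_mass_ge0 //; apply: le_lt_trans (loops_hit_finite F est).
by apply: esum_subset => [t []//|t]; exact: loop_weight_ge0.
Qed.

Definition complement_seq (U : {set I}) : seq V := [seq val i | i <- enum (finset.setC U)].

Lemma has_complement U t : has (mem (complement_seq U)) t = ~~ (trace t \subset U).
Proof.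
apply/hasP/subsetPn => [[x xt /mapP[i]]|[i]].
  rewrite mem_enum finset.in_setC => iU xE; exists i => //.
  by rewrite finset.in_set -xE.
rewrite finset.in_set => it iU; exists (val i) => //.
by apply/mapP; exists i; rewrite ?mem_enum ?finset.in_setC.
Qed.

(** Identifies the exponent of the void function of [U] with the mass of the loops that visit the
    part of the window outside [U]. *)
Lemma hat_complement U : mass window_mass - hat window_mass U =
  fine (\esum_(t in [set t | has (mem (complement_seq U)) t]) loop_weight t)%E.
Proof.
rewrite /mass /hat (bigID (fun T : {set I} => T \subset U)) /= addrAC subrr add0r.
apply: EFin_inj; rewrite fineK; last first.
  rewrite ge0_fin_numE; first exact: loops_hit_finite est.
  by apply: esum_ge0 => t _; exact: loop_weight_ge0.
rewrite big_mkcond -sumEFin.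
transitivity (\sum_T @trace_mass R _ _ trace (has (mem F)) T * (~~ (T \subset U))%:R%:E)%E.
  by apply: eq_bigr => T _; rewrite -window_massE; case: ifP => _; rewrite ?mule1 ?mule0.
rewrite trace_mass_sum; last by move=> T; rewrite lee_fin.
rewrite esum_mkcond [RHS]esum_mkcond; apply: eq_esum => t _.
have hD := has_complement U t.
case: (boolP (trace t \subset U)) hD => [_ /= hD|/subsetPn[i it _] /= hD].
  by rewrite [RHS]ifF ?mule0; [case: ifP|apply/negbTE; rewrite notin_setE /= hD].
rewrite !mem_set ?mule1 //=; apply/hasP; exists (val i); last exact: valP.
by move: it; rewrite finset.in_set.
Qed.

(* Both sides are linear in f, so it suffices to compare them on void events. *)
Lemma expectation_pois (f : config d -> R) : (forall omega, 0 <= f omega) ->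
  depends_on f [set` F] ->
  'E_Q[f]%E = (pois (fun T => alpha * window_mass T) (fun S => f (window_config S)) finset.set0)%:E.
Proof.
move=> f0 hf; rewrite expectation_window //; congr _%:E.
have m0 T : 0 <= alpha * window_mass T by rewrite mulr_ge0 // window_mass_ge0.
apply: (@void_ext _ _ (fun g => \sum_S g S * fine (Q (cell S)))
  (fun g => pois (fun T => alpha * window_mass T) g finset.set0)).
- move=> g; apply: eq_bigr => S _; congr (_ * _).
  rewrite (bigD1 S) //= /dirac_set eqxx mul1r big1 ?addr0 // => T /negbTE ->.
  by rewrite mul0r.
- move=> g; rewrite /pois (finlin_Ex finset.set0 m0) mulr_sumr.
  by apply: eq_bigr => S _; rewrite mulrCA.
move=> U; pose D := complement_seq U.
pose W := [set omega : config d | forall x, x \in D -> omega x = false].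
have mW : measurable W by exact: measurable_void.
have DF x : x \in D -> x \in F by move=> /mapP[i _ ->]; exact: valP.
have := @expectation_window (\1_W) (fun omega => ler0n _ _) _.
rewrite expectation_indic // (void_probability est alpha0 Qlaw mW) => h.
have e0 : subset_indic U (finset.set0 : {set I}) = 1 :> R by rewrite /subset_indic finset.sub0set.
rewrite /pois Ex_void // e0 mulr1 -expRD.
transitivity (\sum_S \1_W (window_config S) * fine (Q (cell S))).
  apply: eq_bigr => S _; congr (_ * _); rewrite indicE; congr ((nat_of_bool _)%:R).
  apply/idP/idP => [SU|/set_mem h'].
    apply/mem_set => x /mapP[i]; rewrite mem_enum finset.in_setC => iU ->.
    apply/negbTE/existsPn => j; apply: contra iU => /andP[jS /eqP /val_inj <-].
    exact: (fintype.subsetP SU).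
  apply/fintype.subsetP => i iS; apply: contraT => iU.
  have /negbT/existsPn/(_ i) : window_config S (val i) = false.
    by apply: h'; apply/mapP; exists i => //; rewrite mem_enum finset.in_setC.
  by rewrite iS eqxx.
apply: EFin_inj; rewrite -h.
  rewrite -hat_complement; congr (expR _)%:E.
  have -> : mass (fun T => alpha * window_mass T) = alpha * mass window_mass by rewrite /mass mulr_sumr.
  have -> : hat (fun T => alpha * window_mass T) U = alpha * hat window_mass U by rewrite /hat mulr_sumr.
  by ring.
move=> omega omega' hh; rewrite !indicE; congr ((nat_of_bool _)%:R).
by apply/idP/idP => /set_mem h'; apply/mem_set => x xD; have := h' x xD; rewrite hh //; exact: DF.
Qed.

End finite_window.

End poisson_link.

(** * Choice of constants and conclusion *)

Section constants.
Context {R : realType} (d : nat).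
Hypothesis hd : (3 <= d)%N.
Notation decay := (@decay R d).

Lemma decay_small (eps : R) (n0 : nat) : 0 < eps -> exists2 n, (n0 <= n)%N & decay n <= eps.
Proof.
move=> e0; pose n := (maxn n0 (Num.truncn eps^-1).+1).
exists n; first exact: leq_maxl.
have n1 : (1 <= n)%N by rewrite leq_max orbT.
have n0' : 0 < n%:R :> R by rewrite ltr0n.
have en : eps^-1 <= n%:R.
  apply: le_trans (ltW (truncnS_gt _)) _; by rewrite ler_nat leq_maxr.
apply: (@le_trans _ _ (n%:R^-1)); last by rewrite -[leRHS]invrK lef_pV2 ?posrE ?invr_gt0.
rewrite /decay -[leRHS]expr1; apply: ler_wiXn2l.
- by rewrite invr_ge0.
- by rewrite invf_le1 // ler1n.
- by rewrite subn_gt0.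
Qed.

Definition coupling_const (c C : R) (r' : nat) : R :=
  2 * C ^+ 2 / (decay 2 ^+ 4 * lower_const d c ^+ 2 * decay r'.+1 ^+ 2).

(** [M ^+ 2] and [kappa ^+ 2] carry the same power of [decay L], so only the separation [s] remains,
    to the power -2 (d - 2). *)
Lemma couplingE (c C : R) (r' L s : nat) : 0 < lower_const d c -> (0 < L)%N -> (0 < s)%N ->
  coupling d c C r' L s = coupling_const c C r' / (s%:R ^+ (d - 2)) ^+ 2.
Proof.
move=> l0 L0 s0; rewrite /coupling /coupling_const -mulSnr !decayM.
have -> : (s%:R ^+ (d - 2)) = (decay s)^-1 by rewrite /decay exprVn invrK.
have h2 := decay_gt0 (R := R) d (isT : (0 < 2)%N).
have hL := decay_gt0 (R := R) d L0; have hs := decay_gt0 (R := R) d s0.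
have hr := decay_gt0 (R := R) d (isT : (0 < r'.+1)%N).
by field; rewrite !gt_eqF.
Qed.

(** [m] is the integer part. The bound 2/3 <= exp(-1/3) is 1 + x <= exp x at x = -1/3, and
    [expR 3^-1] compensates for the rounding. *)
Lemma truncation_depth (q de X : R) : 0 <= q -> 0 <= X -> exists m : nat,
  m%:R <= q * Num.sqrt de * X /\
  (2 / 3) ^+ m <= expR 3^-1 * expR (- (q / 3 * Num.sqrt de * X)).
Proof.
move=> q0 X0; have y0 : 0 <= q * Num.sqrt de * X by rewrite !mulr_ge0 ?sqrtr_ge0.
have /andP[h1 h2] := truncn_itv y0; set m := Num.truncn _ in h1 h2.
exists m; split => //; have e3 := expR_ge1Dx (- 3^-1 : R).
apply: (@le_trans _ _ (expR (- 3^-1) ^+ m)).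
  by apply: lerXn2r; rewrite ?nnegrE ?expR_ge0 //; lra.
rewrite -expRM_natl -expRD ler_expR; move: h2; rewrite -natr1.
lra.
Qed.

End constants.

Section windows.
Context {R : realType} (d : nat).
Notation V := 'rV[int]_d.
Variables (F : seq V) (P : pred V).
Implicit Types (S T : {set seq_sub F}).

Lemma trace_cat p q : trace F (p ++ q) = finset.setU (trace F p) (trace F q).
Proof. by apply/setP => i; rewrite !finset.inE mem_cat. Qed.

Lemma trace_nil : trace F [::] = finset.set0.
Proof. by apply/setP => i; rewrite !finset.inE. Qed.

Lemma window_config_setU S T x :
  window_config (finset.setU S T) x = window_config S x || window_config T x.
Proof.
apply/existsP/orP => [[i /andP[]]|[] /existsP[i /andP[iS ix]]].
- by rewrite finset.in_setU => /orP[] h ix; [left|right]; apply/existsP; exists i; rewrite h.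
- by exists i; rewrite finset.in_setU iS.
- by exists i; rewrite finset.in_setU iS orbT.
Qed.

Lemma window_config_trace t x : window_config (trace F t) x -> x \in t.
Proof. by move=> /existsP[i /andP[]]; rewrite finset.in_set => it /eqP <-. Qed.

Lemma window_config_out (f : config d -> R) S t : depends_on f [set x | P x] -> ~~ has P t ->
  f (window_config (finset.setU S (trace F t))) = f (window_config S).
Proof.
move=> hf nt; apply: hf => x Px; rewrite window_config_setU.
case h : (window_config (trace F t) x); last by rewrite orbF.
by move/hasPn: nt => /(_ x (window_config_trace h)); rewrite Px.
Qed.

Lemma window_config_increasing (f : config d -> R) S T : increasing f ->
  f (window_config S) <= f (window_config (finset.setU S T)).
Proof.
by move=> hf; apply: hf => x; rewrite window_config_setU; case: (window_config S x).
Qed.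

End windows.

Theorem theorem1p1 (R : realType) (d : nat) (hd : (3 <= d)%N) :
  exists (C c : R), 0 < c /\
  forall (alpha delta : R), 0 < alpha -> 0 < delta < 1 ->
  forall (L s : nat), (1 <= L)%N -> (1 <= s)%N ->
  forall (x1 x2 : 'rV[int]_d), `|x1 - x2| = (s * L)%N%:Z ->
  forall (f1 f2 : config d -> R),
    (forall omega, 0 <= f1 omega <= 1) ->
    (forall omega, 0 <= f2 omega <= 1) ->
    depends_on f1 [set x | `|x - x1| <= L%:Z] ->
    depends_on f2 [set x | `|x - x2| <= L%:Z] ->
  (increasing f2 ->
   forall Q Q' : probability (config d) R,
     range_law alpha Q -> range_law (alpha + delta) Q' ->
     ('E_Q[f1 \* f2] <= 'E_Q[f1] * 'E_Q'[f2]
        + (C * expR (alpha - c * Num.sqrt delta * s%:R ^+ (d - 2)))%:E)%E) /\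
  (decreasing f2 ->
   forall Q Q' : probability (config d) R,
     range_law alpha Q -> range_law (Num.max (alpha - delta) 0) Q' ->
     ('E_Q[f1 \* f2] <= 'E_Q[f1] * 'E_Q'[f2]
        + (C * expR (alpha - c * Num.sqrt delta * s%:R ^+ (d - 2)))%:E)%E).
Proof.
have [c [C est]] := green_dist (R := R) hd.
have [c0 C0 _ _ _] := est; have l0 := lower_const_gt0 est.
have dec2 := decay_gt0 (R := R) d (isT : (0 < 2)%N).
(* [r] is fixed first, so that from distance [r * L] a ball of radius L is hit too rarely to spoil
   the lower bounds. *)
have [r r2 [Hr Hr2]] : exists2 r, (2 <= r)%N &
    4 * C ^+ 2 * decay d r <= c * decay d 2 ^+ 2 /\ 4 * C * decay d r <= 1.
  have e0 : 0 < Num.min (c * decay d 2 ^+ 2 / (4 * C ^+ 2)) ((4 * C)^-1).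
    by rewrite lt_min !(divr_gt0, mulr_gt0, invr_gt0, exprn_gt0).
  have [r r2 hr] := decay_small hd 2 e0; exists r => //.
  move: hr; rewrite le_min => /andP[h1 h2]; split.
    by rewrite mulrC -ler_pdivlMr // mulr_gt0 // exprn_gt0.
  by rewrite mulrC -ler_pdivlMr ?div1r // mulr_gt0.
(* [r'] depends on [r]: returning from distance [r' * L] must be unlikely compared with the capacity
   bound at scale [r * L], with ratio 1/4. *)
have [r' rr' Hq] : exists2 r', (2 * r.+1 <= r')%N &
    4 * (C * decay d r') <= decay d 2 * lower_const d c * decay d (2 * r.+1).
  have e0 : 0 < decay d 2 * lower_const d c * decay d (2 * r.+1) / (4 * C).
    by rewrite divr_gt0 ?mulr_gt0 // decay_gt0.
  have [r' r'2 hr] := decay_small hd (2 * r.+1) e0; exists r' => //.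
  by rewrite mulrA mulrC -ler_pdivlMr // mulr_gt0.
pose K0 := coupling_const d c C r'.
have K00 : 0 < K0.
  by rewrite divr_gt0 ?mulr_gt0 ?exprn_gt0 ?decay_gt0.
(* Chosen so that [K0 * q ^+ 2 = expR (-1)]: with [m] at most [q * Num.sqrt de * X], the product of
   [m ^+ 2] and the coupling is at most [de * expR (-1)]. *)
pose q := Num.sqrt (expR (-1) / K0).
have q0 : 0 < q by rewrite sqrtr_gt0 divr_gt0 // expR_gt0.
(* For [s >= s0] the boxes are well separated, and [3 * K0 <= s] brings the coupling below 1/3. *)
pose s0 := (8 * r'.+1 + (Num.truncn (3 * K0)).+1)%N.
(* The first summand serves [s >= s0]; the second makes the error term at least 1 for [s < s0]. The
   rate [q / 3] is [q] times the 1/3 of [truncation_depth]. *)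
exists (error_const * expR 3^-1 + expR (q / 3 * s0%:R ^+ (d - 2))), (q / 3).
split; first by rewrite divr_gt0.
move=> al de al0 /andP[de0 de1] L s L0 s_gt0 x1 x2 x12 f1 f2 f1_01 f2_01 hf1 hf2.
have {}x12 : dist x1 x2 = (s * L)%N by apply/eqP; rewrite -eqz_nat distE x12.
set X := s%:R ^+ (d - 2).
have X1 : 1 <= X by rewrite exprn_ege1 // ler1n.
have X0 : 0 <= X by exact: le_trans X1.
set err := _ * expR (al - _).
have [F1 hF1] := box_seq x1 L; have [F2 hF2] := box_seq x2 L.
pose F := [seq y <- F1 ++ F2 | box x1 L y || box x2 L y].
have FE y : (y \in F) = box x1 L y || box x2 L y.
  rewrite mem_filter mem_cat; case: (boolP (box x1 L y)) => [/hF1 ->//|_] /=.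
  by case: (boolP (box x2 L y)) => [/hF2 ->|//]; rewrite orbT.
have {}hf1 : depends_on f1 [set x | box x1 L x].
  by move=> w w' h; apply: hf1 => x /= hx; apply: h; rewrite /= /box -dist_le.
have {}hf2 : depends_on f2 [set x | box x2 L x].
  by move=> w w' h; apply: hf2 => x /= hx; apply: h; rewrite /= /box -dist_le.
have hf1F : depends_on f1 [set` F].
  by move=> w w' h; apply: hf1 => x /= hx; apply: h; rewrite /= FE hx.
have hf2F : depends_on f2 [set` F].
  by move=> w w' h; apply: hf2 => x /= hx; apply: h; rewrite /= FE hx orbT.
have hf12F : depends_on (f1 \* f2) [set` F].
  by move=> w w' h; rewrite /= (hf1F w w' h) (hf2F w w' h).
have f10 w : 0 <= f1 w by have /andP[] := f1_01 w.
have f20 w : 0 <= f2 w by have /andP[] := f2_01 w.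
have f120 w : 0 <= (f1 \* f2) w by rewrite mulr_ge0.
have f12_01 w : 0 <= f1 w * f2 w <= 1.
  have /andP[? ?] := f1_01 w; have /andP[? ?] := f2_01 w.
  by rewrite mulr_ge0 //= mulr_ile1.
pose lam (a : R) (T : {set seq_sub F}) := a * @window_mass R d F T.
have lam0 a : 0 <= a -> forall T, 0 <= lam a T.
  by move=> a0 T; rewrite mulr_ge0 // window_mass_ge0.
(* Both parts reduce to inequalities between Poisson functionals of traces in the window [F], where
   [a] stands for the intensity after sprinkling. *)
suff main a : 0 <= a ->
   (increasing f2 -> a = al + de ->
      pois (lam al) (fun S => f1 (window_config S) * f2 (window_config S)) finset.set0 <=
      pois (lam al) (fun S => f1 (window_config S)) finset.set0 *
      pois (lam a) (fun S => f2 (window_config S)) finset.set0 + err) /\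
   (decreasing f2 -> a = Num.max (al - de) 0 ->
      pois (lam al) (fun S => f1 (window_config S) * f2 (window_config S)) finset.set0 <=
      pois (lam al) (fun S => f1 (window_config S)) finset.set0 *
      pois (lam a) (fun S => f2 (window_config S)) finset.set0 + err).
  split=> hf Q Q' hQ hQ'.
    have a0 : 0 <= al + de by rewrite addr_ge0 // ltW.
    rewrite (expectation_pois est (ltW al0) hQ f120 hf12F) (expectation_pois est (ltW al0) hQ f10 hf1F).
    rewrite (expectation_pois est a0 hQ' f20 hf2F) -EFinM -EFinD lee_fin.
    by have [h _] := main _ a0; exact: h.
  have a0 : 0 <= Num.max (al - de) 0 by rewrite le_max lexx orbT.
  rewrite (expectation_pois est (ltW al0) hQ f120 hf12F) (expectation_pois est (ltW al0) hQ f10 hf1F).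
  rewrite (expectation_pois est a0 hQ' f20 hf2F) -EFinM -EFinD lee_fin.
  by have [_ h] := main _ a0; exact: h.
move=> a0.
have K1 : 0 <= error_const * expR 3^-1 :> R.
  by rewrite mulr_ge0 ?expR_ge0 // addr_ge0 // mulr_ge0 ?expR_ge0.
(* For s < s0 the error term exceeds 1. *)
have [ss0|ss0] := ltnP s s0.
  have err1 : 1 <= err.
    apply: (@le_trans _ _ (expR (q / 3 * s0%:R ^+ (d - 2)) * expR (al - q / 3 * Num.sqrt de * X))).
      rewrite -expRD -[leLHS]expR0 ler_expR.
      have : q / 3 * Num.sqrt de * X <= q / 3 * s0%:R ^+ (d - 2).
        rewrite -mulrA ler_wpM2l ?divr_ge0 ?(ltW q0) //.
        apply: (@le_trans _ _ X).
          by rewrite ler_piMl // -[leRHS]sqrtr1 ler_wsqrtr // ltW.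
        by apply: lerXn2r; rewrite ?nnegrE ?ler_nat // ltnW.
      have := al0; lra.
    by rewrite /err ler_wpM2r ?expR_ge0 // lerDr.
  have bound : pois (lam al) (fun S => f1 (window_config S) * f2 (window_config S)) finset.set0 <=
      pois (lam al) (fun S => f1 (window_config S)) finset.set0 *
      pois (lam a) (fun S => f2 (window_config S)) finset.set0 + err.
    apply: (@le_trans _ _ 1).
      by have /andP[] := pois_le1 finset.set0 (lam0 _ (ltW al0)) (fun S => f12_01 (window_config S)).
    apply: (le_trans err1); rewrite lerDr mulr_ge0 ?pois_ge0 //; apply: lam0 => //; exact: ltW.
  by split.
have hs : (8 * r'.+1 <= s)%N by apply: leq_trans ss0; rewrite leq_addr.
have cpE := couplingE C r' l0 L0 s_gt0.
have XK : 3 * K0 <= X ^+ 2.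
  have h : 3 * K0 <= s%:R.
    apply: (le_trans (ltW (truncnS_gt _))); rewrite ler_nat.
    by apply: leq_trans ss0; rewrite leq_addl.
  apply: (le_trans h); apply: (@le_trans _ _ X); last by rewrite expr2 ler_peMl.
  by rewrite -[leLHS]expr1; apply: ler_weXn2l; rewrite ?ler1n // subn_gt0.
have XX : 0 < X ^+ 2 by rewrite exprn_gt0 // (lt_le_trans ltr01).
have cp3 : coupling d c C r' L s <= 3^-1.
  by rewrite cpE -/X -/K0 ler_pdivrMr // mulrC ler_pdivlMr // mulrC.
have [m [mq hm]] := truncation_depth de (ltW q0) X0.
have cpm : m%:R * (coupling d c C r' L s * m%:R) <= de * expR (-1).
  rewrite cpE -/X -/K0.
  have -> : m%:R * (K0 / X ^+ 2 * m%:R) = K0 * (m%:R ^+ 2 / X ^+ 2) by ring.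
  have h2 : m%:R ^+ 2 <= q ^+ 2 * de * X ^+ 2.
    rewrite -(sqr_sqrtr (ltW de0)) -!exprMn; apply: lerXn2r; rewrite ?nnegrE ?ler0n //.
    by apply: mulr_ge0 => //; rewrite mulr_ge0 ?sqrtr_ge0 // ltW.
  apply: (@le_trans _ _ (K0 * (q ^+ 2 * de))).
    by rewrite ler_wpM2l ?(ltW K00) // ler_pdivrMr.
  rewrite /q sqr_sqrtr; last by rewrite divr_ge0 ?expR_ge0 // ltW.
  rewrite le_eqVlt; apply/orP; left; apply/eqP; field; by rewrite gt_eqF.
have tr_out (p : seq 'rV[int]_d) : all (fun y => ~~ box x1 L y && ~~ box x2 L y) p ->
    trace F p = finset.set0.
  move=> /allP hp; apply/setP => i; rewrite finset.in_set finset.in_set0.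
  apply/negP => /hp; rewrite -negb_or -FE; apply/negP; rewrite negbK; exact: valP.
have lamE b : lam b = (fun T => b * rmass (R := R) (trace F) (hitting L x1 x2) T).
  apply/funext => T; rewrite /lam /window_mass /rmass; congr (_ * fine (trace_mass _ _ _)).
  apply/funext => t; rewrite /hitting -has_predU; apply: eq_has => y /=; exact: FE.
have errE : error_const * (expR al * (2 / 3) ^+ m) <= err.
  rewrite /err expRD; set u := expR (- _).
  apply: (@le_trans _ _ (error_const * (expR al * (expR 3^-1 * u)))).
    by rewrite ler_wpM2l ?ler_wpM2l ?expR_ge0 // addr_ge0 // mulr_ge0 ?expR_ge0.
  rewrite [leRHS]mulrDl; apply: (@le_trans _ _ (error_const * expR 3^-1 * (expR al * u))).
    by rewrite le_eqVlt; apply/orP; left; apply/eqP; ring.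
  by rewrite lerDl !mulr_ge0 ?expR_ge0.
have f1_out (S : {set seq_sub F}) t : ~~ has (box x1 L) t ->
    f1 (window_config (finset.setU S (trace F t))) = f1 (window_config S).
  exact: window_config_out.
have f2_out (S : {set seq_sub F}) t : ~~ has (box x2 L) t ->
    f2 (window_config (finset.setU S (trace F t))) = f2 (window_config S).
  exact: window_config_out.
split=> hf aE.
- apply: le_trans (lerD (lexx _) errE); rewrite !lamE aE.
  apply: (two_ball_increasing hd est r2 Hr Hr2 rr' Hq (@trace_cat _ F) (@trace_nil _ F) L0 hs x12
    tr_out de0 (ltW de1) cp3 cpm (f1 := fun S => f1 (window_config S)) (f2 := fun S => f2 (window_config S))) => //.
  by move=> S T; exact: window_config_increasing.
- apply: le_trans (lerD (lexx _) errE); rewrite !lamE.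
  have aal : 0 <= a <= al by rewrite a0 aE ge_max (ltW al0) gerBl ltW.
  apply: (two_ball_decreasing hd est r2 Hr Hr2 rr' Hq (@trace_cat _ F) (@trace_nil _ F) L0 hs x12
    tr_out de0 (ltW de1) cp3 cpm (f1 := fun S => f1 (window_config S)) (f2 := fun S => f2 (window_config S))) => //.
  + exact: ltW.
  + by rewrite aE; case: (leP (al - de) 0) => h; rewrite ?eqxx // subrK eqxx orbT.
  + move=> S T; rewrite -lerN2.
    exact: (@window_config_increasing _ _ _ (fun w => - f2 w)).
Qed.
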